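(* Let $k \ge 1$ and $\ell \ge 0$ be integers. There exists $n_0 = n_0(k,\ell)$ such that for all $n \ge n_0$ and all integers $m$ with $$\binom{n}{k} - \binom{n-\ell}{k} \le m \le \binom{n}{k} - \binom{n-\ell}{k} + n - \ell - k + 1,$$ $\mathcal{L}_{n,k}(m)$ is a most probably intersecting $k$-uniform hypergraph on $[n]$ with $m$ sets; that is, for every $p \in [0,1]$ and every $\mathcal{F} \subseteq \binom{[n]}{k}$ with $|\mathcal{F}| = m$, $$\mathbb{P}(\mathcal{F}_p \text{ is intersecting}) \le \mathbb{P}\big(\mathcal{L}_{n,k}(m)_p \text{ is intersecting}\big).$$
   Context: $[n]=\{1,\dots,n\}$, and $\binom{X}{k}$ denotes the set of $k$-element subsets of $X$. A family $\mathcal{F}$ of sets is intersecting if $F_1 \cap F_2 \ne \emptyset$ for all $F_1, F_2 \in \mathcal{F}$ (the empty family is intersecting). For a family $\mathcal{F}$ and $p\in[0,1]$, $\mathcal{F}_p$ denotes the random subfamily obtained by retaining each set of $\mathcal{F}$ independently with probability $p$. The lexicographic order on $\binom{[n]}{k}$ is: for $A \ne B$, $A<B$ if $\min(A \triangle B) \in A$. $\mathcal{L}_{n,k}(m)$ is the family of the first $m$ sets of $\binom{[n]}{k}$ in this order. *)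

(* Defs.v *)
From mathcomp Require Import all_boot all_order all_algebra.
From mathcomp Require Import reals.

Set Implicit Arguments.
Unset Strict Implicit.
Unset Printing Implicit Defensive.

Import Order.TTheory GRing.Theory Num.Theory.

Local Open Scope ring_scope.

(* The ground set [n] = {1, ..., n} is modelled by 'I_n = {0, ..., n-1}, with
   the same (natural) order. *)

Definition ksets (n k : nat) : {set {set 'I_n}} := [set A : {set 'I_n} | #|A| == k].

(* The two members may coincide, so {set0} is not intersecting. *)
Definition intersecting (n : nat) (F : {set {set 'I_n}}) : bool :=
  [forall A in F, forall B in F, A :&: B != set0].

(* Probability that the random subfamily F_p satisfies the event E: the law of
   F_p gives G \subset F the product of p over the retained sets and 1 - p over
   the discarded ones. *)
Definition prob_subfamily (R : realType) (n : nat) (p : R)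
    (F : {set {set 'I_n}}) (E : pred {set {set 'I_n}}) : R :=
  \sum_(G : {set {set 'I_n}} | (G \subset F) && E G)
    \prod_(A in F) (if A \in G then p else 1 - p).

Definition symdiff (n : nat) (A B : {set 'I_n}) : {set 'I_n} :=
  (A :\: B) :|: (B :\: A).

Definition is_min (n : nat) (S : {set 'I_n}) (i : 'I_n) : bool :=
  (i \in S) && [forall j in S, (i <= j)%N].

(* min (A /_\ B) \in A; a minimum exists only if A != B, so this is strict. *)
Definition lex_lt (n : nat) (A B : {set 'I_n}) : bool :=
  [exists i in A, is_min (symdiff A B) i].

Definition lex_le (n : nat) (A B : {set 'I_n}) : bool :=
  (A == B) || lex_lt A B.

Definition lex_family (n k m : nat) : {set {set 'I_n}} :=
  [set A in take m (sort (@lex_le n) (enum (ksets n k)))].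

Definition most_probably_intersecting (R : realType) (n k m : nat)
    (H : {set {set 'I_n}}) : Prop :=
  [/\ H \subset ksets n k,
      #|H| = m
    & forall (p : R) (F : {set {set 'I_n}}),
        0 <= p <= 1 -> F \subset ksets n k -> #|F| = m ->
        prob_subfamily p F (@intersecting n)
          <= prob_subfamily p H (@intersecting n)].

Arguments most_probably_intersecting : clear implicits.

(* Main.v *)
Require Import Defs.
From mathcomp Require Import all_boot all_order all_fingroup all_algebra.
From mathcomp Require Import reals.
From mathcomp Require Import zify.

Set Implicit Arguments.
Unset Strict Implicit.
Unset Printing Implicit Defensive.

(** Expanding the law of the random subfamily by the number [t] of retained
    sets, the probability that it is intersecting is the sum over [t] of
    [p ^ t * (1 - p) ^ (m - t)] times the number [ncl F t] of intersecting
    subfamilies of [F] of size [t], its cliques of size [t].  It therefore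
    suffices that the lexicographic family maximises each of these numbers.
    Write [N], [N2], [N3] for the numbers of [k]-sets through one, two, three
    given points; for [k >= 3] and large [n], [N] is a large multiple of [N2],
    and [N2] of [N3].  The lexicographic family
    consists of all sets meeting the first [l] points (these are [l] full stars)
    and of at most [n - l - k + 1] petals of a sunflower whose kernel is formed by
    the next [k - 1] points ([lex_family_structure]).

    Suppose first that [F] also contains [l] full stars ([ncl_full_stars]).
    Group the cliques by their trace [H] on the remaining sets.  The number of ways to
    complete [H] depends on the family of sets that meet both the centres of the
    stars and every member of [H].  If [H] is a sunflower with a kernel of
    [k - 1] points, relabelling identifies this family with the corresponding one
    for the lexicographic family.  If not, three members of [H] have at most
    [k - 2] common points, and a set meeting all three meets a set [D] of [k - 2]
    points or has two points in a bounded set.  Compared with a kernel of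
    [k - 1] points, one loses about [N2] sets in each star and gains at most
    [O(N3)] sets, hence has fewer cliques ([ncl_core]).

    To reach [l] full stars, exchange sets: if [A] avoids [x] and has fewer
    neighbours in [F] than [x] has degree, replacing [A] by a missing set through
    [x] does not destroy more cliques than it creates.  So [F] may be assumed
    saturated ([exists_saturated]): every member has at least as many neighbours
    as the degree of any incomplete star that it avoids.  For [k >= 3], if [l]
    vertices have degree close to [N], the sets avoiding them have few
    neighbours, and saturation makes the [l] stars full ([saturated_full]).
    If fewer vertices have such a degree, count directly: up to error terms every
    clique lies in a star ([ncl_le_heavy]), and since the degrees of the large
    stars sum to little more than [l * N], convexity of the binomials bounds the
    number of cliques strictly below that of [l] full stars ([few_almost_full]).

    For [k = 2] the additional sets may nearly fill another star, and the
    comparison must be exact.  Saturation makes all large incomplete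
    stars almost equal and lets them cover all edges ([saturated_graph]).  If
    there are at least [l + 2] large stars, convexity decides ([flat_stars]).
    If [l + 1] vertices cover [F], view [F] as the graph of all edges meeting
    them minus some edges, and remove these one at a time: each
    removal destroys at least as many cliques as when all removed edges are at
    one vertex, as they are for the lexicographic family ([ncl_star_cover]). *)

(** * Binomial estimates *)

(** One term of Vandermonde's identity. *)
Lemma bin_mul_le a b i j : 'C(a, i) * 'C(b, j) <= 'C(a + b, i + j).
Proof.
have hi : i < (i + j).+1 by rewrite ltnS leq_addr.
rewrite -binomial.Vandermonde (bigD1 (Ordinal hi)) //= addKn.
exact: leq_addr.
Qed.

Lemma bin_superadd a b r : 0 < r -> 'C(a, r) + 'C(b, r) <= 'C(a + b, r).
Proof.
case: r => // r _; elim: b => [|b IH]; first by rewrite bin0n addn0 addn0.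
rewrite addnS !binS addnA leq_add //.
by apply: leq_bin2l; apply: leq_addl.
Qed.

Lemma bin_mulS q a r : 0 < r -> q * 'C(a, r) <= 'C(q * a, r).
Proof.
move=> r0; elim: q => [|q IH]; first by rewrite mul0n.
rewrite !mulSn; apply: leq_trans (bin_superadd _ _ r0).
by rewrite leq_add2l.
Qed.

(** Moving [b] units from the smaller to the larger argument. *)
Lemma bin_convex p c b r : b <= c <= p ->
  'C(p, r) + 'C(c, r) <= 'C(p + b, r) + 'C(c - b, r).
Proof.
elim: b => [|b IH]; first by rewrite addn0 subn0.
case/andP=> hbc hcp; have {IH} := IH _; rewrite (ltnW hbc) hcp => /(_ isT) IH.
apply: leq_trans IH _; case: r => [|r]; first by rewrite !bin0.
have -> : c - b = (c - b.+1).+1 by rewrite subnSK.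
rewrite addnS !binS -addnA leq_add2l addnC leq_add2r.
by apply: leq_bin2l; lia.
Qed.

(** Each of the [t] factors [(D - i) / (N - i)] of the quotient is at most
    [D / N <= 1]; keep [j] of them. *)
Lemma bin_ratio D N j t : D <= N -> j <= t ->
  'C(D, t) * N ^ j <= 'C(N, t) * D ^ j.
Proof.
move=> hDN hjt.
suff h : D ^_ t * N ^ j <= N ^_ t * D ^ j.
  rewrite -(leq_pmul2r (fact_gt0 t)).
  by rewrite mulnAC bin_ffact [leqRHS]mulnAC bin_ffact.
have base i : D ^_ i * N ^ i <= N ^_ i * D ^ i.
  elim: i => // i IH; rewrite !ffactnSr !expnSr.
  have := leq_mul IH (_ : (D - i) * N <= (N - i) * D).
  rewrite !mulnA.
  have -> : D ^_ i * N ^ i * (D - i) * N = D ^_ i * (D - i) * N ^ i * N by lia.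
  have -> : N ^_ i * D ^ i * (N - i) * D = N ^_ i * (N - i) * D ^ i * D by lia.
  by apply; nia.
rewrite -(subnK hjt); elim: (t - j) => [|i IH]; first exact: base.
rewrite addSn !ffactnSr.
have := leq_mul IH (_ : D - (i + j) <= N - (i + j)); rewrite leq_sub2r // => /(_ isT).
lia.
Qed.

(** * Intersecting subfamilies of a given size *)

Section Cliques.
Variable n : nat.
Implicit Types (F G E W : {set {set 'I_n}}) (A B : {set 'I_n}).

Definition cliques F t : {set {set {set 'I_n}}} :=
  [set Q : {set {set 'I_n}} | [&& Q \subset F, intersecting Q & #|Q| == t]].

Definition ncl F t := #|cliques F t|.

Lemma intersectingP F :
  reflect {in F &, forall A B, A :&: B != set0} (intersecting F).
Proof.
apply: (iffP forall_inP) => [h A B hA hB | h A hA].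
  by have /forall_inP := h _ hA; apply.
by apply/forall_inP => B hB; apply: h.
Qed.

Lemma intersectingS F G : F \subset G -> intersecting G -> intersecting F.
Proof.
move=> /subsetP hs /intersectingP h; apply/intersectingP => A B hA hB.
by apply: h; apply: hs.
Qed.

Lemma star_intersecting x F : {in F, forall A, x \in A} -> intersecting F.
Proof.
move=> h; apply/intersectingP => A B hA hB.
by apply/set0Pn; exists x; rewrite inE !h.
Qed.

Lemma cliquesP F t (Q : {set {set 'I_n}}) :
  reflect [/\ Q \subset F, intersecting Q & #|Q| = t] (Q \in cliques F t).
Proof. by rewrite inE; apply: (iffP and3P) => -[? ?] /eqP. Qed.

Lemma ncl0 F : ncl F 0 = 1.
Proof.
rewrite /ncl -(cards1 (set0 : {set {set 'I_n}})); apply: eq_card => Q.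
rewrite !inE cards_eq0; apply/and3P/eqP => [[_ _ /eqP] //|->].
by split=> //; [exact: sub0set | apply/intersectingP => A B; rewrite inE].
Qed.

Lemma ncl_le_bin F t : ncl F t <= 'C(#|F|, t).
Proof.
rewrite -cards_draws; apply: subset_leq_card; apply/subsetP => Q.
by rewrite !inE => /and3P[-> _ ->].
Qed.

Lemma ncl_star x F t : {in F, forall A, x \in A} -> ncl F t = 'C(#|F|, t).
Proof.
move=> h; rewrite -cards_draws; apply: eq_card => Q; rewrite !inE.
apply: andb_id2l => /subsetP hQ.
by rewrite (@star_intersecting x) // => A /hQ /h.
Qed.

Lemma ncl_sub F G t : F \subset G -> ncl F t <= ncl G t.
Proof.
move=> hs; apply: subset_leq_card; apply/subsetP => Q.
by rewrite !inE => /and3P[h -> ->]; rewrite (subset_trans h hs).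
Qed.

(** [A] itself is left out, so that a clique through [A] is [A] together with a
    clique among its neighbours. *)
Definition nbrs F A := [set B in F | (B != A) && (B :&: A != set0)].

Lemma nbrsP F A B :
  reflect [/\ B \in F, B != A & B :&: A != set0] (B \in nbrs F A).
Proof. by rewrite inE; apply: and3P. Qed.

Lemma nbrs_sub F A : nbrs F A \subset F.
Proof. by apply/subsetP => B /nbrsP[]. Qed.

Lemma ncl_through F A t : A \in F -> A != set0 ->
  #|[set Q in cliques F t.+1 | A \in Q]| = ncl (nbrs F A) t.
Proof.
move=> hA A0; rewrite /ncl.
have inj : {in cliques (nbrs F A) t &, injective (fun Q : {set {set 'I_n}} => A |: Q)}.
  move=> Q1 Q2 /cliquesP[/subsetP h1 _ _] /cliquesP[/subsetP h2 _ _] e.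
  have n1 : A \notin Q1 by apply/negP => /h1 /nbrsP[_]; rewrite eqxx.
  have n2 : A \notin Q2 by apply/negP => /h2 /nbrsP[_]; rewrite eqxx.
  by rewrite -(setU1K n1) e setU1K.
rewrite -(card_in_imset inj); apply: eq_card => Q; rewrite inE.
apply/andP/imsetP => [[/cliquesP[hs /intersectingP hi hc] hAQ]|[R hR ->]].
  exists (Q :\ A); last by rewrite setD1K.
  apply/cliquesP; split.
  - apply/subsetP => B /setD1P[hB hBQ]; apply/nbrsP; split=> //.
      exact: (subsetP hs).
    exact: hi.
  - apply/intersectingP => B C /setD1P[_ hB] /setD1P[_ hC]; exact: hi.
  - by move: hc; rewrite (cardsD1 A) hAQ => -[].
case/cliquesP: hR => /subsetP hs /intersectingP hi hc.
have nA : A \notin R by apply/negP => /hs /nbrsP[_]; rewrite eqxx.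
split; last exact: setU11.
apply/cliquesP; split.
- by apply/subsetP => B /setU1P[-> //|/hs /nbrsP[]].
- apply/intersectingP => B C /setU1P[->|hB] /setU1P[->|hC].
  + by rewrite setIid.
  + by case/nbrsP: (hs _ hC) => _ _; rewrite setIC.
  + by case/nbrsP: (hs _ hB).
  + exact: hi.
- by rewrite cardsU1 nA hc.
Qed.

Lemma ncl_del F A t : A \in F -> A != set0 ->
  ncl F t.+1 = ncl (F :\ A) t.+1 + ncl (nbrs F A) t.
Proof.
move=> hA A0; rewrite -(ncl_through _ hA A0) addnC /ncl.
rewrite -(cardsID [set Q : {set {set 'I_n}} | A \in Q] (cliques F t.+1)); congr (_ + _).
  by apply: eq_card => Q; rewrite !inE.
apply: eq_card => Q; rewrite !inE.
by rewrite subsetD1; case: (A \in Q); rewrite /= ?andbF ?andbT.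
Qed.

(** Union bound over the members of [W] that a clique may contain. *)
Lemma ncl_setU F W t : {in W, forall A, A != set0} ->
  ncl (F :|: W) t.+1 <= ncl F t.+1 + \sum_(A in W) ncl (nbrs (F :|: W) A) t.
Proof.
move=> hW.
rewrite {1}/ncl -(cardsID [set Q : {set {set 'I_n}} | Q \subset F] (cliques (F :|: W) t.+1)).
apply: leq_add.
  apply: subset_leq_card; apply/subsetP => Q.
  rewrite !inE => /andP[/and3P[_ h1 h2] h3]; exact/and3P.
apply: (@leq_trans #|\bigcup_(A in W) [set Q in cliques (F :|: W) t.+1 | A \in Q]|).
  apply: subset_leq_card; apply/subsetP => Q.
  rewrite inE => /andP[]; rewrite inE => /subsetPn[A hA nA] hQ.
  case/cliquesP: (hQ) => hs _ _.
  have /setUP[h|h] := subsetP hs _ hA; first by rewrite h in nA.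
  by apply/bigcupP; exists A => //; rewrite inE hQ.
apply: (@leq_trans (\sum_(A in W) #|[set Q in cliques (F :|: W) t.+1 | A \in Q]|)).
  elim/big_rec2: _ => [|A a b _ IH]; first by rewrite cards0.
  apply: leq_trans (leq_card_setU _ _) _; exact: leq_add.
apply: leq_sum => A hA; rewrite ncl_through ?hW //.
by rewrite inE hA orbT.
Qed.

End Cliques.

Lemma ncl_inj n1 n2 (phi : {set 'I_n1} -> {set 'I_n2})
    (F : {set {set 'I_n1}}) (G : {set {set 'I_n2}}) t :
  injective phi ->
  (forall A B, A :&: B != set0 -> phi A :&: phi B != set0) ->
  {in F, forall A, phi A \in G} -> ncl F t <= ncl G t.
Proof.
move=> inj hi hF; rewrite /ncl.
rewrite -(card_imset (fun Q : {set {set 'I_n1}} => Q \in cliques F t)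
                     (imset_inj inj)).
apply: subset_leq_card; apply/subsetP => _ /imsetP[Q /cliquesP[hs hQ hc] ->].
apply/cliquesP; split.
- by apply/subsetP => _ /imsetP[A hA ->]; apply: hF; apply: (subsetP hs).
- apply/intersectingP => _ _ /imsetP[A hA ->] /imsetP[B hB ->]; apply: hi.
  by move/intersectingP: hQ; apply.
- by rewrite card_imset.
Qed.

(** * Union bounds *)

Lemma card_bigcup_le (I T : finType) (J : {pred I}) (P : I -> {set T}) :
  #|\bigcup_(i in J) P i| <= \sum_(i in J) #|P i|.
Proof.
elim/big_rec2: _ => [|A a b _ IH]; first by rewrite cards0.
apply: leq_trans (leq_card_setU _ _) _; exact: leq_add.
Qed.

Lemma card_bigcup_const (I T : finType) (J : {set I}) (P : I -> {set T}) c :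
  (forall i, i \in J -> #|P i| <= c) -> #|\bigcup_(i in J) P i| <= #|J| * c.
Proof.
move=> h; apply: leq_trans (card_bigcup_le _ _) _.
by rewrite -sum_nat_const; apply: leq_sum.
Qed.

(** A point in [mu] of the sets is counted [mu <= 1 + mu * (mu - 1)] times. *)
Lemma card_bigcup_ge (I T : finType) (J : {set I}) (P : I -> {set T}) c :
  (forall i j, i \in J -> j \in J -> i != j -> #|P i :&: P j| <= c) ->
  \sum_(i in J) #|P i| <= #|\bigcup_(i in J) P i| + #|J| ^ 2 * c.
Proof.
elim: {J}#|J| {-2}J (erefl #|J|) => [|k IH] J hJ h.
  by rewrite (cards0_eq hJ) !big_set0.
have /card_gt0P[i hi] : 0 < #|J| by rewrite hJ.
have hk : #|J :\ i| = k by move: hJ; rewrite (cardsD1 i) hi => -[].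
rewrite (big_setD1 i hi) [in leqRHS](big_setD1 i hi) /=.
have {}IH := IH _ hk (fun a b ha hb => h a b (subsetP (subD1set _ _) a ha)
                                        (subsetP (subD1set _ _) b hb)).
have hI : #|P i :&: \bigcup_(j in J :\ i) P j| <= k * c.
  rewrite -hk big_distrr /=; apply: card_bigcup_const => j /setD1P[hji hj].
  by apply: h => //; rewrite eq_sym.
rewrite cardsU; have := subset_leq_card (subsetIr (P i) (\bigcup_(j in J :\ i) P j)).
move: IH hI; rewrite ?hk ?hJ; nia.
Qed.

(** Counting cliques goes through this bound: once a few members [S] are pinned,
    the others must come from a small family [V]. *)
Lemma card_pinned (T : finType) (S V : {set T}) t :
  #|[set Q : {set T} | [&& #|Q| == t, S \subset Q & Q :\: S \subset V]]|
    <= 'C(#|V|, t - #|S|).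
Proof.
rewrite -cards_draws.
rewrite -(@card_in_imset _ _ (fun Q : {set T} => Q :\: S)).
  apply: subset_leq_card; apply/subsetP => _ /imsetP[Q + ->].
  rewrite !inE => /and3P[/eqP <- h1 ->] /=.
  by rewrite cardsD (setIidPr h1).
move=> Q R; rewrite !inE => /and3P[_ h1 _] /and3P[_ h2 _] e.
by rewrite -(setID Q S) -(setID R S) e (setIidPr h1) (setIidPr h2).
Qed.

(** * Degrees and codegrees of uniform families *)

Section Uniform.
Variables n k : nat.
Implicit Types (F H : {set {set 'I_n}}) (A B P U X : {set 'I_n}) (x y : 'I_n).

Lemma ksetsP A : reflect (#|A| = k) (A \in ksets n k).
Proof. by rewrite inE; apply: eqP. Qed.

Lemma kset_neq0 A : 0 < k -> A \in ksets n k -> A != set0.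
Proof. by move=> k0 /ksetsP h; rewrite -card_gt0 h. Qed.

Lemma card_sup_le P :
  #|[set A in ksets n k | P \subset A]| <= 'C(n - #|P|, k - #|P|).
Proof.
have -> : n - #|P| = #|~: P| by rewrite [RHS]cardsCs setCK card_ord.
apply: leq_trans (card_pinned _ _ _); apply: subset_leq_card.
apply/subsetP => A; rewrite !inE => /andP[-> ->] /=.
by apply/subsetP => x; rewrite !inE => /andP[].
Qed.

Lemma card_sup P : #|P| <= k ->
  #|[set A in ksets n k | P \subset A]| = 'C(n - #|P|, k - #|P|).
Proof.
move=> hP; apply/eqP; rewrite eqn_leq card_sup_le /=.
have -> : n - #|P| = #|~: P| by rewrite [RHS]cardsCs setCK card_ord.
rewrite -cards_draws.
have inj : {in [set A : {set 'I_n} | (A \subset ~: P) & #|A| == k - #|P|] &,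
            injective (fun A => P :|: A)}.
  move=> A B; rewrite !inE => /andP[hA _] /andP[hB _] e.
  have aux (C : {set 'I_n}) : C \subset ~: P -> (P :|: C) :\: P = C.
    move=> hC; rewrite setDUl setDv set0U; apply/setDidPl.
    by rewrite disjoints_subset.
  by rewrite -(aux A) // e aux.
rewrite -(card_in_imset inj); apply: subset_leq_card.
apply/subsetP => _ /imsetP[A + ->]; rewrite !inE => /andP[hA /eqP cA].
rewrite subsetUl andbT cardsU cA.
have -> : P :&: A = set0.
  by apply/setP => x; rewrite !inE; apply/negP => /andP[h1 /(subsetP hA)]; rewrite inE h1.
by rewrite cards0 subn0 subnKC.
Qed.

Definition star F x := [set A in F | x \in A].

Lemma star_sub F x : star F x \subset F.
Proof. by apply/subsetP => A; rewrite inE => /andP[]. Qed.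

Lemma starS F H x : F \subset H -> star F x \subset star H x.
Proof. by move=> /subsetP h; apply/subsetP => A; rewrite !inE => /andP[/h -> ->]. Qed.

Lemma card_star_full x : 0 < k -> #|star (ksets n k) x| = 'C(n.-1, k.-1).
Proof.
move=> k0; have := @card_sup [set x]; rewrite cards1 !subn1 => <- //.
by apply: eq_card => A; rewrite !inE sub1set.
Qed.

Lemma card_star_le F x : 0 < k -> F \subset ksets n k ->
  #|star F x| <= 'C(n.-1, k.-1).
Proof.
by move=> k0 hF; rewrite -(card_star_full x k0); apply/subset_leq_card/starS.
Qed.

(** Demanding two points makes this family smaller than a star by a factor of
    order [n]. *)
Definition duo P U := [set A in ksets n k |
  [exists x in P, exists y in U, [&& x != y, x \in A & y \in A]]].

Lemma duoP P U A :
  reflect (#|A| = k /\ exists x y, [/\ x \in P, y \in U, x != y, x \in A & y \in A])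
          (A \in duo P U).
Proof.
rewrite inE; apply: (iffP andP) => [[/ksetsP h1 /exists_inP[x hx /exists_inP[y hy]]]|].
  by case/and3P=> *; split=> //; exists x, y.
case=> /ksetsP h1 [x [y [hx hy h3 h4 h5]]]; split=> //.
by apply/exists_inP; exists x => //; apply/exists_inP; exists y => //; apply/and3P.
Qed.

Lemma card_duo P U : #|duo P U| <= #|P| * #|U| * 'C(n - 2, k - 2).
Proof.
pose S (p : 'I_n * 'I_n) := [set A in ksets n k | (p.1 != p.2) && ([set p.1; p.2] \subset A)].
apply: (@leq_trans #|\bigcup_(p in setX P U) S p|).
  apply/subset_leq_card/subsetP => A /duoP[/ksetsP hA [x [y [hx hy xy xA yA]]]].
  apply/bigcupP; exists (x, y); first by rewrite inE /= hx.
  by rewrite inE hA /= xy subUset !sub1set xA.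
rewrite -cardsX; apply: card_bigcup_const => -[x y] _; rewrite /S /=.
have [->|xy] := eqVneq x y.
  apply: (@leq_trans 0) => //; rewrite leqn0 cards_eq0; apply/eqP/setP => A.
  by rewrite !inE /= andbF.
have := card_sup_le [set x; y]; rewrite cards2 xy; apply: leq_trans.
by apply/subset_leq_card/subsetP => A; rewrite !inE /= => /andP[-> ->].
Qed.

Lemma card_ge3 U :
  #|[set A in ksets n k | 2 < #|A :&: U|]| <= #|U| ^ 3 * 'C(n - 3, k - 3).
Proof.
pose S (p : 'I_n * 'I_n * 'I_n) := [set A in ksets n k |
  (#|[set p.1.1; p.1.2; p.2]| == 3) && ([set p.1.1; p.1.2; p.2] \subset A)].
apply: (@leq_trans #|\bigcup_(p in setX (setX U U) U) S p|).
  apply/subset_leq_card/subsetP => A; rewrite inE => /andP[hA].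
  case/card_gt2P => x [y [z [[hx hy hz] [xy yz zx]]]].
  move: hx hy hz; rewrite !inE => /andP[xA xU] /andP[yA yU] /andP[zA zU].
  apply/bigcupP; exists (x, y, z); first by rewrite !inE /= xU yU.
  rewrite inE hA /= !subUset !sub1set xA yA zA !andbT.
  by rewrite -setUA cardsU1 !inE cards2 negb_or xy [x == z]eq_sym zx yz.
have -> : #|U| ^ 3 = #|setX (setX U U) U| by rewrite !cardsX; lia.
apply: card_bigcup_const => -[[x y] z] _; rewrite /S /=.
have [e|ne] := eqVneq #|[set x; y; z]| 3; last first.
  apply: (@leq_trans 0) => //; rewrite leqn0 cards_eq0; apply/eqP/setP => A.
  by rewrite !inE /= andbF.
have := card_sup_le [set x; y; z]; rewrite e; apply: leq_trans.
by apply/subset_leq_card/subsetP => A; rewrite !inE /= => /andP[-> ->].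
Qed.

(** * The families of all sets meeting a given set *)

Definition hit X := [set A in ksets n k | A :&: X != set0].

Lemma hitP X A : reflect (#|A| = k /\ exists2 x, x \in A & x \in X) (A \in hit X).
Proof.
rewrite inE; apply: (iffP andP) => [[/ksetsP h1 /set0Pn[x]]|[/ksetsP h1 [x xA xX]]].
  by rewrite inE => /andP[*]; split=> //; exists x.
by split=> //; apply/set0Pn; exists x; rewrite inE xA.
Qed.

Lemma hit_sub X : hit X \subset ksets n k.
Proof. by apply/subsetP => A; rewrite inE => /andP[]. Qed.

Lemma hitS X U : X \subset U -> hit X \subset hit U.
Proof.
move=> /subsetP h; apply/subsetP => A /hitP[hA [x xA /h xU]].
by apply/hitP; split=> //; exists x.
Qed.

Lemma hit_bigcup X : hit X = \bigcup_(x in X) star (ksets n k) x.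
Proof.
apply/setP => A; apply/hitP/bigcupP => [[/ksetsP hA [x xA xX]]|[x xX]].
  by exists x => //; rewrite inE hA.
by rewrite inE => /andP[/ksetsP hA xA]; split=> //; exists x.
Qed.

Lemma card_hit X : #|hit X| = 'C(n, k) - 'C(n - #|X|, k).
Proof.
have h1 : #|ksets n k| = 'C(n, k).
  rewrite -[in RHS](card_ord n) -cardsT -cards_draws.
  by apply: eq_card => A; rewrite !inE subsetT.
have h2 : #|ksets n k :\: hit X| = 'C(n - #|X|, k).
  have -> : n - #|X| = #|~: X| by rewrite [RHS]cardsCs setCK card_ord.
  rewrite -cards_draws; apply: eq_card => A; rewrite !inE.
  rewrite setI_eq0 disjoints_subset negb_and negbK.
  by case: (#|A| == k); rewrite ?andbT ?andbF.
rewrite -h1 -h2 -(cardsID (hit X) (ksets n k)) (setIidPr (hit_sub X)).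
by rewrite addnK.
Qed.

Lemma card_hit_le X : 0 < k -> #|hit X| <= #|X| * 'C(n.-1, k.-1).
Proof.
move=> k0; rewrite hit_bigcup; apply: card_bigcup_const => x _.
by rewrite card_star_full.
Qed.

Lemma card_two_stars F x y : F \subset ksets n k -> x != y ->
  #|star F x :&: star F y| <= 'C(n - 2, k - 2).
Proof.
move=> /subsetP hF xy; have := card_sup_le [set x; y]; rewrite cards2 xy.
apply: leq_trans; apply/subset_leq_card/subsetP => A.
rewrite !inE subUset !sub1set => /andP[/andP[/hF + ->] /andP[_ ->]].
by rewrite inE => ->.
Qed.

Lemma sum_star_le F X : F \subset ksets n k ->
  \sum_(x in X) #|star F x| <= #|F :&: hit X| + #|X| ^ 2 * 'C(n - 2, k - 2).
Proof.
move=> hF; apply: leq_trans (@card_bigcup_ge _ _ X (star F) 'C(n - 2, k - 2) _) _.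
  by move=> x y _ _; apply: card_two_stars.
rewrite leq_add2r; apply/subset_leq_card/subsetP => A /bigcupP[x xX].
rewrite !inE => /andP[hA xA]; rewrite hA.
have := subsetP hF _ hA; rewrite inE => ->.
by apply/set0Pn; exists x; rewrite inE xA.
Qed.

(** The stars at the points of [X] overlap only in cliques of sets containing
    two points. *)
Lemma ncl_hit_ge X t : 0 < k ->
  #|X| * 'C('C(n.-1, k.-1), t) <= ncl (hit X) t + #|X| ^ 2 * 'C('C(n - 2, k - 2), t).
Proof.
move=> k0.
pose P x := [set Q : {set {set 'I_n}} | (Q \subset star (ksets n k) x) & (#|Q| == t)].
have cP x : #|P x| = 'C('C(n.-1, k.-1), t) by rewrite cards_draws card_star_full.
rewrite -sum_nat_const -(eq_bigr _ (fun x _ => cP x)).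
apply: leq_trans (@card_bigcup_ge _ _ X P 'C('C(n - 2, k - 2), t) _) _.
  move=> x y _ _ xy; apply: leq_trans (leq_bin2l _ (card_two_stars (subxx _) xy)).
  rewrite -cards_draws; apply/subset_leq_card/subsetP => Q.
  by rewrite !inE subsetI => /andP[/andP[-> ->] /andP[-> _]].
rewrite leq_add2r; apply/subset_leq_card/subsetP => Q /bigcupP[x xX].
rewrite inE => /andP[hQ /eqP cQ]; apply/cliquesP; split=> //.
  apply: subset_trans hQ _; apply/subsetP => A; rewrite !inE => /andP[-> xA].
  by apply/set0Pn; exists x; rewrite inE xA.
by apply: (@star_intersecting _ x) => A /(subsetP hQ); rewrite inE => /andP[].
Qed.

Lemma sum_deg F : F \subset ksets n k -> \sum_x #|star F x| = k * #|F|.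
Proof.
move=> /subsetP hF.
have h x : #|star F x| = \sum_(A in F) (x \in A : nat).
  by rewrite -sum1dep_card big_mkcondr; apply: eq_bigr => A _; case: (x \in A).
rewrite (eq_bigr _ (fun x _ => h x)) exchange_big /= mulnC -sum_nat_const.
apply: eq_bigr => A /hF /ksetsP <-; rewrite -sum1_card [RHS]big_mkcond.
by apply: eq_bigr => x _; case: (x \in A).
Qed.

Lemma card_nbrs F A : F \subset ksets n k -> A \in F ->
  #|nbrs F A| + k <= \sum_(y in A) #|star F y|.
Proof.
move=> hF hA.
have h1 : #|nbrs F A| <= \sum_(y in A) (#|star F y| - 1).
  apply: (@leq_trans #|\bigcup_(y in A) (star F y :\ A)|).
    apply/subset_leq_card/subsetP => B /nbrsP[hB ne /set0Pn[y]].
    by rewrite inE => /andP[yB yA]; apply/bigcupP; exists y; rewrite // !inE ne hB.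
  apply: leq_trans (card_bigcup_le _ _) _; apply: leq_sum => y yA.
  by rewrite (cardsD1 A (star F y)) inE hA yA addKn.
rewrite sumnB in h1; last first.
  by move=> y yA; apply/card_gt0P; exists A; rewrite inE hA.
move: h1; rewrite sum_nat_const muln1 (ksetsP _ (subsetP hF _ hA)).
have : k <= \sum_(y in A) #|star F y|.
  rewrite -{1}(ksetsP _ (subsetP hF _ hA)) -sum1_card; apply: leq_sum => y yA.
  by apply/card_gt0P; exists A; rewrite inE hA.
lia.
Qed.

(** The last three terms bound the cliques not contained in a star at a point of
    [Hv].  If a member [A] misses [Hv], the others are among its at most [k * d]
    neighbours.  If every member has two points in [Hv], they all lie in
    [duo Hv Hv].  Otherwise some member [A] has a single point [y] in [Hv], some
    member [B] misses [y], and then all others contain two points from a bounded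
    set. *)
Lemma ncl_le_heavy F (Hv : {set 'I_n}) d t : F \subset ksets n k ->
  (forall y, y \notin Hv -> #|star F y| <= d) ->
  ncl F t.+2 <= \sum_(y in Hv) 'C(#|star F y|, t.+2)
    + #|F| * 'C(k * d, t.+1)
    + #|F| * (#|Hv| * k * 'C(n - 2, k - 2)
              * 'C((#|Hv| * k + k * k) * 'C(n - 2, k - 2), t))
    + 'C(#|Hv| ^ 2 * 'C(n - 2, k - 2), t.+2).
Proof.
move=> hF hd.
have cF A : A \in F -> #|A| = k by move=> /(subsetP hF) /ksetsP.
pose pin (S V : {set {set 'I_n}}) :=
  [set Q : {set {set 'I_n}} | [&& #|Q| == t.+2, S \subset Q & Q :\: S \subset V]].
pose S1 := \bigcup_(y in Hv)
  [set Q : {set {set 'I_n}} | (Q \subset star F y) & (#|Q| == t.+2)].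
pose S2 := \bigcup_(A in [set A in F | A :&: Hv == set0]) pin [set A] (nbrs F A).
pose S3 := \bigcup_(A in F) \bigcup_(B in duo Hv A :\ A)
  pin [set A; B] (duo Hv A :|: duo A B).
pose S4 := [set Q : {set {set 'I_n}} | (Q \subset duo Hv Hv) & (#|Q| == t.+2)].
have c1 : #|S1| <= \sum_(y in Hv) 'C(#|star F y|, t.+2).
  apply: leq_trans (card_bigcup_le _ _) _; apply: leq_sum => y _.
  by rewrite cards_draws.
have c2 : #|S2| <= #|F| * 'C(k * d, t.+1).
  apply: (@leq_trans (#|[set A in F | A :&: Hv == set0]| * 'C(k * d, t.+1))).
    apply: card_bigcup_const => A; rewrite inE => /andP[hA dA].
    apply: leq_trans (card_pinned _ _ _) _; rewrite cards1 subn1 /=.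
    apply: leq_bin2l; apply: leq_trans (leq_addr k _) _.
    apply: leq_trans (card_nbrs hF hA) _; rewrite -(cF _ hA) -sum_nat_const.
    apply: leq_sum => y yA; apply: hd; apply/negP => yH.
    by move/eqP/setP: dA => /(_ y); rewrite !inE yA yH.
  by rewrite leq_mul2r; apply/orP; right; apply/subset_leq_card/subsetP => A;
     rewrite inE => /andP[].
have c3 : #|S3| <= #|F| * (#|Hv| * k * 'C(n - 2, k - 2)
              * 'C((#|Hv| * k + k * k) * 'C(n - 2, k - 2), t)).
  apply: card_bigcup_const => A hA.
  apply: (@leq_trans (#|duo Hv A :\ A|
                      * 'C((#|Hv| * k + k * k) * 'C(n - 2, k - 2), t))).
    apply: card_bigcup_const => B /setD1P[BA /duoP[cB _]].
    apply: leq_trans (card_pinned _ _ _) _; rewrite cards2 eq_sym BA subSS subn1 /=.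
    apply: leq_bin2l; apply: leq_trans (leq_card_setU _ _) _; rewrite mulnDl.
    by apply: leq_add; apply: leq_trans (card_duo _ _) _; rewrite ?cB (cF _ hA).
  rewrite leq_mul2r; apply/orP; right.
  apply: leq_trans (subset_leq_card (subD1set _ _)) _.
  by apply: leq_trans (card_duo _ _) _; rewrite (cF _ hA).
have c4 : #|S4| <= 'C(#|Hv| ^ 2 * 'C(n - 2, k - 2), t.+2).
  by rewrite cards_draws; apply: leq_bin2l; apply: card_duo.
suff hs : cliques F t.+2 \subset S1 :|: S2 :|: S3 :|: S4.
  apply: leq_trans (subset_leq_card hs) _.
  apply: leq_trans (leq_card_setU _ _) _; apply: leq_add => //.
  apply: leq_trans (leq_card_setU _ _) _; apply: leq_add => //.
  apply: leq_trans (leq_card_setU _ _) _; exact: leq_add.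
apply/subsetP => Q /cliquesP[hQ /intersectingP iQ cQ].
have QF A : A \in Q -> A \in F by apply: (subsetP hQ).
have Qk A : A \in Q -> A \in ksets n k by move=> /QF /(subsetP hF).
rewrite !in_setU.
case: (boolP [exists A in Q, A :&: Hv == set0]) => [/exists_inP[A hA dA]|].
  apply/orP; left; apply/orP; left; apply/orP; right.
  apply/bigcupP; exists A; first by rewrite inE QF.
  rewrite inE cQ eqxx sub1set hA /=; apply/subsetP => B /setD1P[BA hB].
  by apply/nbrsP; split=> //; [exact: QF | exact: iQ].
move/exists_inPn => hHv.
have {}hHv A : A \in Q -> exists2 z, z \in A & z \in Hv.
  by move=> /hHv /set0Pn[z]; rewrite inE => /andP[? ?]; exists z.
case: (boolP [exists y in Hv, Q \subset star F y]) => [/exists_inP[y hy hs]|].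
  apply/orP; left; apply/orP; left; apply/orP; left.
  by apply/bigcupP; exists y => //; rewrite inE hs cQ /=.
move/exists_inPn => nst.
case: (boolP (Q \subset duo Hv Hv)) => [h4|/subsetPn[A hA nA]].
  by apply/orP; right; rewrite inE h4 cQ /=.
apply/orP; left; apply/orP; right.
have cA : #|A| = k by apply: cF; apply: QF.
have one y z : y \in A -> z \in A -> y \in Hv -> z \in Hv -> y = z.
  move=> yA zA yH zH; apply/eqP/negPn/negP => yz.
  by move/duoP: nA; apply; split=> //; exists y, z.
have [y yA yH] := hHv A hA.
have /subsetPn[B hB nB] := nst y yH.
have yB : y \notin B by move: nB; rewrite inE QF.
have AB : B != A by apply: contraNneq yB => ->.
apply/bigcupP; exists A; first exact: QF.
apply/bigcupP; exists B.
  rewrite !inE AB /=; have /ksetsP := Qk B hB => cB.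
  have -> /= : #|B| == k by apply/eqP.
  have [z zB zH] := hHv B hB.
  have /set0Pn[a] := iQ _ _ hB hA; rewrite inE => /andP[aB aA].
  apply/exists_inP; exists z => //; apply/exists_inP; exists a => //.
  rewrite zB aB !andbT; apply: contraNneq yB => e.
  by rewrite (one y z) // e.
rewrite inE cQ eqxx subUset !sub1set hA hB /=.
apply/subsetP => C; rewrite !in_setD => /andP[_ hC].
rewrite in_setU; have [z zC zH] := hHv C hC.
have /ksetsP cC := Qk C hC.
case: (boolP (z \in A)) => zA.
  have /set0Pn[b] := iQ _ _ hC hB; rewrite inE => /andP[bC bB].
  apply/orP; right; apply/duoP; split=> //; exists z, b; split=> //.
  by apply: contraNneq yB => e; rewrite (one y z) // e.
have /set0Pn[a] := iQ _ _ hC hA; rewrite inE => /andP[aC aA].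
apply/orP; left; apply/duoP; split=> //; exists z, a; split=> //.
by apply: contraNneq zA => ->.
Qed.

End Uniform.

Lemma subset_of_card (T : finType) (B : {set T}) l : l <= #|B| ->
  exists2 X : {set T}, X \subset B & #|X| = l.
Proof.
rewrite -bin_gt0 -cards_draws => /card_gt0P[X].
by rewrite inE => /andP[h /eqP]; exists X.
Qed.

(** The codegree is smaller than the degree by the factor
    [(n - 1) / (k - 1)]. *)
Lemma codeg_small n k Q : 1 < k -> Q * k.-1 <= n.-1 ->
  Q * 'C(n - 2, k - 2) <= 'C(n.-1, k.-1).
Proof.
case: k => [//|[//|k]] _; rewrite /= => h.
case: n h => [|[|n]] /= h; try by have -> : Q = 0 by lia.
rewrite !subSS !subn0 -(leq_pmul2l (ltn0Sn k)) -mul_bin_diag /=.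
by rewrite mulnA leq_mul2r (mulnC k.+1) h orbT.
Qed.

(** * Reduction to saturated families *)

Section Saturated.
Variables n k : nat.
Implicit Types F G : {set {set 'I_n}}.

(** No exchange of a member [A] for a missing set through [x] is obviously
    profitable. *)
Definition saturated F := forall (A : {set 'I_n}) x, A \in F -> x \notin A ->
  star F x != star (ksets n k) x -> #|star F x| <= #|nbrs F A|.

(** Exchanging [A] for a missing set through [x] trades the cliques among the
    neighbours of [A] for those of a star.  If the star has more members, all
    clique counts grow weakly and [ncl _ 2] grows strictly; so a family
    maximising [ncl _ 2] among those with at least [ncl F t] cliques of size [t]
    is saturated. *)
Lemma exists_saturated F t : 0 < k -> F \subset ksets n k ->
  exists G, [/\ G \subset ksets n k, #|G| = #|F|, ncl F t <= ncl G t & saturated G].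
Proof.
move=> k0 hF.
pose P (G : {set {set 'I_n}}) := [&& G \subset ksets n k, #|G| == #|F| & ncl F t <= ncl G t].
have PF : P F by rewrite /P hF !eqxx leqnn.
case: (@arg_maxnP _ F P (fun G : {set {set 'I_n}} => ncl G 2) PF) => G /and3P[hG /eqP cG tG] maxG.
exists G; split=> // A x hA xA hx; rewrite leqNgt; apply/negP => hlt.
have /subsetPn[B] : ~~ (star (ksets n k) x \subset star G x).
  by apply: contra hx => h; rewrite eqEsubset h starS.
rewrite !inE => /andP[hB xB] nB; rewrite xB andbT in nB.
have AB : A != B by apply: contraNneq xA => ->.
pose E := G :\ A; pose G' := B |: E.
have BE : B \notin E by rewrite !inE negb_and nB orbT.
have B0 : B != set0 by apply/set0Pn; exists x.
have A0 : A != set0 by apply: kset_neq0 k0 (subsetP hG _ hA).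
have G'B : G' :\ B = E by rewrite setU1K.
have hst : star G x \subset nbrs G' B.
  apply/subsetP => C; rewrite inE => /andP[hC xC]; apply/nbrsP; split.
  - by rewrite !inE hC andbT (_ : C != A) ?orbT //; apply: contraNneq xA => <-.
  - by apply: contraNneq nB => <-.
  - by apply/set0Pn; exists x; rewrite inE xC.
have st r : ncl (star G x) r = 'C(#|star G x|, r).
  by apply: (@ncl_star _ x) => C; rewrite inE => /andP[].
have gain r : ncl G r.+1 + 'C(#|star G x|, r) <= ncl G' r.+1 + ncl (nbrs G A) r.
  rewrite (ncl_del _ hA A0) (ncl_del _ (setU11 B E) B0) G'B -/E.
  by rewrite addnAC leq_add2r leq_add2l -st; apply: ncl_sub.
have PG' : P G'.
  apply/and3P; split.
  - apply/subsetP => C /setU1P[-> //|/setD1P[_]]; first by rewrite inE.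
    exact: (subsetP hG).
  - by rewrite cardsU1 BE -cG (cardsD1 A G) hA.
  - apply: leq_trans tG _; case: {maxG P PF} t => [|r]; first by rewrite !ncl0.
    have := gain r; have := ncl_le_bin (nbrs G A) r.
    have := leq_bin2l r (ltnW hlt); clear; lia.
have := maxG _ PG'; have := gain 1; have := ncl_le_bin (nbrs G A) 1.
rewrite !bin1; move: hlt; clear; lia.
Qed.

End Saturated.

(** * Families with few almost full stars *)

(** The error terms of [ncl_le_heavy] are a small fraction of the number of
    [t]-subsets of one star. *)
Lemma heavy_error q c h k d m N N2 t : 1 < N -> m <= c * N ->
  9 * c * q * k * d <= N./2 -> 18 * c * q * h * k * N2 < N./2 ->
  (h * k + k * k) * N2 <= N./2 -> 3 * q * h ^ 2 * N2 <= N ->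
  q * (m * 'C(k * d, t.+1) + m * (h * k * N2 * 'C((h * k + k * k) * N2, t))
       + 'C(h ^ 2 * N2, t.+2)) <= 'C(N, t.+2).
Proof.
move=> N1 hm h1 h2 h3 h4.
have hN : N./2 + N./2 <= N by lia.
have hm3 : m <= 3 * c * N./2 by nia.
have e1 : 3 * (q * (m * 'C(k * d, t.+1))) <= 'C(N, t.+2).
  apply: leq_trans (_ : N./2 * 'C(N./2, t.+1) <= _); last first.
    by rewrite -{1}(bin1 N./2); apply: leq_trans (bin_mul_le _ _ _ _) _; apply: leq_bin2l.
  have : 9 * c * q * 'C(k * d, t.+1) <= 'C(N./2, t.+1).
    apply: leq_trans (bin_mulS _ _ _) _ => //; apply: leq_bin2l.
    by rewrite mulnA.
  move: ('C(k * d, t.+1)) ('C(N./2, t.+1)) => x y hxy.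
  apply: (@leq_trans (3 * (q * (3 * c * N./2 * x)))).
    by rewrite !leq_mul2l leq_mul2r hm3 !orbT.
  have -> : 3 * (q * (3 * c * N./2 * x)) = N./2 * (9 * c * q * x) by lia.
  by rewrite leq_mul2l hxy orbT.
have e2 : 3 * (q * (m * (h * k * N2 * 'C((h * k + k * k) * N2, t)))) <= 'C(N, t.+2).
  apply: leq_trans (_ : 'C(N./2, 2) * 'C(N./2, t) <= _); last first.
    by apply: leq_trans (bin_mul_le _ _ _ _) _; apply: leq_bin2l.
  have hb := leq_bin2l t h3.
  have : 3 * (q * (m * (h * k * N2))) <= 'C(N./2, 2).
    rewrite bin2 geq_half_double.
    apply: (@leq_trans ((3 * (q * (3 * c * N./2 * (h * k * N2)))).*2)).
      by rewrite leq_double !leq_mul2l leq_mul2r hm3 !orbT.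
    have -> : (3 * (q * (3 * c * N./2 * (h * k * N2)))).*2 =
              N./2 * (18 * c * q * h * k * N2) by lia.
    by rewrite leq_mul2l -ltnS prednK ?h2 ?orbT //; lia.
  move: hb; move: ('C(_, t)) ('C(N./2, t)) ('C(N./2, 2)) => x y z hxy hz.
  have := leq_mul hz hxy; lia.
have e3 : 3 * (q * 'C(h ^ 2 * N2, t.+2)) <= 'C(N, t.+2).
  rewrite mulnA; apply: leq_trans (bin_mulS _ _ _) _ => //; apply: leq_bin2l.
  by rewrite mulnA.
rewrite !mulnDr; lia.
Qed.

Lemma bin_geq a b : 0 < b < a -> a <= 'C(a, b).
Proof.
elim: a b => [|a IH] [|b] // /andP[_]; rewrite ltnS => hb.
rewrite binS; have := hb; rewrite leq_eqVlt => /orP[/eqP e|hlt].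
  by rewrite -e binn binSn; lia.
have := IH b.+1; rewrite hlt => /(_ isT) h.
have : 0 < 'C(a, b) by rewrite bin_gt0; lia.
lia.
Qed.

(** A degree below [(1 - 1 / 4l) N] loses that factor once more, because
    [t >= 2]. *)
Lemma bin_star_bound l N D t : 0 < l -> D <= N -> 1 < t ->
  'C(D, t) * (4 * l * N) <=
  'C(N, t) * ((4 * l).-1 * D + (if (4 * l).-1 * N <= 4 * l * D then N else 0)).
Proof.
move=> l0 hD ht; case: ifP => hb.
  have := bin_ratio hD (ltnW ht); rewrite !expn1 => h1.
  have : 4 * l * ('C(D, t) * N) <= 4 * l * ('C(N, t) * D) by rewrite leq_mul2l h1 orbT.
  have -> : 'C(N, t) * ((4 * l).-1 * D + N) =
    (4 * l).-1 * ('C(N, t) * D) + 'C(N, t) * N by lia.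
  have : 'C(N, t) * D <= 'C(N, t) * N by rewrite leq_mul2l hD orbT.
  move: ('C(N, t) * D) ('C(N, t) * N) => u v; rewrite -{4}(prednK (_ : 0 < 4 * l)); last by lia.
  nia.
move/negbT: hb; rewrite -ltnNge addn0 => hb.
have N0 : 0 < N by lia.
have h2 := bin_ratio hD ht; rewrite -(leq_pmul2r N0).
have h3 : 'C(N, t) * D * (4 * l * D) <= 'C(N, t) * D * ((4 * l).-1 * N).
  by rewrite leq_mul2l (ltnW hb) orbT.
move: h2 h3; move: ('C(D, t)) ('C(N, t)) => x y h2 h3; clear ht hD hb.
have : 4 * l * (x * N ^ 2) <= 4 * l * (y * D ^ 2) by rewrite leq_mul2l h2 orbT.
lia.
Qed.

Section Far.
Variables (n k l : nat).
Hypotheses (k0 : 0 < k) (l0 : 0 < l).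
Let N := 'C(n.-1, k.-1).
Let N2 := 'C(n - 2, k - 2).
Implicit Types F : {set {set 'I_n}}.

(** Double counting: the degrees sum to [k * #|F|]. *)
Lemma card_heavy F g (Hv : {set 'I_n}) : 0 < N -> F \subset ksets n k ->
  #|F| <= l.+1 * N -> {in Hv, forall y, N <= g * #|star F y|} -> #|Hv| <= g * k * l.+1.
Proof.
move=> N0 hF cF hH; rewrite -(leq_pmul2r N0) -sum_nat_const.
apply: (@leq_trans (\sum_(y in Hv) g * #|star F y|)); first exact: leq_sum.
rewrite -big_distrr /=; apply: (@leq_trans (g * (k * #|F|))).
  rewrite leq_mul2l -(sum_deg hF) [leqRHS](bigID (mem Hv)) /=.
  by rewrite leq_addr orbT.
by rewrite -!mulnA !leq_mul2l cF !orbT.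
Qed.

Definition almost_full F := [set y | (4 * l).-1 * N <= 4 * l * #|star F y|].

Lemma sum_bin_heavy F (Hv : {set 'I_n}) t : F \subset ksets n k -> 1 < t ->
  4 * l * N * \sum_(y in Hv) 'C(#|star F y|, t) <=
  'C(N, t) * ((4 * l).-1 * (#|F| + #|Hv| ^ 2 * N2) + #|almost_full F| * N).
Proof.
move=> hF ht.
apply: (@leq_trans ('C(N, t) * ((4 * l).-1 * \sum_(y in Hv) #|star F y|
   + \sum_(y in Hv) (if y \in almost_full F then N else 0)))).
  rewrite mulnC big_distrl /= [(4 * l).-1 * _]big_distrr -big_split big_distrr /=.
  apply: leq_sum => y _; rewrite inE.
  by apply: bin_star_bound => //; apply: card_star_le.
rewrite leq_mul2l; apply/orP; right; apply: leq_add.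
  rewrite leq_mul2l; apply/orP; right; apply: leq_trans (sum_star_le _ hF) _.
  rewrite leq_add2r; apply/subset_leq_card/subsetIl.
rewrite -big_mkcondr sum_nat_const leq_mul2r; apply/orP; right.
by apply/subset_leq_card/subsetP => y /andP[].
Qed.

(** If [l] vertices have almost full degree, few sets avoid all of them, so any
    such set has too few neighbours for [F] to be saturated unless the [l]
    stars are full. *)
Lemma saturated_full F (X : {set 'I_n}) : F \subset ksets n k -> saturated k F ->
  X \subset almost_full F -> #|X| = l -> #|hit k X| <= #|F| <= l * N + n ->
  4 * l * (n + (l ^ 2 + l * k) * N2) < 2 * N -> hit k X \subset F.
Proof.
move=> hF sF hX cX /andP[c1 c2] hN; apply/negPn/negP => /subsetPn[A hA nA].
have /subsetPn[B hB nB] : ~~ (F \subset hit k X).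
  apply: contra nA => h; have /eqP -> : F == hit k X by rewrite eqEcard h c1.
  exact: hA.
case/hitP: (hA) => _ [x xA xX].
have dB z : z \in B -> z \notin X.
  move=> zB; apply: contra nB => zX; apply/hitP; split; last by exists z.
  by have /ksetsP := subsetP hF _ hB.
have xB : x \notin B by apply/negP => /dB; rewrite xX.
have h1 : #|star F x| <= #|nbrs F B|.
  apply: sF => //; apply: contra nA => /eqP e.
  suff : A \in star F x by rewrite inE => /andP[].
  by rewrite e inE xA andbT; apply: (subsetP (hit_sub _ _)) hA.
have cB : #|B| = k by have /ksetsP := subsetP hF _ hB.
have h2 : #|nbrs F B| <= (#|F| - #|F :&: hit k X|) + l * k * N2.
  apply: (@leq_trans (#|(F :\: hit k X) :|: duo k X B|)).
    apply/subset_leq_card/subsetP => C /nbrsP[hC _ /set0Pn[b]].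
    rewrite inE => /andP[bC bB]; rewrite !in_setU in_setD hC andbT.
    case: (boolP (C \in hit k X)) => //= /hitP[cC [z zC zX]].
    apply/duoP; split=> //; exists z, b; split=> //.
    by apply: contraTneq zX => ->; apply: dB.
  apply: leq_trans (leq_card_setU _ _) _; apply: leq_add.
    by rewrite cardsD leq_sub2r.
  by apply: leq_trans (card_duo _ _ _) _; rewrite cX cB.
have h3 := sum_star_le X hF.
have h4 : l * ((4 * l).-1 * N) <= 4 * l * \sum_(y in X) #|star F y|.
  rewrite -{1}cX -sum_nat_const big_distrr /=; apply: leq_sum => y yX.
  by have := subsetP hX _ yX; rewrite inE.
have h5 : (4 * l).-1 * N <= 4 * l * #|star F x|.
  by have := subsetP hX _ xX; rewrite inE.
have h6 : #|F :&: hit k X| <= #|F| by apply/subset_leq_card/subsetIl.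
move: h1 h2 h3 h4 h5 h6 c2 hN l0; rewrite cX -/N2.
move: (#|star _ _|) (#|nbrs _ _|) (#|F :&: _|) (\sum_(_ in _) _) (#|F|) N N2 => d e a S m M M2.
clear; move=> h1 h2 h3 h4 h5 h6 h7 h8 h9.
have e1 : 4 * l * d <= 4 * l * (l * M + n + (l ^ 2 + l * k) * M2 - S).
  by rewrite leq_mul2l; apply/orP; right; lia.
have e2 : 4 * l * (l * M + n + (l ^ 2 + l * k) * M2 - S) =
  4 * l * (l * M) + 4 * l * (n + (l ^ 2 + l * k) * M2) - 4 * l * S.
  by rewrite mulnBr !mulnDr; lia.
have e3 : l * ((4 * l).-1 * M) + l * M = 4 * l * (l * M) by nia.
have e4 : (4 * l).-1 * M + M = 4 * l * M by nia.
have e5 : M <= l * M by rewrite -{1}(mul1n M) leq_mul2r h9 orbT.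
lia.
Qed.

(** Otherwise fewer than [l] vertices have almost full degree, and convexity of
    the binomials loses a constant fraction of a star. *)
Lemma few_almost_full F t : F \subset ksets n k -> #|F| <= l * N + n -> n <= N ->
  #|almost_full F| < l -> 1 < N ->
  let c := l.+1 in let q := 16 * l in let g := 18 * c * q * k in
  let h := g * k * c in
  18 * c * q * h * k * N2 < N./2 -> (h * k + k * k) * N2 <= N./2 ->
  3 * q * h ^ 2 * N2 <= N -> 8 * l * (n + h ^ 2 * N2) <= N -> 16 * l ^ 3 * N2 <= N ->
  ncl F t.+2 + l ^ 2 * 'C(N2, t.+2) <= l * 'C(N, t.+2).
Proof.
move=> hF cF nN hbig N1 c q g h h2 h3 h4 h5 h6.
have N0 : 0 < N by apply: ltnW.
have cF' : #|F| <= l.+1 * N by rewrite mulSn addnC; apply: leq_trans cF _; rewrite leq_add2l.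
pose Hv := [set y | N <= g * #|star F y|].
have hHv : #|Hv| <= h by apply: (card_heavy N0 hF cF') => y; rewrite inE.
have g0 : 0 < g by rewrite !muln_gt0 /= k0 l0.
have hd y : y \notin Hv -> #|star F y| <= N %/ g.
  by rewrite inE -ltnNge leq_divRL // mulnC => /ltnW.
have := ncl_le_heavy t hF hd.
have := sum_bin_heavy Hv hF (isT : 1 < t.+2).
have hd2 : N %/ g * g <= N by apply: leq_trunc_div.
have e1 : 9 * c * q * k * (N %/ g) <= N./2.
  by move: hd2; rewrite {2}/g; lia.
have hk : #|Hv| * k <= h * k by rewrite leq_mul2r hHv orbT.
have hh2 : #|Hv| ^ 2 <= h ^ 2 by rewrite leq_exp2r.
have f2 : 18 * c * q * #|Hv| * k * N2 < N./2.
  apply: leq_ltn_trans h2; rewrite leq_mul2r -[_ * #|Hv| * k]mulnA -[_ * h * k]mulnA.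
  by rewrite leq_mul2l hk !orbT.
have f3 : (#|Hv| * k + k * k) * N2 <= N./2.
  by apply: leq_trans h3; rewrite leq_mul2r leq_add2r hk orbT.
have f4 : 3 * q * #|Hv| ^ 2 * N2 <= N.
  by apply: leq_trans h4; rewrite leq_mul2r leq_mul2l hh2 !orbT.
have := heavy_error t N1 cF' e1 f2 f3 f4.
have h7 : 16 * l * (l ^ 2 * 'C(N2, t.+2)) <= 'C(N, t.+2).
  rewrite mulnA; apply: leq_trans (bin_mulS _ _ _) _ => //; apply: leq_bin2l.
  by apply: leq_trans h6; rewrite leq_mul2r; apply/orP; right; lia.
have h8 : 8 * l * (n + #|Hv| ^ 2 * N2) <= N.
  apply: leq_trans h5; rewrite leq_mul2l leq_add2l; apply/orP; right.
  by rewrite leq_mul2r hh2 orbT.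
move: h7 h8 cF hbig N0 l0; rewrite -/N2 /q.
move: ('C(N, t.+2)) => T; move: ('C(N2, t.+2)) ('C(#|Hv| ^ 2 * N2, t.+2)) (\sum_(_ in _) _).
move: (#|F| * _) (#|F| * 'C(_, _)).
move: (#|Hv| ^ 2 * N2) (#|almost_full F|) (#|F|) (ncl F t.+2) N.
clear => U b m x M E2 E1 E4 E3 S h7 h8 h9 h10 N0 l0 h11 h12 h13.
have h14 : 8 * l * M * S <= (8 * l ^ 2 - 1) * (T * M).
  have : (4 * l).-1 * (m + U) + b * M <= (4 * l).-1 * (l * M + n + U) + l.-1 * M.
    apply: leq_add; first by rewrite leq_mul2l leq_add2r h9 orbT.
    by rewrite leq_mul2r -ltnS prednK // h10 orbT.
  have -> : (4 * l).-1 * (l * M + n + U) = (4 * l).-1 * l * M + (4 * l).-1 * (n + U) by lia.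
  have : 2 * ((4 * l).-1 * (n + U)) <= M.
    by apply: leq_trans h8; rewrite mulnA leq_mul2r; apply/orP; right; lia.
  have : 2 * ((4 * l).-1 * l + l.-1) + 1 = 8 * l ^ 2 - 1 by nia.
  move: (_.-1 * (n + U)) => V hV1 hV2 hV3.
  have hV : 2 * ((4 * l).-1 * (m + U) + b * M) <= (8 * l ^ 2 - 1) * M.
    by rewrite -hV1; clear -hV2 hV3; lia.
  have : 2 * (4 * l * M * S) <= T * (2 * ((4 * l).-1 * (m + U) + b * M)).
    by rewrite [leqRHS]mulnCA leq_mul2l h12.
  have : T * (2 * ((4 * l).-1 * (m + U) + b * M)) <= T * ((8 * l ^ 2 - 1) * M).
    by rewrite leq_mul2l hV orbT.
  lia.
have {}h14 : 8 * l * S <= (8 * l ^ 2 - 1) * T.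
  by rewrite -(leq_pmul2r N0); lia.
have h15 : (8 * l ^ 2 - 1) * T + T = 8 * l * (l * T).
  have : 8 * l ^ 2 - 1 + 1 = 8 * l * l by nia.
  nia.
rewrite -(leq_pmul2l (_ : 0 < 8 * l)); last by lia.
have : 8 * l * (x + l ^ 2 * E4) <= 8 * l * (S + E1 + E2 + E3 + l ^ 2 * E4).
  by rewrite leq_mul2l leq_add2r h13 orbT.
lia.
Qed.

End Far.

(** * Completing a trace that is not a sunflower *)

(** One set of [Z] and [u] sets of [P :\: Z] form a clique, since all contain
    [x]; it is not a clique of [E]. *)
Lemma ncl_gain n (E G P Z : {set {set 'I_n}}) x u :
  E \subset G -> P \subset G -> Z \subset P -> [disjoint Z & E] ->
  {in P, forall A : {set 'I_n}, x \in A} ->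
  ncl E u.+1 + #|Z| * 'C(#|P :\: Z|, u) <= ncl G u.+1.
Proof.
move=> EG PG ZP dZ hx.
pose R := [set Q : {set {set 'I_n}} | (Q \subset P :\: Z) & #|Q| == u].
pose f (p : {set 'I_n} * {set {set 'I_n}}) := p.1 |: p.2.
have fI p : p \in setX Z R -> f p :&: Z = [set p.1] /\ f p :\: Z = p.2.
  case: p => A Q; rewrite !inE /= => /andP[hA /andP[/subsetP hQ _]]; rewrite /f /=.
  have nQ B : B \in Q -> B \notin Z by move=> /hQ; rewrite inE => /andP[].
  split; apply/setP => B; rewrite !inE; case: (eqVneq B A) => [->|ne] /=.
  - by rewrite hA.
  - by apply/negP => /andP[/nQ /negP].
  - by rewrite hA; apply/esym/negP => /nQ; rewrite hA.
  - by case: (boolP (B \in Q)) => [/nQ ->|]; rewrite ?andbF.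
have inj : {in setX Z R &, injective f}.
  move=> p q hp hq e; have [p1 p2] := fI p hp; have [q1 q2] := fI q hq.
  move: p1 p2; rewrite e q1 q2 => /set1_inj p1 p2.
  by case: p q p1 p2 {hp hq e q1 q2} => [? ?] [? ?] /= -> ->.
have -> : #|Z| * 'C(#|P :\: Z|, u) = #|f @: setX Z R|.
  by rewrite card_in_imset // cardsX cards_draws.
rewrite /ncl -cardsUI.
have -> : cliques E u.+1 :&: f @: setX Z R = set0.
  apply/setP => Q; rewrite !inE; apply/negP => /andP[/and3P[hQ _ _] /imsetP[p hp e]].
  have : p.1 \in E by apply: (subsetP hQ); rewrite e setU11.
  by move: hp; rewrite inE => /andP[h _]; rewrite (disjointFr dZ h).
rewrite cards0 addn0; apply/subset_leq_card/subsetP => Q /setUP[|/imsetP[[A Q'] hp ->]].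
  by case/cliquesP => h1 h2 h3; apply/cliquesP; split=> //; apply: subset_trans EG.
have [hA hQ cQ] : [/\ A \in Z, Q' \subset P :\: Z & #|Q'| = u].
  by move: hp; rewrite !inE /= => /andP[? /andP[? /eqP]].
rewrite /f /=.
have QP : A |: Q' \subset P.
  rewrite subUset sub1set (subsetP ZP) //=; apply: subset_trans hQ _; exact: subsetDl.
apply/cliquesP; split; first exact: subset_trans PG.
  by apply: (@star_intersecting _ x) => B /(subsetP QP) /hx.
rewrite cardsU1 cQ; suff -> : A \notin Q' by [].
by apply/negP => /(subsetP hQ); rewrite inE hA.
Qed.

(** Here [X] is the set of centres of the full stars, [D] contains the common
    points of three sets with union [U], and [z |: D] is compared with [D] as a
    kernel.  The quantity [j] bounds the number of sets with three points in any
    of the bounded sets that occur below. *)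
Section Covers.
Variables (n k : nat) (X D U : {set 'I_n}) (z : 'I_n).
Hypotheses (k3 : 2 < k) (cD : #|D| = k - 2) (cU : #|U| <= 3 * k).
Hypotheses (dD : [disjoint D & X]) (dU : [disjoint U & X]).
Hypotheses (zX : z \notin X) (zD : z \notin D).

Let N2 := 'C(n - 2, k - 2).
Let N3 := 'C(n - 3, k - 3).
Let l := #|X|.
Let j := (l + 7 * k) ^ 3 * N3.

(** The sets of [hit k X] that meet all three sets either meet [D] or, missing
    their common points, need two points of [U]. *)
Definition through := [set A in hit k X | A :&: D != set0].
Definition around := [set A in hit k X | (A :&: D == set0) && (1 < #|A :&: U|)].
Definition core := [set A in hit k X | A :&: (z |: D) != set0].

Local Notation E := (through :|: around).

Lemma throughP A : reflect (A \in hit k X /\ exists2 d, d \in A & d \in D) (A \in through).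
Proof.
rewrite [A \in through]inE; apply: (iffP andP) => [[h1 /set0Pn[d]]|[h1 [d dA dDD]]].
  by rewrite inE => /andP[*]; split=> //; exists d.
by split=> //; apply/set0Pn; exists d; rewrite inE dA.
Qed.

Lemma cover_ksets : E \subset ksets n k.
Proof.
by apply/subsetP => A /setUP[] /setIdP[h _]; apply: (subsetP (hit_sub _ _)) h.
Qed.

Lemma card_cover : #|E| <= 4 * l * k * N2.
Proof.
apply: (@leq_trans #|duo k X D :|: duo k X U|).
  apply/subset_leq_card/subsetP => A /setUP[|].
    case/throughP=> /hitP[hA [x xA xX]] [d dA dDD]; rewrite inE; apply/orP; left.
    apply/duoP; split=> //; exists x, d; split=> //.
    by apply: contraTneq dDD => <-; rewrite (disjointFl dD).
  case/setIdP=> /hitP[hA [x xA xX]] /andP[_ /card_gt1P[y [y' [+ _ _]]]].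
  rewrite inE => /andP[yA yU]; rewrite inE; apply/orP; right.
  apply/duoP; split=> //; exists x, y; split=> //.
  by apply: contraTneq yU => <-; rewrite (disjointFl dU).
apply: leq_trans (leq_card_setU _ _) _.
apply: leq_trans (leq_add (card_duo _ _ _) (card_duo _ _ _)) _.
rewrite -/N2 -/l -mulnDl -mulnDr leq_mul2r -mulnA -mulnCA leq_mul2l cD.
by rewrite (_ : _ + _ <= _) ?orbT //; lia.
Qed.

Lemma card_around : #|around| <= j.
Proof.
apply: (@leq_trans #|[set A in ksets n k | 2 < #|A :&: (X :|: U)|]|).
  apply/subset_leq_card/subsetP => A /setIdP[hA /andP[_ h1]].
  rewrite inE (subsetP (hit_sub k X)) //=.
  have /hitP[_ [x xA xX]] := hA.
  rewrite (cardsD1 x) !inE xA xX /= add1n ltnS.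
  apply: leq_trans h1 _; apply/subset_leq_card/subsetP => y.
  rewrite !inE => /andP[yA yU]; rewrite yA yU orbT !andbT.
  by apply: contraTneq yU => ->; rewrite (disjointFl dU).
apply: leq_trans (card_ge3 _ _) _; rewrite leq_mul2r leq_exp2r //.
apply/orP; right; apply: leq_trans (leq_card_setU _ _) _; rewrite -/l; lia.
Qed.

Section Near.
Variable w : {set 'I_n}.
Hypothesis hw : w \in around.
Let S := w :&: X.
Let Om := X :|: D :|: U :|: w.
Let V := nbrs E w.
Let J (B : {set 'I_n}) := [set A in ksets n k | 2 < #|A :&: (Om :|: B)|].

Lemma card_around_member : #|w| = k.
Proof. by case/setIdP: hw => /hitP[]. Qed.

Lemma around_missD d : d \in D -> d \notin w.
Proof.
case/setIdP: hw => _ /andP[/eqP/setP h _] hd.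
by move: (h d); rewrite !inE hd andbT => ->.
Qed.

Lemma card_trace_X : #|S| <= k - 2.
Proof.
have h : 1 < #|w :&: U| by case/setIdP: hw => _ /andP[].
have h2 : #|S| + #|w :&: U| <= k.
  rewrite -card_around_member -(cardsID X w) leq_add2l; apply/subset_leq_card/subsetP => y.
  by rewrite !inE => /andP[-> hy]; rewrite (disjointFr dU hy).
by rewrite leq_subRL; lia.
Qed.

Lemma card_third_point (B : {set 'I_n}) : #|B| <= 2 * k -> #|J B| <= j.
Proof.
move=> hB; apply: leq_trans (card_ge3 _ _) _; rewrite leq_mul2r leq_exp2r //.
apply/orP; right; apply: leq_trans (leq_card_setU _ _) _.
have h1 : #|Om| <= l + (k - 2) + 3 * k + k.
  have [+ _] := leq_card_setU (X :|: D :|: U) w.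
  have [+ _] := leq_card_setU (X :|: D) U; have [+ _] := leq_card_setU X D.
  rewrite cD card_around_member -/l -/Om.
  by move: cU; clear; lia.
by move: h1 hB; clear; lia.
Qed.

(** A neighbour of [w] either has a third point in the bounded set [Om], or
    meets it in exactly one point of [w :&: X] and one point of [D]. *)
Lemma near_trace A : A \in V -> A \notin J set0 ->
  exists x d, [/\ x \in S, d \in D, x \in A, d \in A &
                 forall y, y \in A -> y \in Om -> y = x \/ y = d].
Proof.
case/nbrsP => hA _ /set0Pn[y] /setIP[yA yw] hJ.
have hO : #|A :&: Om| <= 2.
  rewrite leqNgt; apply: contra hJ => h; apply/setIdP.
  by rewrite setU0; split=> //; apply: (subsetP cover_ksets).
have big3 a b c : a \in A -> b \in A -> c \in A -> a \in Om -> b \in Om -> c \in Om ->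
    a != b -> b != c -> c != a -> false.
  move=> aA bA cA aO bO cO ab bc ca; move: hO; rewrite leqNgt => /negP[].
  by apply/card_gt2P; exists a, b, c; rewrite !in_setI aA bA cA aO bO cO.
case/setUP: hA => [/throughP[/hitP[_ [x xA xX]] [d dA dDD]]|]; last first.
  case/setIdP=> /hitP[_ [x xA xX]] /andP[_ /card_gt1P[a [b [+ + ab]]]].
  rewrite !inE => /andP[aA aU] /andP[bA bU].
  suff : false by [].
  apply: (big3 x a b) => //; rewrite ?inE ?aU ?bU ?xX ?orbT //.
    by apply: contraTneq aU => <-; rewrite (disjointFl dU).
  by apply: contraTneq bU => ->; rewrite (disjointFl dU).
have xd : x != d by apply: contraTneq dDD => <-; rewrite (disjointFl dD).
have tr t : t \in A -> t \in Om -> t = x \/ t = d.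
  move=> tA tO; case: (eqVneq t x) => [->|tx]; first by left.
  case: (eqVneq t d) => [->|td]; first by right.
  suff : false by [].
  by apply: (big3 x d t) => //; rewrite ?inE ?xX ?dDD ?orbT // eq_sym.
exists x, d; split=> //; rewrite inE xX andbT.
have yO : y \in Om by rewrite !inE yw orbT.
by case: (tr y yA yO) yw => -> //; rewrite (negPf (around_missD dDD)).
Qed.

(** Outside the negligible family [J set0] every neighbour of [w] contains an edge
    [xd] between [w :&: X] and [D].  The edges of the members of a clique all share [x], or
    all share [d], or two of them are disjoint; in the last case all remaining members
    contain one of the two edges joining their ends, or have a third point in a
    bounded set.  In each case the rest of the clique comes from at most
    [(k - 2) * N2 + j] sets, because [w :&: X] has at most [k - 2] points. *)
Lemma ncl_near v :
  ncl V v.+2 <= 2 * k * 'C((k - 2) * N2 + j, v.+2)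
    + (4 * l * k * N2) ^ 2 * 'C((k - 2) * N2 + j, v).
Proof.
pose fam (Y : {set {set 'I_n}}) :=
  [set Q : {set {set 'I_n}} | (Q \subset Y) & (#|Q| == v.+2)].
pose T1 := \bigcup_(x in S) fam (duo k [set x] D :|: J set0).
pose T2 := \bigcup_(d in D) fam (duo k S [set d] :|: J set0).
pose ok (p : {set 'I_n} * {set 'I_n}) := [&& 3 < k, p.1 != p.2,
  #|p.1 :&: X| <= 1, #|p.1 :&: D| <= 1, #|p.2 :&: X| <= 1 & #|p.2 :&: D| <= 1].
pose rest (p : {set 'I_n} * {set 'I_n}) := duo k (p.1 :&: X) (p.2 :&: D)
  :|: duo k (p.2 :&: X) (p.1 :&: D) :|: J (p.1 :|: p.2).
pose T3 := \bigcup_(p in [set p in setX E E | ok p])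
  [set Q : {set {set 'I_n}} | [&& #|Q| == v.+2, [set p.1; p.2] \subset Q
     & Q :\: [set p.1; p.2] \subset rest p]].
have c1 : #|T1| <= k * 'C((k - 2) * N2 + j, v.+2).
  apply: leq_trans (_ : #|S| * 'C((k - 2) * N2 + j, v.+2) <= _); last first.
    by rewrite leq_mul2r (leq_trans card_trace_X (leq_subr _ _)) orbT.
  apply: card_bigcup_const => x _; rewrite cards_draws; apply: leq_bin2l.
  apply: leq_trans (leq_card_setU _ _) _; apply: leq_add.
    by apply: leq_trans (card_duo _ _ _) _; rewrite cards1 mul1n cD.
  by apply: card_third_point; rewrite cards0.
have c2 : #|T2| <= k * 'C((k - 2) * N2 + j, v.+2).
  apply: leq_trans (_ : #|D| * 'C((k - 2) * N2 + j, v.+2) <= _); last first.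
    by rewrite leq_mul2r cD leq_subr orbT.
  apply: card_bigcup_const => d _; rewrite cards_draws; apply: leq_bin2l.
  apply: leq_trans (leq_card_setU _ _) _; apply: leq_add.
    apply: leq_trans (card_duo _ _ _) _; rewrite cards1 muln1.
    by rewrite leq_mul2r card_trace_X orbT.
  by apply: card_third_point; rewrite cards0.
have c3 : #|T3| <= (4 * l * k * N2) ^ 2 * 'C((k - 2) * N2 + j, v).
  apply: leq_trans (_ : #|[set p in setX E E | ok p]| * 'C((k - 2) * N2 + j, v) <= _);
      last first.
    rewrite leq_mul2r; apply/orP; right.
    apply: (@leq_trans #|setX E E|).
      by apply/subset_leq_card/subsetP => p; rewrite inE => /andP[].
    by rewrite cardsX; apply: leq_mul; apply: card_cover.
  apply: card_bigcup_const => -[a b]; rewrite inE => /andP[].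
  rewrite inE /= => /andP[aE bE] /and5P[k4 ab a1 a2 /andP[b1 b2]].
  rewrite /= in k4 ab a1 a2 b1 b2 *.
  apply: leq_trans (card_pinned _ _ _) _; rewrite cards2 ab !subSS subn0.
  apply: leq_bin2l; rewrite /rest /=.
  apply: leq_trans (leq_card_setU _ _) _; apply: leq_add; last first.
    apply: card_third_point; apply: leq_trans (leq_card_setU _ _) _.
    have /ksetsP -> := subsetP cover_ksets _ aE; have /ksetsP -> := subsetP cover_ksets _ bE.
    by rewrite mul2n addnn.
  apply: (@leq_trans (2 * N2)); last by rewrite leq_mul2r; apply/orP; right; lia.
  apply: leq_trans (leq_card_setU _ _) _; rewrite mul2n -addnn; apply: leq_add;
    apply: leq_trans (card_duo _ _ _) _; rewrite -/N2 -{2}(mul1n N2) leq_mul2r.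
    by rewrite -[X in _ <= X]muln1 leq_mul ?orbT.
  by rewrite -[X in _ <= X]muln1 leq_mul ?orbT.
suff hs : cliques V v.+2 \subset T1 :|: T2 :|: T3.
  apply: leq_trans (subset_leq_card hs) _.
  apply: leq_trans (leq_card_setU _ _) _; apply: leq_add => //.
  apply: leq_trans (leq_card_setU _ _) _; rewrite mul2n -addnn mulnDl; exact: leq_add.
apply/subsetP => Q /cliquesP[/subsetP hQ /intersectingP iQ cQ].
have Qk A : A \in Q -> A \in ksets n k.
  by move=> /hQ /(subsetP (nbrs_sub _ _)) /(subsetP cover_ksets).
have tr A : A \in Q -> A \notin J set0 -> exists x d,
    [/\ x \in S, d \in D, x \in A, d \in A &
        forall y, y \in A -> y \in Om -> y = x \/ y = d].
  by move=> /hQ; apply: near_trace.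
rewrite !in_setU.
case: (boolP [exists x in S, Q \subset [set A : {set 'I_n} | x \in A] :|: J set0]).
  case/exists_inP => x xS /subsetP h; apply/orP; left; apply/orP; left.
  apply/bigcupP; exists x => //; rewrite inE cQ eqxx andbT; apply/subsetP => A hA.
  rewrite in_setU orbC; case: (boolP (A \in J set0)) => //= hJ.
  have := h A hA; rewrite in_setU (negPf hJ) orbF inE => xA.
  have [x' [d [_ dDD _ dA _]]] := tr A hA hJ.
  apply/duoP; split; first by have /ksetsP := Qk A hA.
  exists x, d; split=> //; first by rewrite inE.
  have xX : x \in X by move: xS; rewrite inE => /andP[].
  by apply: contraTneq dDD => <-; rewrite (disjointFl dD).
move/exists_inPn => nx.
case: (boolP [exists d in D, Q \subset [set A : {set 'I_n} | d \in A] :|: J set0]).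
  case/exists_inP => d dDD /subsetP h; apply/orP; left; apply/orP; right.
  apply/bigcupP; exists d => //; rewrite inE cQ eqxx andbT; apply/subsetP => A hA.
  rewrite in_setU orbC; case: (boolP (A \in J set0)) => //= hJ.
  have := h A hA; rewrite in_setU (negPf hJ) orbF inE => dA.
  have [x [d' [xS _ xA _ _]]] := tr A hA hJ.
  apply/duoP; split; first by have /ksetsP := Qk A hA.
  exists x, d; split=> //; first by rewrite inE.
  have xX : x \in X by move: xS; rewrite inE => /andP[].
  by apply: contraTneq dDD => <-; rewrite (disjointFl dD).
move/exists_inPn => nd.
apply/orP; right.
have {}nx x : x \in S -> exists A, [/\ A \in Q, A \notin J set0 & x \notin A].
  move=> /nx /subsetPn[A hA]; rewrite in_setU negb_or inE => /andP[h1 h2].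
  by exists A.
have {}nd d : d \in D -> exists A, [/\ A \in Q, A \notin J set0 & d \notin A].
  move=> /nd /subsetPn[A hA]; rewrite in_setU negb_or inE => /andP[h1 h2].
  by exists A.
have SO x : x \in S -> x \in Om by rewrite !inE => /andP[_ ->].
have DO d : d \in D -> d \in Om by rewrite !inE => ->; rewrite orbT.
have SD x d : x \in S -> d \in D -> x <> d.
  by rewrite inE => /andP[_ xX] dDD e; move: dDD; rewrite -e (disjointFl dD).
(* Edges of a bipartite graph without a common end are not pairwise
   intersecting. *)
have [a [b [x1 [d1 [x2 [d2 [[aQ aJ ta] [bQ bJ tb] x12 d12]]]]]]] :
    exists a b x1 d1 x2 d2, [/\ [/\ a \in Q, a \notin J set0 &
      [/\ x1 \in S, d1 \in D, x1 \in a, d1 \in a &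
        forall y, y \in a -> y \in Om -> y = x1 \/ y = d1]],
      [/\ b \in Q, b \notin J set0 &
      [/\ x2 \in S, d2 \in D, x2 \in b, d2 \in b &
        forall y, y \in b -> y \in Om -> y = x2 \/ y = d2]], x1 != x2 & d1 != d2].
  have /hitP[_ [x0 x0w x0X]] : w \in hit k X by case/setIdP: hw.
  have [a0 [a0Q a0J _]] : exists A, [/\ A \in Q, A \notin J set0 & x0 \notin A].
    by apply: nx; rewrite inE x0w.
  have [x [d ta]] := tr a0 a0Q a0J; have [xS dDD xa da ha] := ta.
  have [c [cQ' cJ xc]] := nx x xS.
  have [x' [d' tc]] := tr c cQ' cJ; have [xS' dDD' xc' dc' hc] := tc.
  have xx' : x != x' by apply: contraNneq xc => ->.
  case: (eqVneq d d') => [e|dd']; last by exists a0, c, x, d, x', d'.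
  subst d'; have [f [fQ fJ df]] := nd d dDD.
  have [x'' [d'' tf]] := tr f fQ fJ; have [xS'' dDD'' xf df' hf] := tf.
  have dd'' : d != d'' by apply: contraNneq df => ->.
  case: (eqVneq x x'') => [e|ne]; last by exists a0, f, x, d, x'', d''.
  by subst x''; exists c, f, x', d, x, d''; split=> //; rewrite eq_sym.
have [x1S d1D x1a d1a ha] := ta; have [x2S d2D x2b d2b hb] := tb.
have X1 x : x \in S -> x \in X by rewrite inE => /andP[].
have trX (c : {set 'I_n}) x d : d \in D -> (forall y, y \in c -> y \in Om -> y = x \/ y = d) ->
    forall y, y \in c -> y \in X -> y = x.
  move=> dDD h y yc yX; case: (h y yc) => // [|e]; first by rewrite !inE yX.
  by move: dDD; rewrite -e (disjointFl dD).
have trD (c : {set 'I_n}) x d : x \in S -> (forall y, y \in c -> y \in Om -> y = x \/ y = d) ->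
    forall y, y \in c -> y \in D -> y = d.
  move=> xS h y yc yD; case: (h y yc) => // [|e]; first exact: DO.
  by case: (SD x y xS yD).
have le1 (A B : {set 'I_n}) t : (forall y, y \in A -> y \in B -> y = t) ->
    #|A :&: B| <= 1.
  move=> h; rewrite -(cards1 t); apply/subset_leq_card/subsetP => y.
  by rewrite !inE => /andP[yA yB]; rewrite (h y).
have ab : a != b.
  by apply: contraNneq x12 => e; apply/eqP; apply: (trX b x2 d2 d2D hb); rewrite -?e ?X1.
apply/bigcupP; exists (a, b).
  rewrite inE in_setX /= !(subsetP (nbrs_sub E w)) ?hQ //=.
  rewrite /ok /= ab (le1 _ _ _ (trX _ _ _ d1D ha)) (le1 _ _ _ (trX _ _ _ d2D hb)).
  rewrite (le1 _ _ _ (trD _ _ _ x1S ha)) (le1 _ _ _ (trD _ _ _ x2S hb)) !andbT.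
  have : 1 < #|D| by apply/card_gt1P; exists d1, d2.
  by rewrite cD ltn_subRL addn1.
rewrite inE cQ eqxx subUset !sub1set aQ bQ /=; apply/subsetP => c.
rewrite in_setD => /andP[_ hc].
rewrite /rest /= !in_setU orbC.
case: (boolP (c \in J (a :|: b))) => //= cJ.
have cJ0 : c \notin J set0.
  apply: contra cJ; rewrite !inE => /andP[-> h] /=; apply: leq_trans h _.
  apply/subset_leq_card/setIS; rewrite setU0; exact: subsetUl.
have [x [d [xS dDD xc dc tc]]] := tr c hc cJ0.
have cab y : y \in c -> y \in a :|: b -> y \in Om.
  move=> yc yab; apply/negPn/negP => yO; move/negP: cJ; apply.
  rewrite inE Qk //=; apply/card_gt2P; exists x, d, y.
  have [xO dO] := (SO x xS, DO d dDD).
  split; first by rewrite !in_setI xc dc yc !(in_setU _ Om) xO dO yab !orbT.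
  split; first by apply/eqP/SD.
    by apply: contraNneq yO => <-.
  by apply: contraNneq yO => ->.
have meet (f : {set 'I_n}) : f \in Q -> f \subset a :|: b -> exists2 y, y \in f & y = x \/ y = d.
  move=> fQ fab; have /set0Pn[y] := iQ _ _ hc fQ; rewrite inE => /andP[yc yf].
  by exists y => //; apply: tc => //; apply: cab => //; apply: (subsetP fab).
have [y ya hy] := meet a aQ (subsetUl _ _).
have [y' yb hy'] := meet b bQ (subsetUr _ _).
have /ksetsP cc := Qk c hc.
have ex xx : xx \in S -> forall (A : {set 'I_n}) dd, dd \in D ->
   (forall t, t \in A -> t \in Om -> t = xx \/ t = dd) -> x \in A -> x = xx.
  by move=> _ A dd hdd hA xA; apply: (trX A xx dd) => //; apply: X1.
have ed dd : dd \in D -> forall (A : {set 'I_n}) xx, xx \in S ->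
   (forall t, t \in A -> t \in Om -> t = xx \/ t = dd) -> d \in A -> d = dd.
  by move=> _ A xx hxx hA dA; apply: (trD A xx dd).
have [e1|e1] := hy; have [e2|e2] := hy'; rewrite {}e1 in ya; rewrite {}e2 in yb.
- move/negP: x12; case; apply/eqP.
  by rewrite -(ex _ x1S a d1 d1D ha ya) -(ex _ x2S b d2 d2D hb yb).
- apply/orP; left; apply/duoP; split=> //; exists x, d; split=> //.
  + by rewrite inE ya X1.
  + by rewrite inE yb dDD.
  + exact/eqP/SD.
- apply/orP; right; apply/duoP; split=> //; exists x, d; split=> //.
  + by rewrite inE yb X1.
  + by rewrite inE ya dDD.
  + exact/eqP/SD.
- move/negP: d12; case; apply/eqP.
  by rewrite -(ed _ d1D a x1 x1S ha ya) -(ed _ d2D b x2 x2S hb yb).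
Qed.

End Near.

Lemma through_core : through \subset core.
Proof.
apply/subsetP => A /throughP[hA [d dA dDD]]; apply/setIdP; split=> //.
by apply/set0Pn; exists d; rewrite !inE dA dDD orbT.
Qed.

Lemma card_star_core x : x \in X -> k.-1 * N2 <= #|star core x| + k ^ 2 * N3.
Proof.
move=> xX.
pose P y := [set A in ksets n k | [set x; y] \subset A].
have xK y : y \in z |: D -> x != y.
  rewrite !inE => /orP[/eqP->|yD]; first by apply: contraNneq zX => <-.
  by apply: contraTneq yD => <-; rewrite (disjointFl dD).
have cK : #|z |: D| = k.-1 by rewrite cardsU1 zD cD; move: k3; clear; lia.
have cP y : y \in z |: D -> #|P y| = N2.
  move=> yK; rewrite card_sup cards2 (xK _ yK) // ltnW //.
have := @card_bigcup_ge _ _ (z |: D) P N3 _.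
rewrite (eq_bigr (fun=> N2)) // sum_nat_const cK => h.
apply: leq_trans (h _) _ => [y y' yK y'K yy'|].
  have e3 : #|[set x; y; y']| = 3.
    by rewrite -setUA cardsU1 !inE cards2 negb_or yy' !xK.
  have := card_sup_le k [set x; y; y']; rewrite e3; apply: leq_trans.
  apply/subset_leq_card/subsetP => A; rewrite !inE !subUset !sub1set.
  by case/andP=> /andP[-> /andP[-> ->]] /andP[_ /andP[_ ->]].
apply: leq_add; last first.
  by rewrite leq_mul2r leq_exp2r // leq_pred orbT.
apply/subset_leq_card/subsetP => A /bigcupP[y yK /setIdP[/ksetsP hA]].
rewrite subUset !sub1set => /andP[xA yA]; apply/setIdP; split=> //.
apply/setIdP; split; first by apply/hitP; split=> //; exists x.
by apply/set0Pn; exists y; rewrite inE yA.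
Qed.

(** The sets of [around] are a vanishing fraction of the sets that contain [x]
    and [z] but miss [D]; adding the latter to the star at [x] creates more
    cliques than the former can take part in. *)
Lemma ncl_core u : 0 < l -> 64 <= N2 ->
  4 * ((2 * k + (128 * (l * k)) ^ 2) * j) + 4 * (k ^ 2 * N3) <= N2 ->
  ncl E u <= ncl core u.
Proof.
move=> /card_gt0P[x xX]; set M := 2 * k + _ => hN2 hN.
case: u => [|u]; first by rewrite !ncl0.
have h1 := card_star_core xX.
have hPt : #|star core x :&: through| <= (k - 2) * N2.
  apply: (@leq_trans #|duo k [set x] D|); last first.
    by apply: leq_trans (card_duo _ _ _) _; rewrite cards1 mul1n cD.
  apply/subset_leq_card/subsetP => A /setIP[/setIdP[_ xA]].
  case/throughP=> /hitP[hA _] [d dA dDD]; apply/duoP; split=> //.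
  exists x, d; split=> //; first by rewrite inE.
  by apply: contraTneq dDD => <-; rewrite (disjointFl dD).
have hk2 : k.-1 * N2 = (k - 2) * N2 + N2 by move: k3; clear; case: k => [|[]] // ? _; lia.
have [Z hZ cZ] : exists2 Z : {set {set 'I_n}}, Z \subset star core x :\: through & #|Z| = N2 %/ 4.
  apply: subset_of_card; rewrite cardsD; move: h1 hPt hN hk2; clear; lia.
have ZP : Z \subset star core x by apply: subset_trans hZ (subsetDl _ _).
have dZ : [disjoint Z & through].
  rewrite disjoints_subset; apply: subset_trans hZ _.
  by apply/subsetP => A /setDP[_]; rewrite in_setC.
have hx : {in star core x, forall A : {set 'I_n}, x \in A} by move=> A /setIdP[].
have := ncl_gain u through_core (star_sub core x) ZP dZ hx.
have -> : #|star core x :\: Z| = #|star core x| - N2 %/ 4.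
  by rewrite cardsD (setIidPr ZP) cZ.
rewrite cZ; set B := _ - _ => hgain.
apply: leq_trans hgain; apply: leq_trans (ncl_setU _ _ _) _.
  by move=> A /setIdP[/hitP[hA _] _]; rewrite -card_gt0 hA; move: k3; clear; lia.
rewrite leq_add2l.
have hB : (k - 2) * N2 + j + N2 %/ 8 <= B.
  have M1 : 1 < M by rewrite /M; move: k3; clear; lia.
  have : 2 * j <= M * j by rewrite leq_mul2r M1 orbT.
  rewrite /B; move: h1 hk2 hN.
  move: ((k - 2) * N2) (k.-1 * N2) (M * j) (k ^ 2 * N3) N2 #|_| j.
  by clear; lia.
have hloc w : w \in around -> ncl (nbrs E w) u <= M * 'C(B, u).
  move=> hw; case: u => [|[|v]].
  - by rewrite ncl0 bin0 muln1 /M; move: k3; clear; lia.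
  - apply: leq_trans (ncl_le_bin _ _) _; rewrite !bin1.
    apply: leq_trans (subset_leq_card (nbrs_sub _ _)) _.
    apply: leq_trans card_cover _.
    have : N2 <= B.
      apply: leq_trans hB; rewrite -addnA; apply: leq_trans (leq_addr _ _).
      by rewrite leq_pmull //; move: k3; clear; lia.
    move=> h; apply: leq_mul => //; rewrite /M.
    have : l * k <= (l * k) ^ 2 by rewrite -mulnn; case: (l * k) => // c; apply: leq_pmulr.
    have -> : (128 * (l * k)) ^ 2 = 128 * 128 * (l * k) ^ 2 by rewrite -!mulnn mulnACA.
    rewrite -mulnA.
    by move: (l * k) (expn (l * k) 2); clear; lia.
  - apply: leq_trans (ncl_near hw v) _; rewrite /M [leqRHS]mulnDl.
    apply: leq_add.
      rewrite leq_mul2l; apply/orP; right; apply: leq_bin2l.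
      exact: leq_trans (leq_addr _ _) hB.
    have : 'C(N2 %/ 8, 2) * 'C((k - 2) * N2 + j, v) <= 'C(B, v.+2).
      apply: leq_trans (bin_mul_le _ _ _ _) _; apply: leq_bin2l.
      by rewrite addnC.
    have : N2 ^ 2 <= 1024 * 'C(N2 %/ 8, 2).
      have e1 : N2 <= 16 * (N2 %/ 8) by move: hN2; clear; lia.
      have e2 : (N2 %/ 8) ^ 2 <= 4 * 'C(N2 %/ 8, 2).
        have e3 : 4 <= N2 %/ 8 by move: hN2; clear; lia.
        rewrite bin2; move: (N2 %/ 8) e3; clear => e e3.
        have := odd_double_half (e * e.-1).
        have : odd (e * e.-1) = false by case: e e3 => // e _; rewrite oddM /= andNb.
        by move=> ->; case: e e3 => // e; nia.
      apply: (@leq_trans ((16 * (N2 %/ 8)) ^ 2)); first by rewrite leq_exp2r.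
      by rewrite expnMn; move: e2; clear; lia.
    move: ('C(_, v)) ('C(_, 2)) ('C(B, _)) => c0 c2 c3; clear; move=> f1 f2.
    have : (16 * (l * k) ^ 2 * c0) * N2 ^ 2 <= (16 * (l * k) ^ 2 * c0) * (1024 * c2).
      by rewrite leq_mul2l f1 orbT.
    have : (128 * (l * k)) ^ 2 * (c2 * c0) <= (128 * (l * k)) ^ 2 * c3.
      by rewrite leq_mul2l f2 orbT.
    have -> : (4 * l * k * N2) ^ 2 * c0 = (16 * (l * k) ^ 2 * c0) * N2 ^ 2.
      by rewrite !expnMn; lia.
    have -> : (128 * (l * k)) ^ 2 * (c2 * c0) = 16 * (l * k) ^ 2 * c0 * (1024 * c2).
      by rewrite -!mulnn mulnACA; lia.
    lia.
apply: (@leq_trans (#|around| * (M * 'C(B, u)))).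
  by rewrite -sum_nat_const; apply: leq_sum.
rewrite mulnA leq_mul2r; apply/orP; right.
apply: (@leq_trans (j * M)); first by rewrite leq_mul2r card_around orbT.
move: hN; rewrite (mulnC j); move: (M * j) (k ^ 2 * N3) N2.
by clear; lia.
Qed.

End Covers.

(** * Families containing all sets that meet a given set *)

Section Decomposition.
Variable n : nat.
Implicit Types (F G B H Q : {set {set 'I_n}}) (A : {set 'I_n}).

Definition meeting G H := [set A in G | [forall B in H, A :&: B != set0]].

Lemma meetingP G H A :
  reflect (A \in G /\ {in H, forall B : {set 'I_n}, A :&: B != set0})
          (A \in meeting G H).
Proof.
apply: (iffP setIdP) => -[hA h]; split=> //; first by move=> B hB; apply: (forall_inP h).
exact/forall_inP.
Qed.

(** Classify the cliques by their trace [H] on [B]. *)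
Lemma ncl_decomp G B t : [disjoint G & B] ->
  ncl (G :|: B) t = \sum_(H : {set {set 'I_n}} | [&& H \subset B, intersecting H & #|H| <= t])
                       ncl (meeting G H) (t - #|H|).
Proof.
move=> dGB; rewrite /ncl -sum1_card.
rewrite (partition_big (fun Q : {set {set 'I_n}} => Q :&: B)
  (fun H : {set {set 'I_n}} => [&& H \subset B, intersecting H & #|H| <= t])) /=; last first.
  move=> Q /cliquesP[_ iQ <-]; rewrite subsetIr subset_leq_card ?subsetIl // andbT.
  by apply: intersectingS iQ; apply: subsetIl.
apply: eq_bigr => H /and3P[HB iH cH].
have nG A : A \in G -> A \notin B by move=> hA; rewrite (disjointFr dGB hA).
have mG Q (A : {set 'I_n}) : Q \in cliques (meeting G H) (t - #|H|) -> A \in Q -> A \in G.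
  by case/cliquesP=> /subsetP hQ _ _ /hQ /meetingP[].
have rem Q : Q \in cliques (meeting G H) (t - #|H|) -> (H :|: Q) :&: B = H.
  move=> hQ; apply/setP => A; rewrite !inE.
  case: (boolP (A \in H)) => [/(subsetP HB) -> //|_] /=.
  by apply/negP => /andP[/(mG _ _ hQ) /nG /negP].
have remD Q : Q \in cliques (meeting G H) (t - #|H|) -> (H :|: Q) :\: B = Q.
  move=> hQ; apply/setP => A; rewrite !inE.
  case: (boolP (A \in Q)) => [/(mG _ _ hQ) /nG ->|_]; first by rewrite orbT.
  by rewrite orbF andbC; case: (boolP (A \in H)) => // /(subsetP HB) ->.
have inj : {in cliques (meeting G H) (t - #|H|) &, injective (fun Q : {set {set 'I_n}} => H :|: Q)}.
  by move=> Q R hQ hR e; rewrite -(remD _ hQ) e remD.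
rewrite -(card_in_imset inj) -sum1_card; apply: eq_bigl => Q.
apply/andP/imsetP => [[/cliquesP[hs iQ cQ] /eqP hH]|[R hR ->]].
  exists (Q :\: B); last by rewrite -hH setID.
  apply/cliquesP; split.
  - apply/subsetP => A /setDP[hA nA]; apply/meetingP; split.
      by have := subsetP hs _ hA; rewrite inE (negPf nA) orbF.
    move=> C hC; move/intersectingP: iQ; apply=> //.
    by move: hC; rewrite -hH inE => /andP[].
  - by apply: intersectingS iQ; apply: subsetDl.
  - by rewrite -cQ -hH -(cardsID B Q) addKn.
split; last by rewrite rem.
case/cliquesP: (hR) => /subsetP hs /intersectingP iR cR.
apply/cliquesP; split.
- apply/subsetP => A /setUP[/(subsetP HB)|/(mG _ _ hR)]; rewrite inE => ->;
  by rewrite ?orbT.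
- apply/intersectingP => A C /setUP[hA|hA] /setUP[hC|hC].
  + by move/intersectingP: iH; apply.
  + by rewrite setIC; have /meetingP[_] := hs _ hC; apply.
  + by have /meetingP[_] := hs _ hA; apply.
  + exact: iR.
- rewrite cardsU cR (_ : H :&: R = set0) ?cards0 ?subn0 ?subnKC //.
  apply/setP => A; rewrite !inE; apply/negP => /andP[/(subsetP HB) hB].
  by move=> /(mG _ _ hR) /nG; rewrite hB.
Qed.

Lemma sum_powerset B (g : nat -> nat) :
  \sum_(H in powerset B) g #|H| = \sum_(j < #|B|.+1) 'C(#|B|, j) * g j.
Proof.
rewrite (partition_big (fun H : {set {set 'I_n}} => inord #|H| : 'I_#|B|.+1) xpredT) //=.
apply: eq_bigr => j _; rewrite -cards_draws -sum_nat_const.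
apply: congr_big => // H.
  rewrite !inE; apply: andb_id2l => hH.
  by rewrite -val_eqE /= inordK // ltnS subset_leq_card.
by rewrite inE => /andP[hH /eqP e]; rewrite -?e ?inordK ?ltnS ?subset_leq_card.
Qed.

End Decomposition.

(** * Relabelling *)

Lemma perm_map_uniq (T : finType) (s1 s2 : seq T) :
  uniq s1 -> uniq s2 -> size s1 = size s2 -> exists s : {perm T}, map s s1 = s2.
Proof.
elim: s1 s2 => [|x s1 IH] [|y s2] //=; first by move=> *; exists 1%g.
case/andP=> x1 u1 /andP[y2 u2] [hs]; have [s es] := IH _ u1 u2 hs.
exists (s * tperm (s x) y)%g; rewrite permM tpermL; congr (_ :: _).
rewrite -es; apply/eq_in_map => z z1; rewrite permM tpermD //.
  by rewrite (inj_eq perm_inj); apply: contraNneq x1 => ->.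
by apply: contraNneq y2 => ->; rewrite -es map_f.
Qed.

Lemma perm_three_sets (T : finType) (X1 K1 Y1 X2 K2 Y2 : {set T}) :
  [disjoint X1 & K1] -> [disjoint X1 & Y1] -> [disjoint K1 & Y1] ->
  [disjoint X2 & K2] -> [disjoint X2 & Y2] -> [disjoint K2 & Y2] ->
  #|X1| = #|X2| -> #|K1| = #|K2| -> #|Y1| = #|Y2| ->
  exists s : {perm T}, [/\ s @: X1 = X2, s @: K1 = K2 & s @: Y1 = Y2].
Proof.
move=> a1 a2 a3 b1 b2 b3 cX cK cY.
have un (X K Y : {set T}) : [disjoint X & K] -> [disjoint X & Y] -> [disjoint K & Y] ->
    uniq (enum X ++ enum K ++ enum Y).
  move=> h1 h2 h3; rewrite !cat_uniq !enum_uniq /= andbT has_cat negb_or -andbA.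
  apply/and3P; split; apply/hasPn => x; rewrite /= !mem_enum => hx.
  - by rewrite (disjointFl h1).
  - by rewrite (disjointFl h2).
  - by rewrite (disjointFl h3).
have [|s] := perm_map_uniq (un _ _ _ a1 a2 a3) (un _ _ _ b1 b2 b3).
  by rewrite !size_cat -!cardE cX cK cY.
rewrite !map_cat => /eqP; rewrite eqseq_cat ?size_map -?cardE //.
rewrite eqseq_cat ?size_map -?cardE // => /and3P[/eqP e1 /eqP e2 /eqP e3].
have im (X Y : {set T}) : map s (enum X) = enum Y -> s @: X = Y.
  move=> e; apply/setP => y; rewrite -[RHS]mem_enum -e.
  by apply/imsetP/mapP => -[x hx ->]; exists x => //; rewrite ?mem_enum // -mem_enum.
by exists s; split; apply: im.
Qed.

Section Relabel.
Variables n k : nat.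
Implicit Types (H : {set {set 'I_n}}) (A X K Y : {set 'I_n}).

Lemma hit_perm (s : {perm 'I_n}) X A : A \in hit k X -> s @: A \in hit k (s @: X).
Proof.
case/hitP=> hA [x xA xX]; apply/hitP; rewrite card_imset; last exact: perm_inj.
by split=> //; exists (s x); apply: imset_f.
Qed.

Lemma ncl_perm (s : {perm 'I_n}) (F G : {set {set 'I_n}}) t :
  {in F, forall A : {set 'I_n}, s @: A \in G} -> ncl F t <= ncl G t.
Proof.
apply: ncl_inj => [|A B /set0Pn[x /setIP[xA xB]]]; first exact/imset_inj/perm_inj.
by apply/set0Pn; exists (s x); rewrite inE !imset_f.
Qed.

(** For [k]-sets containing a kernel [K] of [k - 1] points, the sets correspond to
    their points outside [K]. *)
Definition petals K H := [set y | (y \notin K) && (y |: K \in H)].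

Lemma sunflowerE K H : #|K| = k.-1 -> 0 < k -> H \subset ksets n k ->
  {in H, forall A, K \subset A} ->
  H = [set y |: K | y in petals K H] /\ #|petals K H| = #|H|.
Proof.
move=> cK k0 /subsetP Hk hK.
have e : H = [set y |: K | y in petals K H].
  apply/setP => A; apply/idP/imsetP => [hA|[y]]; last by rewrite inE => /andP[_ h] ->.
  have := cardsD A K; rewrite (setIidPr (hK _ hA)) (ksetsP k _ (Hk _ hA)) cK.
  have -> : k - k.-1 = 1 by move: k0; clear; lia.
  move/eqP/cards1P => [y ey].
  have yA : y |: K = A.
    by rewrite -ey setUC -{1}(setIidPr (hK _ hA)) setID.
  exists y => //; rewrite inE yA hA andbT.
  by have : y \in A :\: K; [rewrite ey inE | rewrite inE => /andP[]].
split=> //; rewrite {2}e card_in_imset // => y y'.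
rewrite !inE => /andP[yK _] /andP[y'K _] e'.
have : y \in y' |: K by rewrite -e' setU11.
by rewrite !inE (negPf yK) orbF => /eqP.
Qed.

Lemma ncl_sunflower X1 K1 (H1 : {set {set 'I_n}}) X2 K2 (H2 : {set {set 'I_n}}) u :
  0 < k -> #|X1| = #|X2| -> #|H1| = #|H2| ->
  #|K1| = k.-1 -> [disjoint X1 & K1] -> H1 \subset ksets n k ->
  {in H1, forall A : {set 'I_n}, K1 \subset A /\ [disjoint X1 & A]} ->
  #|K2| = k.-1 -> [disjoint X2 & K2] -> H2 \subset ksets n k ->
  {in H2, forall A : {set 'I_n}, K2 \subset A /\ [disjoint X2 & A]} ->
  ncl (meeting (hit k X1) H1) u <= ncl (meeting (hit k X2) H2) u.
Proof.
move=> k0 cX cH cK1 d1 s1 h1 cK2 d2 s2 h2.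
have [e1 c1] := sunflowerE cK1 k0 s1 (fun A hA => (h1 A hA).1).
have [e2 c2] := sunflowerE cK2 k0 s2 (fun A hA => (h2 A hA).1).
have dP (X K : {set 'I_n}) (H : {set {set 'I_n}}) : {in H, forall A : {set 'I_n}, K \subset A /\ [disjoint X & A]} ->
    [disjoint X & petals K H] /\ [disjoint K & petals K H].
  move=> h; split; rewrite disjoint_sym disjoint_subset; apply/subsetP => y.
    rewrite inE => /andP[_ hy]; rewrite inE; apply/negP => yX.
    by have := disjointFr (h _ hy).2 yX; rewrite setU11.
  by rewrite !inE => /andP[].
have [p1 q1] := dP _ _ _ h1; have [p2 q2] := dP _ _ _ h2.
have [s [sX sK sY]] : exists s : {perm 'I_n},
    [/\ s @: X1 = X2, s @: K1 = K2 & s @: petals K1 H1 = petals K2 H2].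
  by apply: perm_three_sets => //; rewrite ?cK1 ?cK2 ?c1 ?c2.
apply: (@ncl_perm s) => A /meetingP[hA hm]; apply/meetingP; split.
  by rewrite -sX hit_perm.
move=> B; rewrite e2 => /imsetP[y2]; rewrite -sY => /imsetP[y hy ->] ->.
have -> : s y |: K2 = s @: (y |: K1) by rewrite imsetU1 sK.
have /set0Pn[x /setIP[xA xB]] : A :&: (y |: K1) != set0.
  by apply: hm; rewrite e1; apply/imsetP; exists y.
by apply/set0Pn; exists (s x); rewrite inE !imset_f.
Qed.

End Relabel.

(** * Families containing [l] full stars *)

Section FullStars.
Variables n k l : nat.
Hypotheses (k1 : 1 < k) (nlk : l + k <= n).
Hypothesis small : 2 < k -> 64 <= 'C(n - 2, k - 2) /\
  4 * ((2 * k + (128 * (l * k)) ^ 2) * ((l + 7 * k) ^ 3 * 'C(n - 3, k - 3)))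
  + 4 * (k ^ 2 * 'C(n - 3, k - 3)) <= 'C(n - 2, k - 2).
Implicit Types (F H : {set {set 'I_n}}) (A B C E X K D : {set 'I_n}).

Lemma set_between (T : finType) (P Q : {set T}) r :
  P \subset Q -> #|P| <= r <= #|Q| ->
  exists S : {set T}, [/\ P \subset S, S \subset Q & #|S| = r].
Proof.
move=> PQ /andP[h1 h2].
have [R RQ cR] : exists2 R : {set T}, R \subset Q :\: P & #|R| = r - #|P|.
  by apply: subset_of_card; rewrite cardsD (setIidPr PQ) leq_sub2r.
exists (P :|: R); split; first exact: subsetUl.
  by rewrite subUset PQ (subset_trans RQ) ?subsetDl.
rewrite cardsU cR (_ : P :&: R = set0) ?cards0 ?subn0 ?subnKC //.
apply/setP => x; rewrite !inE; apply/negP => /andP[xP /(subsetP RQ)].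
by rewrite inE xP.
Qed.

(** A family that is not a sunflower with a kernel of [k - 1] points has three
    members that already show it. *)
Lemma three_members H X : H \subset ksets n k -> #|X| = l ->
  {in H, forall A : {set 'I_n}, [disjoint X & A]} ->
  (exists K, [/\ #|K| = k.-1, [disjoint X & K] & {in H, forall A : {set 'I_n}, K \subset A}]) \/
  (exists A B C : {set 'I_n}, [/\ A \in H, B \in H, C \in H & #|A :&: B :&: C| <= k - 2]).
Proof.
move=> /subsetP Hk cX dX.
have cA A : A \in H -> #|A| = k by move=> /Hk /ksetsP.
pose I := \bigcap_(A in H) A.
case: (leqP k.-1 #|I :\: X|) => [/subset_of_card[K hK cK]|hI].
  left; exists K; split=> //.
    rewrite disjoint_sym disjoints_subset; apply: subset_trans hK _.
    by apply/subsetP => x; rewrite !inE => /andP[].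
  move=> A hA; apply: subset_trans hK _; apply: subset_trans (subsetDl _ _) _.
  exact: bigcap_inf.
right.
case: (set_0Vmem H) => [H0|[A hA]].
  move: hI; rewrite /I H0 big_set0 cardsD setTI cX cardsT card_ord.
  by move: nlk k1; clear; lia.
have IA : I \subset A by apply: bigcap_inf.
have IX : I :\: X = I.
  by apply/setDidPl; rewrite disjoint_sym; apply: disjointWr IA (dX A hA).
rewrite IX in hI.
have [B hB AB] : exists2 B : {set 'I_n}, B \in H & ~~ (A \subset B).
  apply/exists_inP; rewrite -negb_forall_in; apply/negP => /forall_inP h.
  have : A \subset I by apply/bigcapsP.
  by move/subset_leq_card; rewrite cA //; move: hI k1; clear; lia.
have cAB : #|A :&: B| <= k.-1.
  rewrite -ltnS prednK; last by apply: ltnW.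
  rewrite -(cA A hA); apply: proper_card; rewrite properEneq subsetIl andbT.
  by apply: contra AB => /eqP <-; apply: subsetIr.
case: (leqP #|A :&: B| (k - 2)) => [h|h].
  by exists A, B, B; split=> //; rewrite -setIA setIid.
have [C hC ABC] : exists2 C : {set 'I_n}, C \in H & ~~ (A :&: B \subset C).
  apply/exists_inP; rewrite -negb_forall_in; apply/negP => /forall_inP h'.
  have : A :&: B \subset I by apply/bigcapsP.
  by move/subset_leq_card; move: hI h k1; clear; lia.
exists A, B, C; split=> //.
have : #|A :&: B :&: C| < #|A :&: B|.
  apply: proper_card; rewrite properEneq subsetIl andbT.
  by apply: contra ABC => /eqP <-; apply: subsetIr.
by move: cAB k1; clear; lia.
Qed.

Lemma ncl_cores (X1 K1 X2 K2 : {set 'I_n}) u : #|X1| = #|X2| -> #|K1| = #|K2| ->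
  [disjoint X1 & K1] -> [disjoint X2 & K2] ->
  ncl [set A in hit k X1 | A :&: K1 != set0] u <=
  ncl [set A in hit k X2 | A :&: K2 != set0] u.
Proof.
move=> cX cK d1 d2.
have [s [sX sK _]] : exists s : {perm 'I_n},
    [/\ s @: X1 = X2, s @: K1 = K2 & s @: set0 = set0].
  by apply: perm_three_sets; rewrite ?disjoints0 // disjoint_sym disjoints_subset sub0set.
apply: (@ncl_perm _ s) => A /setIdP[hA /set0Pn[x /setIP[xA xK]]].
apply/setIdP; split; first by rewrite -sX hit_perm.
by apply/set0Pn; exists (s x); rewrite -sK inE !imset_f.
Qed.

(** The trace [H1] of a clique is compared with a sunflower [H2] of the same size:
    any set that meets the kernel [K2] meets all of [H2], whereas only
    [O(N3)] sets meet all of [H1] without meeting a set [D] of [k - 2] points. *)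
Lemma ncl_meeting_le (X1 : {set 'I_n}) (H1 : {set {set 'I_n}}) (X2 K2 : {set 'I_n})
    (H2 : {set {set 'I_n}}) u :
  #|X1| = l -> H1 \subset ksets n k -> {in H1, forall A : {set 'I_n}, [disjoint X1 & A]} ->
  #|X2| = l -> #|K2| = k.-1 -> [disjoint X2 & K2] -> H2 \subset ksets n k ->
  {in H2, forall A : {set 'I_n}, K2 \subset A /\ [disjoint X2 & A]} -> #|H1| = #|H2| ->
  ncl (meeting (hit k X1) H1) u <= ncl (meeting (hit k X2) H2) u.
Proof.
move=> cX1 s1 d1 cX2 cK2 dK2 s2 d2 cH.
have k0 : 0 < k by apply: ltnW.
case: (three_members s1 cX1 d1) => [[K [cK dK hK]]|[A [B [C [hA hB hC cI]]]]].
  apply: (@ncl_sunflower _ _ X1 K H1 X2 K2 H2) => //; first by rewrite cX1.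
  by move=> A hA; split; [apply: hK | apply: d1].
have cA E : E \in H1 -> #|E| = k by move=> /(subsetP s1) /ksetsP.
have [D [ID DA cD]] : exists D : {set 'I_n},
    [/\ A :&: B :&: C \subset D, D \subset A & #|D| = k - 2].
  apply: set_between; first by rewrite -setIA subsetIl.
  by rewrite cI cA // leq_subr.
pose U := A :|: B :|: C.
have dX E : E \in H1 -> [disjoint E & X1] by move=> hE; rewrite disjoint_sym d1.
have dD : [disjoint D & X1] by apply: disjointWl DA (dX A hA).
have dU : [disjoint U & X1] by rewrite -!setI_eq0 !setIUl !setU_eq0 !setI_eq0 !dX.
have cU : #|U| <= 3 * k.
  have [+ _] := leq_card_setU (A :|: B) C; have [+ _] := leq_card_setU A B.
  by rewrite -/U (cA A hA) (cA B hB) (cA C hC); clear; lia.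
have [z zA zD] : exists2 z, z \in A & z \notin D.
  apply/subsetPn/negP => /subset_leq_card; rewrite cA // cD.
  by move: k1; clear; lia.
have zX : z \notin X1 by rewrite (disjointFr (dX A hA) zA).
have sub : meeting (hit k X1) H1 \subset through k X1 D :|: around k X1 D U.
  apply/subsetP => E /meetingP[hE hm]; rewrite in_setU.
  case: (boolP (E :&: D == set0)) => [dE|nE]; last first.
    by apply/orP; left; apply/setIdP.
  apply/orP; right; apply/setIdP; split=> //; rewrite dE /= ltnNge; apply/negP => h.
  have /set0Pn[a /setIP[aE aA]] := hm A hA.
  have /set0Pn[b /setIP[bE bB]] := hm B hB.
  have /set0Pn[c /setIP[cE cC]] := hm C hC.
  have uni x y : x \in E -> y \in E -> x \in U -> y \in U -> x = y.
    move=> xE yE xU yU; apply/eqP/negPn/negP => xy; move: h; rewrite leqNgt => /negP[].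
    by apply/card_gt1P; exists x, y; rewrite !in_setI xE yE xU yU.
  have [aU bU cU'] : [/\ a \in U, b \in U & c \in U].
    by rewrite !inE aA bB cC !orbT.
  have ab := uni a b aE bE aU bU; have ac := uni a c aE cE aU cU'.
  have : a \in D by apply: (subsetP ID); rewrite !in_setI aA {1}ab bB ac cC.
  by move=> aD; move/eqP/setP: dE => /(_ a); rewrite !inE aE aD.
have coreX2 : [set E in hit k X2 | E :&: K2 != set0] \subset meeting (hit k X2) H2.
  apply/subsetP => E /setIdP[hE /set0Pn[x /setIP[xE xK]]]; apply/meetingP.
  split=> // F hF; apply/set0Pn; exists x; rewrite inE xE.
  exact: (subsetP (d2 F hF).1).
apply: leq_trans (ncl_sub _ coreX2).
have [l0|l0] := posnP l.
  apply: ncl_sub; apply/subsetP => E /meetingP[/hitP[_ [x _]]].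
  by have /cards0_eq -> := etrans cX1 l0; rewrite inE.
case: (ltnP 2 k) => [k3|k2]; last first.
  apply: ncl_sub; apply: subset_trans sub _; apply/subsetP => E.
  have k2' : k = 2 by move: k1 k2; clear; lia.
  have D0 : D = set0 by apply: cards0_eq; rewrite cD k2'.
  case/setUP=> /setIdP[/hitP[cE [x xE xX]]]; first by rewrite D0 setI0 eqxx.
  case/andP=> _ h.
  have : #|E :&: U| + #|E :&: X1| <= 2.
    rewrite -k2' -cE -(cardsID U E) leq_add2l.
    apply/subset_leq_card/subsetP => y /setIP[yE yX].
    by rewrite in_setD yE (disjointFl dU yX).
  have : 0 < #|E :&: X1| by apply/card_gt0P; exists x; rewrite inE xE.
  by move: h; clear; lia.
have [N64 hN] := small k3.
apply: leq_trans (ncl_sub _ sub) _.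
apply: leq_trans (ncl_core k3 cD cU dD dU zX zD _ _ _ _) _; rewrite ?cX1 //.
apply: ncl_cores; rewrite ?cX1 ?cX2 //.
  by rewrite cardsU1 zD cD cK2; move: k3; clear; lia.
rewrite disjoint_sym -setI_eq0 setIUl setU_eq0 !setI_eq0 dD andbT.
by rewrite disjoints1.
Qed.

(** All subfamilies of [L :\: hit k X2] are sunflowers with kernel [K], hence
    intersecting, so that [L] does best for every possible trace, and both
    families have equally many traces of each size. *)
Theorem ncl_full_stars (X1 : {set 'I_n}) F (X2 K : {set 'I_n}) (L : {set {set 'I_n}}) t :
  #|X1| = l -> hit k X1 \subset F -> F \subset ksets n k ->
  #|X2| = l -> #|K| = k.-1 -> [disjoint X2 & K] ->
  hit k X2 \subset L -> L \subset ksets n k ->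
  {in L :\: hit k X2, forall A : {set 'I_n}, K \subset A} ->
  #|F| = #|L| -> ncl F t <= ncl L t.
Proof.
move=> cX1 h1 Fk cX2 cK dK h2 Lk hK cFL.
have split_fam X (G : {set {set 'I_n}}) : hit k X \subset G -> G \subset ksets n k ->
  [/\ G = hit k X :|: (G :\: hit k X), [disjoint hit k X & G :\: hit k X],
      G :\: hit k X \subset ksets n k &
      {in G :\: hit k X, forall A : {set 'I_n}, [disjoint X & A]}].
  move=> hX Gk; split.
  - by rewrite setDE setUIr setUCr setIT; apply/esym/setUidPr.
  - by rewrite disjoint_sym disjoints_subset setDE subsetIr.
  - exact: subset_trans (subsetDl _ _) Gk.
  - move=> A /setDP[hA nA]; rewrite -setI_eq0; apply/eqP/setP => x; rewrite !inE.
    apply/negP => /andP[xX xA]; move/hitP: nA; apply; split; last by exists x.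
    by have /ksetsP := subsetP Gk _ hA.
have [eF dF sF fF] := split_fam _ _ h1 Fk.
have [eL dL sL fL] := split_fam _ _ h2 Lk.
set B1 := F :\: hit k X1 in eF dF sF fF; set B2 := L :\: hit k X2 in eL dL sL fL hK.
have cB : #|B1| = #|B2|.
  by rewrite !cardsD (setIidPr h1) (setIidPr h2) cFL !card_hit cX1 cX2.
rewrite eF eL !ncl_decomp //.
(* The best completion of a trace of size [j] on the side of [F]. *)
pose psi j := \max_(H in powerset B1 | #|H| == j) ncl (meeting (hit k X1) H) (t - j).
pose g j := if j <= t then psi j else 0.
apply: (@leq_trans (\sum_(H in powerset B1) g #|H|)).
  rewrite [leqRHS]big_mkcond [leqLHS]big_mkcond; apply: leq_sum => H _.
  case: ifP => // /and3P[hH _ cH]; rewrite inE hH /g cH.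
  by apply: (@leq_bigmax_cond _ _ _ H); rewrite inE hH eqxx.
rewrite sum_powerset cB -sum_powerset.
rewrite [leqRHS]big_mkcond [leqLHS]big_mkcond; apply: leq_sum => H _.
rewrite inE; case: (boolP (H \subset B2)) => //= hH; rewrite /g.
case: (leqP #|H| t) => cH; last by rewrite andbF.
rewrite andbT; have -> : intersecting H.
  have /card_gt0P[x xK] : 0 < #|K| by rewrite cK; move: k1; clear; lia.
  apply: (@star_intersecting _ x) => A /(subsetP hH) hA.
  exact: (subsetP (hK A hA)).
apply/bigmax_leqP => H1; rewrite inE => /andP[hH1 /eqP cH1].
apply: (@ncl_meeting_le X1 H1 X2 K H) => //.
- exact: subset_trans hH1 sF.
- by move=> A /(subsetP hH1) /fF.
- exact: subset_trans hH sL.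
- by move=> A /(subsetP hH) hA; split; [apply: hK | apply: fL].
Qed.

End FullStars.

(** * From clique counts to probabilities *)

Section Probability.
Import Order.TTheory GRing.Theory Num.Theory.
Local Open Scope ring_scope.
Variables (R : realType) (n : nat).

(** A subfamily of size [t] has the weight [p ^ t * (1 - p) ^ (#|F| - t)]. *)
Lemma prob_intersecting (p : R) (F : {set {set 'I_n}}) :
  prob_subfamily p F (@intersecting n) =
  \sum_(t < #|F|.+1) (p ^+ t * (1 - p) ^+ (#|F| - t)) *+ ncl F t.
Proof.
rewrite /prob_subfamily (partition_big (fun G : {set {set 'I_n}} =>
  inord #|G| : 'I_#|F|.+1) xpredT) //=.
apply: eq_bigr => t _; rewrite -sumr_const; apply: congr_big => // G.
  rewrite [RHS]inE -andbA; apply: andb_id2l => hG; apply: andb_id2l => _.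
  by rewrite -val_eqE /= inordK // ltnS subset_leq_card.
case/andP=> /andP[hG _] /eqP <-; rewrite inordK ?ltnS ?subset_leq_card //.
rewrite (bigID (mem G)) /=; congr (_ * _).
  rewrite (eq_bigr (fun=> p)) => [|A /andP[_ ->]//].
  rewrite prodr_const; congr (_ ^+ _); apply: eq_card => A.
  by apply/andP/idP => [[]//|hA]; split; rewrite ?(subsetP hG).
rewrite (eq_bigr (fun=> 1 - p)) => [|A /andP[_ /negPf ->]//].
rewrite prodr_const; congr (_ ^+ _); rewrite -[in RHS](cardsID G F) (setIidPr hG).
rewrite addKn; apply: eq_card => A; rewrite inE.
by apply/andP/andP => -[].
Qed.

Lemma most_probably_of_ncl k m (L : {set {set 'I_n}}) :
  L \subset ksets n k -> #|L| = m ->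
  (forall (F : {set {set 'I_n}}) t, F \subset ksets n k -> #|F| = m ->
     (ncl F t <= ncl L t)%N) ->
  most_probably_intersecting R n k m L.
Proof.
move=> hL cL h; split=> // p F /andP[p0 p1] hF cF.
rewrite !prob_intersecting cF cL; apply: ler_sum => t _.
rewrite -[leLHS]mulr_natr -[leRHS]mulr_natr.
apply: ler_wpM2l; last by rewrite ler_nat h.
by rewrite mulr_ge0 // exprn_ge0 // subr_ge0.
Qed.

End Probability.

(** * Initial segments of the lexicographic order *)

Section Lex.
Variable n : nat.
Implicit Types (A B C : {set 'I_n}) (P : {set {set 'I_n}}).

Lemma is_minP A i : reflect (i \in A /\ forall j : 'I_n, j \in A -> i <= j) (is_min A i).
Proof.
apply: (iffP andP) => -[hi h]; split=> //; first exact/forall_inP.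
exact/forall_inP.
Qed.

Lemma symdiffP A B i : (i \in symdiff A B) = (i \in A) (+) (i \in B).
Proof. by rewrite !inE; case: (i \in A); case: (i \in B). Qed.

Lemma symdiffC A B : symdiff A B = symdiff B A.
Proof. by rewrite /symdiff setUC. Qed.

Lemma exists_min A : A != set0 -> exists i, is_min A i.
Proof.
case/set0Pn=> i0 hi0; case: (arg_minnP (fun i : 'I_n => i : nat) hi0) => i hi h.
by exists i; apply/is_minP.
Qed.

Lemma lex_ltP A B :
  reflect (exists i : 'I_n, [/\ i \in A, i \notin B &
             forall j : 'I_n, j < i -> (j \in A) = (j \in B)])
          (lex_lt A B).
Proof.
apply: (iffP exists_inP) => [[i hi /is_minP[h1 h2]]|[i [hA hB h]]].
  exists i; split=> //; first by move: h1; rewrite symdiffP hi.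
  move=> j ji; have := h2 j; rewrite symdiffP leqNgt ji.
  by case: (j \in A); case: (j \in B) => //= /(_ isT).
exists i => //; apply/is_minP; rewrite symdiffP hA (negPf hB); split=> // j.
by rewrite symdiffP leqNgt; apply: contraL => /h ->; rewrite addbb.
Qed.

Lemma lex_lt_asym A B : lex_lt A B -> ~~ lex_le B A.
Proof.
move=> h; apply/negP => /orP[/eqP e|].
  by move: h; rewrite e => /lex_ltP[i [-> ]].
case/lex_ltP: h => i [iA iB hi] /lex_ltP[j [jB jA hj]].
case: (ltngtP i j) => [ij|ji|/val_inj e].
- by move: iB; rewrite (hj i ij) iA.
- by move: jA; rewrite (hi j ji) jB.
- by move: iB; rewrite e jB.
Qed.

Lemma lex_total : total (@lex_le n).
Proof.
move=> A B; rewrite /lex_le (eq_sym B A); case: eqP => //= AB.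
have [|i /is_minP[hi hm]] := @exists_min (symdiff A B).
  apply/negP => /eqP/setP h; case: AB; apply/setP => i.
  by have := h i; rewrite symdiffP inE; case: (i \in A); case: (i \in B).
have mi : is_min (symdiff A B) i by apply/is_minP.
move: (hi); rewrite symdiffP; case: (boolP (i \in A)) => iA /= iB.
  by apply/orP; left; apply/exists_inP; exists i.
by apply/orP; right; apply/exists_inP; exists i; rewrite // symdiffC.
Qed.

Lemma lex_trans : transitive (@lex_le n).
Proof.
move=> B A C /orP[/eqP -> //|hAB] /orP[/eqP <-|hBC].
  by rewrite /lex_le hAB orbT.
apply/orP; right; case/lex_ltP: hAB => i [iA iB hi]; case/lex_ltP: hBC => j [jB jC hj].
apply/lex_ltP; case: (ltngtP i j) => [ij|ji|/val_inj e].
- exists i; rewrite -(hj i ij); split=> // a ai.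
  by rewrite hi // hj // (ltn_trans ai).
- exists j; rewrite (hi j ji); split=> // a aj.
  by rewrite hi ?hj // (ltn_trans aj).
- by move: iB; rewrite e jB.
Qed.

Lemma lex_family_props k m : m <= #|ksets n k| ->
  [/\ lex_family n k m \subset ksets n k, #|lex_family n k m| = m
    & forall A B, A \in lex_family n k m -> B \in ksets n k ->
        B \notin lex_family n k m -> lex_le A B].
Proof.
move=> hm; set s := sort (@lex_le n) (enum (ksets n k)).
have us : uniq s by rewrite sort_uniq enum_uniq.
have ms A : (A \in s) = (A \in ksets n k) by rewrite mem_sort mem_enum.
have eL A : (A \in lex_family n k m) = (A \in take m s) by rewrite inE.
have ht A : A \in take m s -> A \in s by apply: mem_take.
split.
- by apply/subsetP => A; rewrite eL => /ht; rewrite ms.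
- rewrite -[RHS](@size_takel m _ s); last by rewrite size_sort -cardE.
  rewrite -(card_uniqP (take_uniq m us)); apply: eq_card => A; exact: eL.
- move=> A B; rewrite !eL => hA hB nB.
  have : pairwise (@lex_le n) s.
    by rewrite -sorted_pairwise ?sort_sorted //; [exact: lex_total | exact: lex_trans].
  rewrite -(cat_take_drop m s) pairwise_cat => /andP[/allrelP h _]; apply: h => //.
  by have := ms B; rewrite hB -{1}(cat_take_drop m s) mem_cat (negPf nB) /= => ->.
Qed.

(** A family [P] that precedes its complement is comparable with every initial
    segment of the order. *)
Lemma lex_family_initial k m P : m <= #|ksets n k| -> P \subset ksets n k ->
  (forall A B, A \in P -> B \in ksets n k -> B \notin P -> lex_lt A B) ->
  (#|P| <= m -> P \subset lex_family n k m) /\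
  (m <= #|P| -> lex_family n k m \subset P).
Proof.
move=> hm hP hlt; have [Lk cL hL] := lex_family_props hm.
split=> hc; apply/negPn/negP => /subsetPn[A hA nA].
- have hs : lex_family n k m \subset P :\ A.
    apply/subsetP => B hB; rewrite in_setD1 (_ : B != A); last first.
      by apply: contraNneq nA => <-.
    apply/negPn/negP => nB.
    have := lex_lt_asym (hlt A B hA (subsetP Lk _ hB) nB).
    by rewrite (hL B A hB (subsetP hP _ hA) nA).
  by have := subset_leq_card hs; rewrite cL leqNgt (leq_trans _ hc) // [leqRHS](cardsD1 A) hA.
- have hs : P \subset lex_family n k m :\ A.
    apply/subsetP => B hB; rewrite in_setD1 (_ : B != A); last first.
      by apply: contraNneq nA => <-.
    apply/negPn/negP => nB.
    have := lex_lt_asym (hlt B A hB (subsetP Lk _ hA) nA).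
    by rewrite (hL A B hA (subsetP hP _ hB) nB).
  have := subset_leq_card hs; rewrite leqNgt (leq_trans _ hc) //.
  by rewrite -[leqRHS]cL [leqRHS](cardsD1 A) hA.
Qed.

(** Take for [X] the first [l] points and for [K] the next [k - 1].  Both
    [hit k X] and its union with the sets containing [K] precede their
    complements, and the bounds on [m] place the segment between the two. *)
Lemma lex_family_structure k l m : 0 < k -> l + k <= n ->
  'C(n, k) - 'C(n - l, k) <= m -> m <= 'C(n, k) - 'C(n - l, k) + n - l - k + 1 ->
  exists X K : {set 'I_n}, let L := lex_family n k m in
    [/\ #|X| = l, #|K| = k.-1, [disjoint X & K] &
     [/\ hit k X \subset L, L \subset ksets n k, #|L| = m
      & {in L :\: hit k X, forall A, K \subset A}]].
Proof.
move=> k0 hn h1 h2.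
pose X := [set i : 'I_n | i < l]; pose K := [set i : 'I_n | l <= i < l + k.-1].
have ltE c : c <= n -> #|[set i : 'I_n | i < c]| = c.
  move=> hc; have inj : injective (widen_ord hc) by move=> i j /(congr1 val) /= /val_inj.
  rewrite -[RHS]card_ord -(card_imset _ inj).
  apply: eq_card => i; rewrite inE; apply/idP/imsetP => [hi|[j _ ->]]; last exact: (ltn_ord j).
  by exists (Ordinal hi) => //; apply: val_inj.
have cX : #|X| = l by apply: ltE; move: hn; clear; lia.
have dXK : [disjoint X & K].
  rewrite disjoints_subset; apply/subsetP => i; rewrite !inE => hi.
  by rewrite leqNgt hi.
have XK : X :|: K = [set i : 'I_n | i < l + k.-1].
  apply/setP => i; rewrite !inE; move: (nat_of_ord i); clear; lia.
have cXK : #|X :|: K| = l + k.-1 by rewrite XK ltE //; move: hn k0; clear; lia.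
have cK : #|K| = k.-1.
  by move: cXK; rewrite cardsU (eqP (_ : X :&: K == set0)) ?setI_eq0 // cards0 cX; clear; lia.
exists X, K => L.
pose P2 := hit k X :|: [set A in ksets n k | (K \subset A) && (A :&: X == set0)].
have P2k : P2 \subset ksets n k.
  by rewrite subUset hit_sub; apply/subsetP => A /setIdP[].
have cP2 : m <= #|P2|.
  pose C2 := [set A in ksets n k | (K \subset A) && (A :&: X == set0)].
  have cC : #|~: (X :|: K)| <= #|C2|.
    have inj : {in ~: (X :|: K) &, injective (fun y => y |: K)}.
      move=> y y' hy _ e; have : y \in y' |: K by rewrite -e setU11.
      by move: hy; rewrite in_setC in_setU negb_or => /andP[_ /negPf yK];
         rewrite in_setU1 yK orbF => /eqP.
    rewrite -(card_in_imset inj); apply/subset_leq_card/subsetP => _ /imsetP[y hy ->].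
    move: hy; rewrite in_setC in_setU negb_or => /andP[yX yK].
    apply/setIdP; split; first by apply/ksetsP; rewrite cardsU1 yK cK add1n prednK.
    rewrite subsetUr setIUl setU_eq0 [K :&: X]setIC !setI_eq0 dXK andbT.
    by rewrite disjoints1.
  have hd : hit k X :&: C2 = set0.
    apply/setP => A; rewrite !inE; apply/negP => /andP[/andP[_ /negP h] /and3P[_ _ h']].
    exact: h.
  have cc : #|X :|: K| + #|~: (X :|: K)| = n by rewrite cardsC card_ord.
  rewrite /P2 cardsU hd cards0 subn0 card_hit cX.
  move: h2 cC cc hn k0; rewrite cXK.
  by move: ('C(n, k)) ('C(n - l, k)) #|~: _| #|C2|; clear; lia.
have hm : m <= #|ksets n k| by apply: leq_trans cP2 (subset_leq_card P2k).
have [Lk cL _] := lex_family_props hm.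
have lt1 A B : A \in hit k X -> B \in ksets n k -> B \notin hit k X -> lex_lt A B.
  case/hitP=> _ [x xA xX] /ksetsP hB nB.
  have dB (i : 'I_n) : i < l -> i \notin B.
    move=> il; apply: contra nB => iB; apply/hitP; split=> //; exists i => //.
    by rewrite inE.
  have [|i /is_minP[iA hi]] := @exists_min A; first by apply/set0Pn; exists x.
  have il : i < l by apply: leq_ltn_trans (hi x xA) _; move: xX; rewrite inE.
  apply/lex_ltP; exists i; split=> //; first exact: dB.
  move=> j ji; rewrite (negPf (dB j (ltn_trans ji il))).
  by apply/negP => /hi; rewrite leqNgt ji.
have lt2 A B : A \in P2 -> B \in ksets n k -> B \notin P2 -> lex_lt A B.
  rewrite in_setU => hA hB; rewrite in_setU negb_or => /andP[nB nB2].
  case/orP: hA => [hA|/setIdP[_ /andP[KA AX]]]; first exact: lt1.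
  have BX : B :&: X == set0 by apply: contraR nB => h; apply/setIdP.
  have /subsetPn[y yK yB] : ~~ (K \subset B).
    by apply: contra nB2 => h; apply/setIdP; rewrite h.
  have [|i /is_minP[iA hi]] := @exists_min (symdiff A B).
    by apply/set0Pn; exists y; rewrite symdiffP (subsetP KA) // (negPf yB).
  have iy : i <= y by apply: hi; rewrite symdiffP (subsetP KA) // (negPf yB).
  have yl : y < l + k.-1 by move: yK; rewrite inE => /andP[].
  have iX : i \notin X.
    apply/negP => iX; move: iA; rewrite symdiffP.
    move/eqP/setP: AX => /(_ i); move/eqP/setP: BX => /(_ i).
    by rewrite !inE -[i < l]/(i < l); move: iX; rewrite inE => ->; rewrite !andbT => -> ->.
  have iK : i \in K.
    have : i \in X :|: K by rewrite XK inE (leq_ltn_trans iy).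
    by rewrite in_setU (negPf iX).
  apply/exists_inP; exists i; first exact: (subsetP KA).
  by apply/is_minP.
have hitL := (lex_family_initial hm (hit_sub k X) lt1).1.
have subP2 := (lex_family_initial hm P2k lt2).2 cP2.
split=> //; split=> //; first by apply: hitL; rewrite card_hit cX.
move=> A /setDP[hA nA].
by have /setUP[h|/setIdP[_ /andP[]//]] := subsetP subP2 _ hA; rewrite h in nA.
Qed.

End Lex.

(** * Graphs covered by few vertices *)

Section Graph.
Variable n : nat.
Implicit Types (G F R : {set {set 'I_n}}) (A B C e X : {set 'I_n}) (x y z : 'I_n).

Lemma edgeP A : A \in ksets n 2 -> forall x, x \in A ->
  exists2 y, x != y & A = [set x; y].
Proof.
rewrite inE => /cards2P[a [b [ab ->]]] x; rewrite !inE => /orP[] /eqP ->.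
  by exists b.
by exists a; [rewrite eq_sym | rewrite setUC].
Qed.

Lemma edge_inj x y z : [set x; y] = [set x; z] -> y = z.
Proof.
move=> e; have : y \in [set x; z] by rewrite -e !inE eqxx orbT.
have : z \in [set x; y] by rewrite e !inE eqxx orbT.
by rewrite !inE => /orP[] /eqP h1 /orP[] /eqP h2 //; rewrite h1 h2.
Qed.

Definition tri G x y := [set z | ([set x; z] \in G) && ([set y; z] \in G)].

Section Edge.
Variables (G : {set {set 'I_n}}) (x y : 'I_n).
Hypotheses (hG : G \subset ksets n 2) (xy : x != y) (xyG : [set x; y] \in G).
Let e := [set x; y].
Let Px := star G x :\ e.
Let Py := star G y :\ e.

Lemma nbr_at_xP A : A \in Px -> exists z, [/\ z != x, z != y & A = [set x; z]].
Proof.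
case/setD1P=> ne /setIdP[hA xA].
have [z xz eA] := edgeP (subsetP hG _ hA) xA; exists z; split=> //.
  by rewrite eq_sym.
by apply: contraNneq ne => h; rewrite eA h.
Qed.

Lemma nbr_at_yP A : A \in Py -> exists z, [/\ z != x, z != y & A = [set y; z]].
Proof.
case/setD1P=> ne /setIdP[hA yA].
have [z yz eA] := edgeP (subsetP hG _ hA) yA; exists z; split=> //.
  by apply: contraNneq ne => h; rewrite eA h setUC.
by rewrite eq_sym.
Qed.

Lemma nbr_at_x_notin_y A : A \in Px -> A \notin Py.
Proof.
case/nbr_at_xP=> z [_ zy ->]; apply/negP => /setD1P[_ /setIdP[_]].
by rewrite !inE eq_sym (negPf xy) eq_sym (negPf zy).
Qed.

Lemma nbrs_edge : nbrs G e = Px :|: Py.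
Proof.
apply/setP => A; rewrite !inE -!andb_orr andbCA; congr (_ && (_ && _)).
apply/set0Pn/orP => [[z]|].
  by rewrite !inE => /andP[zA] /orP[] /eqP <-; [left|right].
by case=> h; [exists x | exists y]; rewrite !inE h eqxx ?orbT.
Qed.

Lemma tri_pair_inj :
  {in tri G x y &, injective (fun z => [set [set x; z]; [set y; z]])}.
Proof.
move=> z z' hz _ ez.
have zy : z != y.
  apply: contraTneq hz => ->; rewrite inE negb_and; apply/orP; right.
  by apply/negP => /(subsetP hG) /ksetsP; rewrite setUid cards1.
have : [set x; z] \in [set [set x; z']; [set y; z']] by rewrite -ez set21.
rewrite !inE => /orP[/eqP/edge_inj //|/eqP h].
have : x \in [set y; z'] by rewrite -h set21.
rewrite !inE (negPf xy) /= => /eqP xz'.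
by move: h; rewrite -xz' [RHS]setUC => /edge_inj h; rewrite h eqxx in zy.
Qed.

Let small (P : {set {set 'I_n}}) r :=
  [set Q : {set {set 'I_n}} | (Q \subset P) & (#|Q| == r.+1)].
Let T := [set [set [set x; z]; [set y; z]] | z in tri G x y].

(** A clique meeting the edge [xy] consists of edges at [x], of edges at [y],
    or completes [xy] to a triangle. *)
Lemma ncl_nbrs_edge_ge r : 'C(#|Px|, r.+1) + 'C(#|Py|, r.+1)
  + (r == 1) * #|tri G x y| <= ncl (nbrs G e) r.+1.
Proof.
have sx : small Px r \subset cliques (nbrs G e) r.+1.
  apply/subsetP => Q; rewrite inE => /andP[hQ /eqP cQ]; apply/cliquesP; split=> //.
    by rewrite nbrs_edge (subset_trans hQ) ?subsetUl.
  by apply: (@star_intersecting _ x) => A /(subsetP hQ) /setD1P[_ /setIdP[]].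
have sy : small Py r \subset cliques (nbrs G e) r.+1.
  apply/subsetP => Q; rewrite inE => /andP[hQ /eqP cQ]; apply/cliquesP; split=> //.
    by rewrite nbrs_edge (subset_trans hQ) ?subsetUr.
  by apply: (@star_intersecting _ y) => A /(subsetP hQ) /setD1P[_ /setIdP[]].
have dxy : small Px r :&: small Py r = set0.
  apply/setP => Q; rewrite !inE; apply/negP => /andP[/andP[h1 cQ] /andP[h2 _]].
  have /card_gt0P[A hA] : 0 < #|Q| by rewrite (eqP cQ).
  by have := nbr_at_x_notin_y (subsetP h1 _ hA); rewrite (subsetP h2).
have cxy : #|small Px r :|: small Py r| = 'C(#|Px|, r.+1) + 'C(#|Py|, r.+1).
  by rewrite cardsU dxy cards0 subn0 !cards_draws.
case: eqP => [r1|_]; last first.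
  by rewrite addn0 -cxy; apply: subset_leq_card; rewrite subUset sx.
rewrite mul1n -(card_in_imset tri_pair_inj) -/T -cxy.
have tz z : z \in tri G x y -> [set x; z] \in Px /\ [set y; z] \in Py.
  rewrite inE => /andP[h1 h2].
  have zx : z != x.
    by apply: contraTneq h1 => ->; apply/negP => /(subsetP hG) /ksetsP; rewrite setUid cards1.
  have zy : z != y.
    by apply: contraTneq h2 => ->; apply/negP => /(subsetP hG) /ksetsP; rewrite setUid cards1.
  split; rewrite !inE ?h1 ?h2 eqxx /= ?andbT.
    by apply: contra zy => /eqP/edge_inj ->.
  by apply: contra zx; rewrite /e [X in _ == X]setUC => /eqP/edge_inj ->.
have dT : (small Px r :|: small Py r) :&: T = set0.
  apply/setP => Q; rewrite in_setI in_set0; apply/negP => /andP[hQ /imsetP[z hz eQ]].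
  have [p1 p2] := tz z hz.
  case/setUP: hQ; rewrite inE eQ subUset !sub1set => /andP[/andP[h1 h2] _].
    by have := nbr_at_x_notin_y h2; rewrite p2.
  by have := nbr_at_x_notin_y p1; rewrite h1.
have -> : #|small Px r :|: small Py r| + #|T| = #|small Px r :|: small Py r :|: T|.
  by rewrite [RHS]cardsU dT cards0 subn0.
apply: subset_leq_card; rewrite !subUset sx sy /=.
apply/subsetP => _ /imsetP[z hz ->]; have [p1 p2] := tz z hz.
apply/cliquesP; split.
- by rewrite nbrs_edge subUset !sub1set !in_setU p1 p2 orbT.
- by apply: (@star_intersecting _ z) => A; rewrite !inE => /orP[] /eqP ->;
     rewrite !inE eqxx orbT.
- rewrite cards2 r1; case: eqP => // eq; have := nbr_at_x_notin_y p1; rewrite eq.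
  by rewrite p2.
Qed.

Lemma ncl_nbrs_edge_le r : ncl (nbrs G e) r.+1 <=
  'C(#|Px|, r.+1) + 'C(#|Py|, r.+1) + (r == 1) * #|tri G x y|.
Proof.
have cT : #|T| <= #|tri G x y| by apply: leq_imset_card.
suff : cliques (nbrs G e) r.+1 \subset
    (small Px r :|: small Py r) :|: (if r == 1 then T else set0).
  move/subset_leq_card => h; apply: leq_trans h _.
  apply: leq_trans (leq_card_setU _ _) _; apply: leq_add.
    by apply: leq_trans (leq_card_setU _ _) _; rewrite !cards_draws.
  by case: eqP => _; rewrite ?mul1n // cards0.
apply/subsetP => Q /cliquesP[hQ /intersectingP iQ cQ]; rewrite !in_setU.
rewrite nbrs_edge in hQ.
case: (boolP (Q \subset Px)) => [h|/subsetPn[A hA nA]].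
  by rewrite [Q \in small Px r]inE h cQ eqxx.
case: (boolP (Q \subset Py)) => [h|/subsetPn[B hB nB]].
  by rewrite [Q \in small Py r]inE h cQ eqxx orbT.
apply/orP; right.
have {}nA : A \in Py by have := subsetP hQ _ hA; rewrite in_setU (negPf nA).
have {}nB : B \in Px by have := subsetP hQ _ hB; rewrite in_setU (negPf nB) orbF.
have [z [zx zy eA]] := nbr_at_yP nA; have [z' [z'x z'y eB]] := nbr_at_xP nB.
(* Two edges, one at each end of [xy], meet only in a common third vertex. *)
have meet a b : a != x -> a != y -> [set x; a] :&: [set y; b] != set0 -> b != x -> a = b.
  move=> ax ay /set0Pn[c]; rewrite !inE => /andP[/orP[] /eqP -> /orP[] /eqP h] bx //.
  - by move: xy; rewrite h eqxx.
  - by move: bx; rewrite h eqxx.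
  - by move: ay; rewrite h eqxx.
have ezz : z' = z by apply: meet => //; rewrite -eA -eB; apply: iQ.
subst z'.
have QE : Q = [set [set x; z]; [set y; z]].
  apply/setP => C; rewrite !inE; apply/idP/orP => [hC|]; last first.
    by case=> /eqP ->; rewrite -?eA -?eB.
  have /setUP[/nbr_at_xP[c [cx cy eC]]|/nbr_at_yP[c [cx cy eC]]] := subsetP hQ _ hC.
    left; rewrite eC (meet c z) //; by rewrite -eC -eA; apply: iQ.
  right; rewrite eC -(meet z c) //; by rewrite -eC -eB; apply: iQ.
have r1 : r = 1.
  move: cQ; rewrite QE cards2; case: eqP => [h|_ [<-]//].
  have : x \in [set y; z] by rewrite -h set21.
  by rewrite !inE (negPf xy) eq_sym (negPf zx).
rewrite r1 eqxx; apply/imsetP; exists z => //.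
rewrite inE -eA -eB; apply/andP.
by case/setD1P: nA => _ /setIdP[? _]; case/setD1P: nB => _ /setIdP[? _].
Qed.

End Edge.
End Graph.

Lemma bin_convex2 p c b : b <= c <= p ->
  'C(p, 2) + 'C(c, 2) + b <= 'C(p + b, 2) + 'C(c - b, 2).
Proof.
elim: b => [|b IH]; first by rewrite !addn0 subn0.
case/andP=> hbc hcp; have {IH} := IH _; rewrite (ltnW hbc) hcp => /(_ isT).
have -> : c - b = (c - b.+1).+1 by rewrite subnSK.
by rewrite (addnS p) !binS !bin1; move: hbc hcp; clear; lia.
Qed.

Section Removal.
Variable n : nat.
Implicit Types (G F R : {set {set 'I_n}}) (A B C e X : {set 'I_n}) (x y z : 'I_n).

Lemma card_star_hit_in X x : x \in X -> #|star (hit 2 X) x| = n.-1.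
Proof.
move=> xX; rewrite -[RHS]bin1 -(card_star_full x (isT : 0 < 2)).
apply: eq_card => A; apply/setIdP/setIdP => -[h xA]; split=> //.
  exact: (subsetP (hit_sub _ _)) h.
by apply/hitP; split; [apply/ksetsP | exists x].
Qed.

Lemma card_star_hit_out X y : y \notin X -> #|star (hit 2 X) y| = #|X|.
Proof.
move=> yX; rewrite -(@card_imset _ _ (fun z => [set y; z])); last first.
  by move=> z z' /edge_inj.
apply: eq_card => A; apply/setIdP/imsetP => [[/hitP[cA [z zA zX]] yA]|[z zX ->]].
  exists z => //; apply/esym/eqP; rewrite eqEcard subUset !sub1set yA zA cA cards2.
  by case: eqP => // e; rewrite e zX in yX.
rewrite set21; split=> //; apply/hitP; split; last by exists z; rewrite ?set22.
by rewrite cards2; case: eqP => // e; rewrite e zX in yX.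
Qed.

(** The number of cliques of size [r + 2] through an edge [xy] with [x] one of the
    [l + 1] centres, when [i] other edges at [x] have been removed and [y] is
    still joined to all centres: [x] has [n - 2 - i] other neighbours, [y] has
    [l], and [l] triangles contain the edge, which count for [r + 2 = 3]. *)
Definition removal_loss l r i := 'C(n - 2 - i, r.+1) + 'C(l, r.+1) + (r == 1) * l.

(** By convexity, an edge loses most cliques when all removed edges are at its end
    of larger degree.  Removed edges at [x] that lead out of [X] destroy no
    triangle over [xy]; those inside [X] would, hence the assumption on [R]. *)
Lemma removal_loss_le X R e r : R \subset hit 2 X -> e \in hit 2 X -> e \notin R ->
  (e \subset X) || [forall A in R, ~~ (A \subset X)] -> #|R| + #|X| < n ->
  removal_loss #|X|.-1 r #|R| <= ncl (nbrs (hit 2 X :\: R) e) r.+1.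
Proof.
move=> hR he eR hX hn; have [ce [x xe xX]] := hitP _ _ _ he.
have [|y xy eE] := edgeP _ xe; first by apply/ksetsP.
subst e; set G := hit 2 X :\: R.
have hG : G \subset ksets n 2 by apply: subset_trans (subsetDl _ _) (hit_sub _ _).
have eG : [set x; y] \in G by rewrite inE eR.
apply: leq_trans _ (ncl_nbrs_edge_ge hG xy r).
have cstar z : z \in [set x; y] ->
    #|star G z :\ [set x; y]| + #|star R z| + 1 = #|star (hit 2 X) z|.
  move=> ze; rewrite -(cardsID R (star (hit 2 X) z)).
  have -> : star (hit 2 X) z :&: R = star R z.
    apply/setP => A; rewrite !in_setI [RHS]inE inE.
    by case: (boolP (A \in R)) => [/(subsetP hR) ->|_]; rewrite ?andbT ?andbF.
  have -> : star (hit 2 X) z :\: R = star G z.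
    by apply/setP => A; rewrite in_setD [RHS]inE !in_setD [A \in star _ _]inE andbA.
  have es : [set x; y] \in star G z by apply/setIdP.
  by rewrite (cardsD1 [set x; y] (star G z)) es add1n addn1 addnS addnC.
have cx := cstar x (set21 x y); have cy := cstar y (set22 x y).
rewrite card_star_hit_in // in cx.
set Px := star G x :\ _ in cx *; set Py := star G y :\ _ in cy *.
have dis : #|star R x| + #|star R y| <= #|R|.
  rewrite -cardsUI (_ : star R x :&: star R y = set0).
    by rewrite cards0 addn0; apply/subset_leq_card; rewrite subUset !star_sub.
  apply/setP => A; rewrite in_setI !inE; apply/negP => /andP[/andP[AR xA] /andP[_ yA]].
  move/negP: eR; apply; suff -> : [set x; y] = A by [].
  apply/eqP; rewrite eqEcard subUset !sub1set xA yA cards2 xy.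
  by have /hitP[-> _] := subsetP hR _ AR.
pose Zs t := [set z | [set t; z] \in R].
have cZ t : #|Zs t| <= #|star R t|.
  rewrite -(@card_imset _ _ (fun z => [set t; z])); last by move=> z z' /edge_inj.
  apply/subset_leq_card/subsetP => _ /imsetP[z + ->]; rewrite !inE => ->.
  by rewrite eqxx.
have notR t z : z \notin Zs t -> [set t; z] \notin R by rewrite inE.
have inhit a b : a != b -> b \in X -> [set a; b] \in hit 2 X.
  move=> ab bX; apply/hitP; split; first by rewrite cards2 ab.
  by exists b; rewrite ?set22.
have X0 : 0 < #|X| by apply/card_gt0P; exists x.
case: (boolP (y \in X)) => yX.
  rewrite card_star_hit_in // in cy.
  have ct : n - 2 <= #|tri G x y| + #|Zs x| + #|Zs y|.
    have -> : n - 2 = #|~: [set x; y]| by rewrite [RHS]cardsCs setCK card_ord cards2 xy.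
    apply: leq_trans (_ : #|tri G x y :|: Zs x :|: Zs y| <= _).
      apply/subset_leq_card/subsetP => z; rewrite in_setC in_set2 negb_or => /andP[zx zy].
      rewrite !in_setU; case: (boolP (z \in Zs x)) => hx; first by rewrite orbT.
      case: (boolP (z \in Zs y)) => hy; first by rewrite orbT.
      rewrite !orbF inE !in_setD notR // notR //= ![[set _; z]]setUC.
      by rewrite !inhit.
    apply: leq_trans (leq_card_setU _ _) _; rewrite leq_add2r.
    exact: leq_card_setU.
  have := cZ x; have := cZ y; move: ct cx cy dis hn X0 => ct cx cy dis hn X0 c1 c2.
  have hP : n - 2 - #|R| <= #|Px| by move: cx dis; clear; lia.
  have hQ : #|X|.-1 <= #|Py| by move: cy dis hn X0; clear; lia.
  have hT : #|X|.-1 <= #|tri G x y| by move: ct dis hn c1 c2 X0; clear; lia.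
  rewrite /removal_loss; apply: leq_add; last by rewrite leq_mul2l hT orbT.
  by apply: leq_add; apply: leq_bin2l.
rewrite card_star_hit_out // in cy.
have hin : [forall A in R, ~~ (A \subset X)].
  by case/orP: hX => // /subsetP/(_ y); rewrite set22 (negPf yX) => /(_ isT).
have ct : #|X|.-1 <= #|tri G x y| + #|Zs y|.
  have -> : #|X|.-1 = #|X :\ x| by rewrite (cardsD1 x X) xX.
  apply: leq_trans (_ : #|tri G x y :|: Zs y| <= _); last exact: leq_card_setU.
  apply/subset_leq_card/subsetP => z /setD1P[zx zX].
  rewrite in_setU; case: (boolP (z \in Zs y)) => hy; first by rewrite orbT.
  have yz : y != z by apply: contraNneq yX => ->.
  have xz : x != z by rewrite eq_sym.
  rewrite orbF inE; apply/andP; split; rewrite in_setD inhit // andbT; last exact: notR.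
  by apply/negP => hA; have := forall_inP hin _ hA; rewrite subUset !sub1set xX zX.
have := cZ y; rewrite /removal_loss.
have : #|star R y| <= #|X|.-1 by move: cy; clear; lia.
have : #|X|.-1 <= n - 2 - (#|star R x| + #|star R y|) by move: hn dis X0; clear; lia.
have -> : #|Py| = #|X|.-1 - #|star R y| by move: cy; clear; lia.
have -> : #|Px| = n - 2 - (#|star R x| + #|star R y|) + #|star R y|.
  by move: cx hn dis X0; clear; lia.
have : n - 2 - #|R| <= n - 2 - (#|star R x| + #|star R y|) by rewrite leq_sub2l.
move: ct; move: (n - 2 - (_ + _)) => p; move: (n - 2 - #|R|) => p'.
move: #|X|.-1 #|star R y| #|Zs y| #|tri G x y|; clear => l b c T ct hp' hlp hbl hcb.
apply: (@leq_trans ('C(p, r.+1) + 'C(l, r.+1) + (r == 1) * l)).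
  by rewrite !leq_add2r; apply: leq_bin2l.
have hblp : b <= l <= p by rewrite hbl.
case: eqP => [->|_]; last by rewrite !addn0; apply: bin_convex.
by have := bin_convex2 hblp; move: hcb ct; clear; lia.
Qed.

Lemma ncl_remove_ge X R r : R \subset hit 2 X -> #|R| + #|X| <= n ->
  ncl (hit 2 X :\: R) r.+2 + \sum_(i < #|R|) removal_loss #|X|.-1 r i <= ncl (hit 2 X) r.+2.
Proof.
elim: {R}#|R| {-2}R (erefl #|R|) => [|q IH] R cR hR; last rewrite cR => hn.
  by rewrite (cards0_eq cR) setD0 cards0 big_ord0 addn0.
(* The edges inside [X] are removed last. *)
have [e eR heX] : exists2 e, e \in R &
    (e \subset X) || [forall A in R, ~~ (A \subset X)].
  case: (boolP [exists A in R, A \subset X]) => [/exists_inP[A hA AX]|].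
    by exists A; rewrite ?AX.
  rewrite negb_exists_in => h; have /card_gt0P[e eR] : 0 < #|R| by rewrite cR.
  by exists e; rewrite ?h ?orbT.
have cq : #|R :\ e| = q by move: cR; rewrite (cardsD1 e) eR => -[].
have hR' : R :\ e \subset hit 2 X by apply: subset_trans (subD1set _ _) hR.
have := IH _ cq hR' _; rewrite cq => /(_ (ltnW hn)) {IH} IH.
have eG : e \in hit 2 X :\: (R :\ e) by rewrite in_setD in_setD1 eqxx /= (subsetP hR).
have e0 : e != set0 by rewrite -card_gt0; have /hitP[-> _] := subsetP hR _ eR.
have dE : (hit 2 X :\: (R :\ e)) :\ e = hit 2 X :\: R.
  apply/setP => A; rewrite !(in_setD1, in_setD, in_set1).
  by case: (eqVneq A e) => [->|]; rewrite ?eR.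
have heX' : (e \subset X) || [forall A in R :\ e, ~~ (A \subset X)].
  case/orP: heX => [->//|/forall_inP h]; apply/orP; right; apply/forall_inP => A.
  by case/setD1P=> _ /h.
have hl := @removal_loss_le X (R :\ e) e r hR' (subsetP hR _ eR).
have {}hl := hl (negbT (setD11 e R)); rewrite cq in hl; have {}hl := hl heX' hn.
move: IH; rewrite (ncl_del _ eG e0) dE big_ord_recr /=.
by move=> h; apply: leq_trans h; rewrite -addnA leq_add2l addnC leq_add2r.
Qed.

(** If the removed edges form a star at [x] leaving [X], every inequality above
    is sharp. *)
Lemma ncl_remove_le X R x r : x \in X -> R \subset hit 2 X ->
  {in R, forall A, x \in A /\ [disjoint A & X :\ x]} -> #|R| < n ->
  ncl (hit 2 X) r.+2 <= ncl (hit 2 X :\: R) r.+2 + \sum_(i < #|R|) removal_loss #|X|.-1 r i.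
Proof.
move=> xX.
elim: {R}#|R| {-2}R (erefl #|R|) => [|q IH] R cR hR hx; last rewrite cR => hn.
  by rewrite (cards0_eq cR) setD0 cards0 big_ord0 addn0.
have /card_gt0P[e eR] : 0 < #|R| by rewrite cR.
have cq : #|R :\ e| = q by move: cR; rewrite (cardsD1 e) eR => -[].
have hR' : R :\ e \subset hit 2 X by apply: subset_trans (subD1set _ _) hR.
have hx' : {in R :\ e, forall A : {set 'I_n}, x \in A /\ [disjoint A & X :\ x]}.
  by move=> A /setD1P[_ /hx].
have := IH _ cq hR' hx' _; rewrite cq => /(_ (ltnW hn)) {IH} IH.
set G := hit 2 X :\: (R :\ e) in IH.
have eG : e \in G by rewrite in_setD in_setD1 eqxx /= (subsetP hR).
have hG : G \subset ksets n 2 by apply: subset_trans (subsetDl _ _) (hit_sub _ _).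
have dE : G :\ e = hit 2 X :\: R.
  apply/setP => A; rewrite !(in_setD1, in_setD, in_set1).
  by case: (eqVneq A e) => [->|]; rewrite ?eR.
have e0 : e != set0 by apply/set0Pn; exists x; case: (hx e eR).
rewrite (ncl_del _ eG e0) dE in IH; apply: leq_trans IH _.
rewrite big_ord_recr /= -addnA leq_add2l addnC leq_add2l.
have [xe de] := hx e eR.
have [y xy eE] := edgeP (subsetP hG _ eG) xe; subst e.
have yX : y \notin X.
  apply/negP => yX; have := disjointFr de (set22 x y).
  by rewrite !inE eq_sym xy yX.
apply: leq_trans (ncl_nbrs_edge_le hG xy r) _; rewrite /removal_loss.
have cx : #|star G x :\ [set x; y]| <= n - 2 - q.
  have h : #|star G x| + q <= n.-1.
    rewrite -(card_star_hit_in xX) -cq -cardsUI.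
    rewrite (_ : star G x :&: (R :\ [set x; y]) = set0) ?cards0 ?addn0.
      apply/subset_leq_card; rewrite subUset starS ?subsetDl //=.
      apply/subsetP => A hA; apply/setIdP; split; first exact: (subsetP hR').
      by case: (hx' A hA).
    apply/setP => A; rewrite in_setI in_set0; apply/negP => /andP[/setIdP[/setDP[_ nA] _] hA].
    by rewrite hA in nA.
  have : #|star G x| = #|star G x :\ [set x; y]|.+1.
    by rewrite (cardsD1 [set x; y] (star G x)) inE eG xe.
  by move: h; clear; lia.
have cy : #|star G y :\ [set x; y]| <= #|X|.-1.
  have : #|star G y| <= #|X|.
    by rewrite -(card_star_hit_out yX); apply/subset_leq_card/starS/subsetDl.
  have es : [set x; y] \in star G y by apply/setIdP; rewrite set22.
  by rewrite (cardsD1 [set x; y] (star G y)) es add1n; case: #|X|.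
have ct : #|tri G x y| <= #|X|.-1.
  have -> : #|X|.-1 = #|X :\ x| by rewrite (cardsD1 x X) xX.
  apply/subset_leq_card/subsetP => z; rewrite inE => /andP[h1 h2].
  rewrite in_setD1; apply/andP; split.
    by apply: contraTneq h1 => ->; apply/negP => /(subsetP hG) /ksetsP; rewrite setUid cards1.
  have /setDP[/hitP[_ [t]]] := h2; rewrite !inE => /orP[] /eqP -> //.
  by rewrite (negPf yX).
apply: leq_add; last by rewrite leq_mul2l ct orbT.
by apply: leq_add; apply: leq_bin2l.
Qed.

(** Both graphs arise from isomorphic graphs by removing equally many edges; for
    [L] they form a star at [x], the cheapest choice. *)
Theorem ncl_star_cover (X1 : {set 'I_n}) F (X2 : {set 'I_n}) x
    (L : {set {set 'I_n}}) t :
  #|X1| = #|X2| -> F \subset hit 2 X1 ->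
  x \in X2 -> hit 2 (X2 :\ x) \subset L -> L \subset hit 2 X2 -> #|F| = #|L| ->
  ncl F t.+2 <= ncl L t.+2.
Proof.
move=> cX hF xX hL1 hL2 cFL.
pose R1 := hit 2 X1 :\: F; pose R2 := hit 2 X2 :\: L.
have eF : F = hit 2 X1 :\: R1 by rewrite setDDr setDv set0U (setIidPr hF).
have eL : L = hit 2 X2 :\: R2 by rewrite setDDr setDv set0U (setIidPr hL2).
have cR : #|R1| = #|R2|.
  by rewrite !cardsD (setIidPr hF) (setIidPr hL2) !card_hit cX cFL.
have X0 : 0 < #|X2| by apply/card_gt0P; exists x.
have Xn : #|X2| <= n by rewrite -[leqRHS]card_ord max_card.
have hR2 : R2 \subset star (hit 2 X2) x.
  apply/subsetP => A /setDP[hA nA]; apply/setIdP; split=> //.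
  have [cA [y yA yX]] := hitP _ _ _ hA.
  case: (eqVneq y x) => [<- //|yx]; move/negP: nA; case; apply: (subsetP hL1).
  by apply/hitP; split=> //; exists y; rewrite // !inE yx.
have hx : {in R2, forall A : {set 'I_n}, x \in A /\ [disjoint A & X2 :\ x]}.
  move=> A hA; split; first by have /setIdP[] := subsetP hR2 _ hA.
  rewrite -setI_eq0; apply/eqP/setP => y; rewrite in_setI in_set0; apply/negP => /andP[yA yX].
  case/setDP: hA => /hitP[cA _] /negP; apply; apply: (subsetP hL1).
  by apply/hitP; split=> //; exists y.
have cR2 : #|R2| + #|X2| <= n.
  have : #|R2| <= #|~: X2|.
    rewrite -(@card_imset _ _ (fun z => [set x; z])); last by move=> z z' /edge_inj.
    apply/subset_leq_card/subsetP => A hA; have [xA dA] := hx A hA.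
    have [y xy eA] := edgeP (subsetP (hit_sub _ _) _ (subsetP (subsetDl _ _) _ hA)) xA.
    apply/imsetP; exists y => //; rewrite in_setC; apply/negP => yX.
    by have := disjointFr dA (_ : y \in A); rewrite eA set22 => /(_ isT); rewrite !inE eq_sym xy yX.
  by move=> h; rewrite addnC; apply: leq_trans (leq_add (leqnn _) h) _; rewrite cardsC card_ord.
have hR1 : R1 \subset hit 2 X1 by apply: subsetDl.
have h1 := ncl_remove_ge t hR1 _; rewrite cR cX in h1.
have h2 := ncl_remove_le t xX (subsetDl _ _) hx _.
have ltR2 : #|R2| < n by move: cR2 X0; clear; lia.
have {}h1 := h1 cR2; have {}h2 := h2 ltR2.
have h3 : ncl (hit 2 X1) t.+2 <= ncl (hit 2 X2) t.+2.
  have [s [sX _ _]] : exists s : {perm 'I_n},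
      [/\ s @: X1 = X2, s @: set0 = set0 & s @: set0 = set0].
    by apply: perm_three_sets; rewrite // -setI_eq0 setI0.
  by apply: (@ncl_perm _ s) => A hA; rewrite -sX hit_perm.
rewrite eF eL; move: h1 h2 h3; rewrite -/R2 -/R1.
by move: (ncl _ _) (ncl _ _) (ncl _ _) (ncl _ _) (\sum_(_ < _) _); clear; lia.
Qed.

End Removal.

(** * Graphs with many equal stars *)

(** By convexity [r] equal stars hold fewer cliques than [a] full stars and one
    star of size [s] with the same total degree, up to the error [c0].  As
    [r >= a + 2], the excess is a constant fraction of ['C(N, t.+2)].  For two
    edges this is [(a * N + s) ^ 2 + a * N ^ 2 <= (a + 2) * (a * N ^ 2 + s ^ 2)];
    for three or more, [a.+1 ^ 3 < (a + 2) ^ 2 * a] suffices. *)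
Lemma flat_stars a r l D N s c0 E t : 0 < a <= l -> a + 2 <= r -> D <= N -> s <= N ->
  r * D <= a * N + s + c0 -> 4 * l.+2 ^ 2 * E <= 'C(N, t.+2) ->
  2 * (2 * c0 * l.+1 + c0 ^ 2 + l.+2 * l.+1) <= N ->
  2 * (3 * l.+1 ^ 2 * c0 + 3 * l.+1 * c0 ^ 2 + c0 ^ 3) <= N ->
  r * 'C(D, t.+2) + E <= a * 'C(N, t.+2) + 'C(s, t.+2).
Proof.
case/andP=> a0 al ar DN sN hT hE h2 h3.
have N0 : 0 < N by apply: leq_trans h2; rewrite muln_gt0 /= addn_gt0 muln_gt0 orbT.
case: t hE => [|t] hE.
  have d2 x : 2 * 'C(x, 2) + x = x ^ 2.
    elim: x => // x IH; rewrite binS bin1; move: IH; rewrite !expnS !expn0; clear; nia.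
  have e1 : (a + 2) * (r * D ^ 2) <= (a * N + s + c0) ^ 2.
    apply: leq_trans (_ : (r * D) ^ 2 <= _); last by rewrite leq_exp2r.
    by rewrite expnMn mulnA leq_mul2r -mulnn leq_mul2r ar !orbT.
  have e2 : (a * N + s) ^ 2 + a * N ^ 2 <= (a + 2) * (a * N ^ 2 + s ^ 2).
    have : 2 * (N * s) <= N ^ 2 + s ^ 2 by apply: nat_Cauchy.
    move=> /(leq_mul (leqnn a)); rewrite -!mulnn; clear; nia.
  have e3 : (a * N + s + c0) ^ 2 <= (a * N + s) ^ 2 + (2 * c0 * l.+1 + c0 ^ 2) * N.
    rewrite [leqLHS]sqrnD -addnA leq_add2l mulnDl;
    have : a * N + s <= l.+1 * N by rewrite mulSn addnC leq_add // leq_mul2r al orbT.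
    move/(leq_mul (leqnn (2 * c0))).
    have : c0 ^ 2 <= c0 ^ 2 * N by rewrite leq_pmulr.
    by move: (c0 ^ 2) => u; clear; nia.
  have e4 : 2 * ((2 * c0 * l.+1 + c0 ^ 2) * N + l.+2 * l.+1 * N) <= N ^ 2.
    by rewrite -mulnn -mulnDl mulnA leq_mul2r h2 orbT.
  have e5 : (a + 2) * (a * N + s) <= l.+2 * l.+1 * N.
    rewrite -mulnA; apply: leq_mul; first by move: al; clear; lia.
    by rewrite mulSn addnC leq_add // leq_mul2r al orbT.
  have e6 : 4 * ((a + 2) * E) <= N ^ 2.
    apply: leq_trans (_ : 4 * l.+2 ^ 2 * E <= _).
      rewrite mulnA leq_mul2r leq_mul2l; apply/orP; right; rewrite -mulnn.
      by apply: leq_trans (leq_pmull _ _) => //; move: al; clear; lia.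
    apply: leq_trans hE _; rewrite -d2; clear; lia.
  have e7 : N ^ 2 <= a * N ^ 2 by rewrite leq_pmull.
  rewrite -(leq_pmul2l (_ : 0 < 2 * (a + 2))); last by clear; lia.
  move: e1 e2 e3 e4 e5 e6 e7; have := d2 D; have := d2 N; have := d2 s.
  have : (a + 2) * (r * (2 * 'C(D, 2))) <= (a + 2) * (r * D ^ 2).
    by rewrite !leq_mul2l -(d2 D) leq_addr !orbT.
  have -> : 2 * (a + 2) * (r * 'C(D, 2) + E) =
    (a + 2) * (r * (2 * 'C(D, 2))) + 2 * ((a + 2) * E) by clear; lia.
  have -> : 2 * (a + 2) * (a * 'C(N, 2) + 'C(s, 2)) =
    (a + 2) * (a * (2 * 'C(N, 2)) + 2 * 'C(s, 2)) by clear; lia.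
  move=> f0 f1 f2 f3 f4 f5 f6 f7 f8 f9 f10.
  have -> : (a + 2) * (a * (2 * 'C(N, 2)) + 2 * 'C(s, 2)) =
     (a + 2) * (a * N ^ 2 + s ^ 2) - (a + 2) * (a * N + s).
    by rewrite -f1 -f2 -mulnBr; congr (_ * _); clear; lia.
  move: f0 f4 f5 f6 f7 f8 f9 f10.
  move: ((a + 2) * (r * (2 * _))) ((a + 2) * (r * D ^ 2)) ((a + 2) * E).
  move: ((a + 2) * (a * N ^ 2 + s ^ 2)) ((a + 2) * (a * N + s)) (l.+2 * l.+1 * N).
  move: ((a * N + s + c0) ^ 2) ((a * N + s) ^ 2) (a * N ^ 2) (_ * N) (N ^ 2).
  by clear; lia.
have e1 : (a + 2) ^ 2 * (r * D ^ 3) <= (a.+1 * N + c0) ^ 3.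
  apply: leq_trans (_ : (r * D) ^ 3 <= _).
    rewrite expnMn mulnA leq_mul2r [r ^ 3]expnSr leq_mul2r leq_exp2r // ar !orbT.
    by [].
  rewrite leq_exp2r //; apply: leq_trans hT _; rewrite leq_add2r mulSn addnC.
  by rewrite leq_add2r.
have e2 : (a.+1 * N + c0) ^ 3 <= a.+1 ^ 3 * N ^ 3
    + (3 * l.+1 ^ 2 * c0 + 3 * l.+1 * c0 ^ 2 + c0 ^ 3) * N ^ 2.
  have -> : (a.+1 * N + c0) ^ 3 = a.+1 ^ 3 * N ^ 3 + 3 * a.+1 ^ 2 * c0 * N ^ 2
      + 3 * a.+1 * c0 ^ 2 * N + c0 ^ 3.
    by rewrite !expnS !expn0; clear; lia.
  have q1 : 3 * a.+1 ^ 2 * c0 * N ^ 2 <= 3 * l.+1 ^ 2 * c0 * N ^ 2.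
    by rewrite !leq_mul2r leq_mul2l leq_exp2r // ltnS al !orbT.
  have q2 : 3 * a.+1 * c0 ^ 2 * N <= 3 * l.+1 * c0 ^ 2 * N ^ 2.
    apply: leq_mul; first by rewrite leq_mul2r leq_mul2l ltnS al !orbT.
    by rewrite -mulnn leq_pmull.
  have q3 : c0 ^ 3 <= c0 ^ 3 * N ^ 2 by rewrite leq_pmulr // expn_gt0 N0.
  move: q1 q2 q3; move: (3 * l.+1 ^ 2 * c0) (3 * l.+1 * c0 ^ 2) (c0 ^ 3) (a.+1 ^ 3 * _).
  move: (3 * a.+1 ^ 2 * c0 * _) (3 * a.+1 * c0 ^ 2 * _) => v1 v2; move: (N ^ 2).
  by clear; lia.
have e3 : 2 * ((3 * l.+1 ^ 2 * c0 + 3 * l.+1 * c0 ^ 2 + c0 ^ 3) * N ^ 2) <= N ^ 3.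
  by rewrite mulnA [N ^ 3]expnS leq_mul2r h3 orbT.
have e4 : a.+1 ^ 3 + 1 <= (a + 2) ^ 2 * a.
  by move: a0; rewrite !expnS !expn0; clear; nia.
have e5 : 2 * (a + 2) ^ 2 * (r * D ^ 3) + N ^ 3 <= 2 * (a + 2) ^ 2 * a * N ^ 3.
  have : (a.+1 ^ 3 + 1) * N ^ 3 <= (a + 2) ^ 2 * a * N ^ 3 by rewrite leq_mul2r e4 orbT.
  rewrite mulnDl mul1n.
  have -> : 2 * (a + 2) ^ 2 * a * N ^ 3 = 2 * ((a + 2) ^ 2 * a * N ^ 3) by rewrite !mulnA.
  move: e1 e2 e3; rewrite -(mulnA 2).
  move: ((a + 2) ^ 2 * (r * D ^ 3)) ((a + 2) ^ 2 * a * N ^ 3) (a.+1 ^ 3 * N ^ 3).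
  move: ((a.+1 * N + c0) ^ 3) (_ * N ^ 2) (N ^ 3); clear; lia.
have e6 := @bin_ratio D N 3 t.+3 DN isT.
have N30 : 0 < N ^ 3 by rewrite expn_gt0 N0.
have e7 : 2 * (a + 2) ^ 2 * (r * 'C(D, t.+3)) + 'C(N, t.+3) <=
          2 * (a + 2) ^ 2 * a * 'C(N, t.+3).
  rewrite -(leq_pmul2r N30) mulnDl.
  have : 'C(N, t.+3) * (2 * (a + 2) ^ 2 * (r * D ^ 3) + N ^ 3) <=
         'C(N, t.+3) * (2 * (a + 2) ^ 2 * a * N ^ 3) by rewrite leq_mul2l e5 orbT.
  have : 2 * (a + 2) ^ 2 * r * ('C(D, t.+3) * N ^ 3) <=
         2 * (a + 2) ^ 2 * r * ('C(N, t.+3) * D ^ 3) by rewrite leq_mul2l e6 orbT.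
  move: (2 * (a + 2) ^ 2) (N ^ 3) (D ^ 3); clear; lia.
have e8 : 2 * (a + 2) ^ 2 * E <= 'C(N, t.+3).
  apply: leq_trans hE; rewrite leq_mul2r; apply/orP; right; apply: leq_mul => //.
  by rewrite leq_exp2r //; move: al; clear; lia.
apply: leq_trans (leq_addr _ _).
rewrite -(leq_pmul2l (_ : 0 < 2 * (a + 2) ^ 2)); last by rewrite muln_gt0 expn_gt0 addn2.
move: e7 e8; rewrite mulnDr mulnA; move: (2 * (a + 2) ^ 2); clear; lia.
Qed.

Section GraphFar.
Variables (n l : nat).
Implicit Types (F : {set {set 'I_n}}) (X Hv A : {set 'I_n}) (x y : 'I_n).

Let N := n.-1.
Let q := 4 * l.+2 ^ 2.
Let g := 36 * l.+1 * q.
Let h := 4 * g * l.+1.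
Let c0 := 2 * h ^ 2.

(** Let [x] have the largest degree [D] among the incomplete stars.  By saturation
    the ends of an edge missing [x] have total degree at least [D + 2], so the
    vertices of degree at least [N / 2g], boundedly many, cover all edges.
    Any other vertex has bounded degree, so a large star, having an edge to such
    a vertex, has degree at least [D - h] or is full. *)
Lemma saturated_graph F s : F \subset ksets n 2 -> saturated 2 F ->
  #|F| <= l * N + s -> s <= N -> l.+1 <= n -> 1 < N ->
  36 * l.+1 * q * h < N./2 -> h * 2 + 4 <= N./2 -> 3 * q * h ^ 2 <= N ->
  2 * g * h < N ->
  2 * (2 * c0 * l.+1 + c0 ^ 2 + l.+2 * l.+1) <= N ->
  2 * (3 * l.+1 ^ 2 * c0 + 3 * l.+1 * c0 ^ 2 + c0 ^ 3) <= N ->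
  [\/ exists2 X : {set 'I_n}, #|X| = l & hit 2 X \subset F,
      exists2 X : {set 'I_n}, #|X| = l.+1 & F \subset hit 2 X
    | forall t, ncl F t.+2 <= l * 'C(N, t.+2) + 'C(s, t.+2)].
Proof.
move=> hF sF cF sN ln N1 b1 b2 b3 b4 b5 b6.
have N0 : 0 < N by apply: ltnW.
have cF' : #|F| <= l.+1 * N by rewrite mulSn addnC; apply: leq_trans cF _; rewrite leq_add2l.
have dN y : #|star F y| <= N by rewrite /N -[n.-1]bin1; apply: (@card_star_le n 2 F y isT hF).
have g0 : 0 < g by rewrite /g /q !muln_gt0 ?expn_gt0.
pose Full := [set y | #|star F y| == N].
case: (leqP l #|Full|) => [/subset_of_card[X hX cX]|cFull].
  apply: Or31; exists X => //; rewrite hit_bigcup; apply/bigcupsP => y /(subsetP hX).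
  rewrite inE => /eqP cy; apply: subset_trans (star_sub F y).
  suff -> : star F y = star (ksets n 2) y by [].
  by apply/eqP; rewrite eqEcard starS //= card_star_full // bin1 cy.
have heavy (Hv : {set 'I_n}) t : #|Hv| <= h -> (forall y, y \notin Hv -> #|star F y| <= N %/ g) ->
  exists E, q * E <= 'C(N, t.+2) /\ ncl F t.+2 <= \sum_(y in Hv) 'C(#|star F y|, t.+2) + E.
  move=> cH hd; have := ncl_le_heavy t hF hd.
  rewrite subnn bin0 !muln1 -!addnA => hle.
  eexists; split; last exact: hle.
  have hd2 : N %/ g * g <= N by apply: leq_trunc_div.
  have := @heavy_error q l.+1 #|Hv| 2 (N %/ g) #|F| N 1 t N1 cF'.
  rewrite !muln1 addnA; apply.
  - by move: hd2; rewrite /g; clear; lia.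
  - apply: leq_ltn_trans b1; have -> : 18 * l.+1 * q * #|Hv| * 2 = 36 * l.+1 * q * #|Hv|.
      by clear; lia.
    by rewrite leq_mul2l cH orbT.
  - by apply: leq_trans b2; rewrite leq_add2r leq_mul2r cH orbT.
  - by apply: leq_trans b3; rewrite leq_mul2l leq_exp2r // cH orbT.
have q0 : 0 < q by rewrite /q muln_gt0 ?expn_gt0.
have sumFull (t : nat) (Y : {set 'I_n}) : {in Y, forall y : 'I_n, y \in Full} ->
    \sum_(y in Y) 'C(#|star F y|, t) = #|Y| * 'C(N, t).
  move=> hY; rewrite -sum_nat_const; apply: eq_bigr => y /hY; rewrite inE.
  by move/eqP ->.
case: (boolP [exists x, (x \notin Full) && (N <= g * #|star F x|)]); last first.
  rewrite negb_exists => /forallP hn; apply: Or33 => t.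
  have hd y : y \notin Full -> #|star F y| <= N %/ g.
    move=> yF; have := hn y; rewrite yF /= -ltnNge => /ltnW.
    by rewrite leq_divRL // mulnC.
  have [|E [hE hle]] := heavy Full t _ hd.
    apply: leq_trans (ltnW cFull) _; rewrite /h; apply: leq_trans (leqnSn _) _.
    by rewrite leq_pmull // muln_gt0 g0.
  apply: leq_trans hle _; rewrite sumFull //; apply: leq_trans (leq_addr _ _).
  have {}hE : E <= 'C(N, t.+2) by apply: leq_trans hE; rewrite leq_pmull.
  by apply: leq_trans (leq_add (leqnn _) hE) _; rewrite -mulSnr leq_mul2r cFull orbT.
case/existsP=> x0 /andP[nx0 hx0].
case: (@arg_maxnP _ x0 (fun y => y \notin Full) (fun y => #|star F y|) nx0) => x nx maxx.
set D := #|star F x| in maxx *.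
have {}maxx y : y \notin Full -> #|star F y| <= D by apply: maxx.
have hD : N <= g * D by apply: leq_trans hx0 _; rewrite leq_mul2l (maxx x0) ?orbT.
have edge A : A \in F -> x \notin A -> D + 2 <= \sum_(y in A) #|star F y|.
  move=> hA xA; apply: leq_trans (card_nbrs hF hA); rewrite leq_add2r; apply: sF => //.
  apply: contra nx => /eqP e; rewrite inE e card_star_full //.
  by rewrite bin1.
pose Hv := [set y | N <= 2 * g * #|star F y|].
have cHv : #|Hv| <= h.
  have -> : h = 2 * g * 2 * l.+1 by rewrite /h; clear; lia.
  have N' : 0 < 'C(n.-1, 2.-1) by rewrite bin1.
  by apply: (card_heavy _ hF) => [||y]; rewrite ?bin1 // inE.
have xHv : x \in Hv.
  by rewrite inE; apply: leq_trans hD _; rewrite leq_mul2r leq_pmull ?orbT.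
have FullHv : Full \subset Hv.
  apply/subsetP => y; rewrite !inE => /eqP ->.
  by apply: leq_pmull; rewrite muln_gt0.
have cov : F \subset hit 2 Hv.
  apply/subsetP => A hA; apply/hitP; split; first by have /ksetsP := subsetP hF _ hA.
  case: (boolP (x \in A)) => xA; first by exists x.
  have := edge A hA xA; have := subsetP hF _ hA; rewrite inE.
  move=> /cards2P[u [v [uv eA]]].
  rewrite eA big_setU1 ?inE //= big_set1 => hDD.
  case: (leqP D (2 * #|star F u|)) => hu.
    exists u; rewrite ?set21 // inE; apply: leq_trans hD _.
    by rewrite [2 * g]mulnC -mulnA leq_mul2l hu orbT.
  exists v; rewrite ?set22 // inE; apply: leq_trans hD _.
  rewrite [2 * g]mulnC -mulnA leq_mul2l; apply/orP; right.
  rewrite -(leq_add2l (2 * #|star F u|)) -mulnDr.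
  apply: leq_trans (leq_add (ltnW hu) (leqnn D)) _; rewrite addnn -mul2n leq_mul2l /=.
  exact: leq_trans (leq_addr 2 D) hDD.
case: (leqP #|Hv| l.+1) => cHl.
  have [|X [hX _ cX]] := @set_between _ Hv setT l.+1 (subsetT _).
    by rewrite cHl cardsT card_ord.
  by apply: Or32; exists X => //; apply: subset_trans cov (hitS _ hX).
apply: Or33 => t.
have light y : y \notin Hv -> #|star F y| <= h.
  move=> yH; apply: leq_trans cHv; rewrite -(card_star_hit_out yH).
  exact/subset_leq_card/starS.
have heavyD y : y \in Hv -> D <= #|star F y| + h.
  move=> yH; case: (eqVneq y x) => [->|yx]; first exact: leq_addr.
  have hy : h < #|star F y|.
    have gg : 0 < 2 * g by rewrite muln_gt0.
    rewrite -(ltn_pmul2l gg); apply: leq_trans b4 _.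
    by move: yH; rewrite inE.
  have [A hA nA] : exists2 A, A \in star F y & A \notin [set [set y; z] | z in Hv].
    apply/subsetPn/negP => /subset_leq_card; rewrite leqNgt => /negP; apply.
    by apply: leq_ltn_trans (leq_imset_card _ _) _; apply: leq_ltn_trans hy.
  case/setIdP: hA => hA yA; have [z yz eA] := edgeP (subsetP hF _ hA) yA.
  have zH : z \notin Hv by apply: contra nA => zH; rewrite eA; apply/imsetP; exists z.
  have := edge A hA; rewrite eA !inE negb_or eq_sym yx big_setU1 ?inE //= big_set1.
  have -> : x != z by apply: contraNneq zH => <-.
  move=> /(_ isT) hDD; apply: leq_trans (leq_trans (leq_addr 2 D) hDD) _.
  by rewrite leq_add2l light.
have [|E [hE hle]] := heavy Hv t cHv.
  move=> y; rewrite inE -ltnNge => /ltnW hy; rewrite leq_divRL //.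
  by apply: leq_trans hy; rewrite mulnC -mulnA leq_pmull.
apply: leq_trans hle _.
have sumE : \sum_(y in Hv) 'C(#|star F y|, t.+2) <=
    #|Full| * 'C(N, t.+2) + #|Hv :\: Full| * 'C(D, t.+2).
  rewrite (big_setID Full) /= (setIidPr FullHv) sumFull //.
  rewrite leq_add2l -sum_nat_const; apply: leq_sum => y /setDP[_ yF].
  exact/leq_bin2l/maxx.
have sumD : #|Full| * N + #|Hv :\: Full| * D <= l * N + s + c0.
  have h1 := sum_star_le Hv hF.
  have h2 : #|F :&: hit 2 Hv| <= #|F| by apply/subset_leq_card/subsetIl.
  have h3 : #|Full| * N + #|Hv :\: Full| * D <= \sum_(y in Hv) #|star F y| + #|Hv :\: Full| * h.
    rewrite (big_setID Full) /= (setIidPr FullHv) -addnA; apply: leq_add.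
      by rewrite -sum_nat_const; apply: leq_sum => y; rewrite inE => /eqP ->.
    rewrite -!sum_nat_const -big_split /=; apply: leq_sum => y /setDP[yH _].
    exact: heavyD.
  have h4 : #|Hv :\: Full| * h <= h ^ 2.
    rewrite -mulnn leq_mul2r (leq_trans _ cHv) ?orbT //.
    exact/subset_leq_card/subsetDl.
  have h5 : #|Hv| ^ 2 <= h ^ 2 by rewrite leq_exp2r.
  rewrite subnn bin0 muln1 in h1; apply: leq_trans h3 _.
  apply: leq_trans (leq_add (leq_trans h1 (leq_add h2 h5)) h4) _.
  by rewrite /c0 mul2n -addnn addnA !leq_add2r.
have cr : #|Full| + #|Hv :\: Full| = #|Hv| by rewrite cardsD (setIidPr FullHv) subnKC // subset_leq_card.
have := @flat_stars (l - #|Full|) #|Hv :\: Full| l D N s c0 E t.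
have -> : 0 < l - #|Full| <= l by rewrite subn_gt0 cFull leq_subr.
move=> /(_ isT); have -> : l - #|Full| + 2 <= #|Hv :\: Full| by move: cr cHl cFull; clear; lia.
move=> /(_ isT (dN x) sN); rewrite mulnBl.
have hmul : #|Full| * N <= l * N by rewrite leq_mul2r (ltnW cFull) orbT.
move=> /(_ _ hE b5 b6) hf.
have {}hf := hf _; have {hf} : #|Hv :\: Full| * 'C(D, t.+2) + E <=
   (l - #|Full|) * 'C(N, t.+2) + 'C(s, t.+2).
  by apply: hf; move: sumD hmul; clear; lia.
have hmul2 : #|Full| * 'C(N, t.+2) <= l * 'C(N, t.+2) by rewrite leq_mul2r (ltnW cFull) orbT.
rewrite mulnBl => hf; apply: leq_trans (leq_add sumE (leqnn E)) _; rewrite -addnA.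
by apply: leq_trans (leq_add (leqnn _) hf) _; rewrite addnA subnKC.
Qed.

End GraphFar.

(** * The lexicographic families maximise all clique counts *)

Section Small.
Variables n k : nat.
Implicit Types (E F G P : {set {set 'I_n}}).

Lemma ncl1 F : 0 < k -> F \subset ksets n k -> ncl F 1 = #|F|.
Proof.
move=> k0 hF; rewrite /ncl -[RHS](card_imset _ (@set1_inj _)).
apply: eq_card => Q; apply/cliquesP/imsetP => [[hQ _ /eqP/cards1P[A eA]]|[A hA ->]].
  by exists A => //; apply: (subsetP hQ); rewrite eA inE.
split; rewrite ?sub1set ?cards1 //; apply/intersectingP => B C.
rewrite !inE => /eqP -> /eqP ->; rewrite setIid.
exact: kset_neq0 k0 (subsetP hF _ hA).
Qed.

Lemma ncl_singletons F t : F \subset ksets n 1 -> ncl F t.+2 = 0.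
Proof.
move=> hF; apply/eqP; rewrite cards_eq0; apply/eqP/setP => Q; rewrite in_set0.
apply/negP => /cliquesP[hQ /intersectingP iQ cQ].
have /card_gt1P[A [B [hA hB AB]]] : 1 < #|Q| by rewrite cQ.
have single C : C \in Q -> exists x, C = [set x].
  by move=> /(subsetP hQ) /(subsetP hF); rewrite inE => /cards1P.
have [a ea] := single A hA; have [b eb] := single B hB.
have /set0Pn[x] := iQ _ _ hA hB; rewrite ea eb !inE => /andP[/eqP -> /eqP e].
by rewrite ea eb e eqxx in AB.
Qed.

(** Any sets through [x] form a clique, and a clique of positive size does not lie
    in both [E] and [P]. *)
Lemma ncl_add_star E P G x t : E \subset G -> P \subset G -> [disjoint E & P] ->
  {in P, forall A : {set 'I_n}, x \in A} ->
  ncl E t.+1 + 'C(#|P|, t.+1) <= ncl G t.+1.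
Proof.
move=> EG PG dEP hP; rewrite -(ncl_star _ hP) /ncl -cardsUI.
have -> : cliques E t.+1 :&: cliques P t.+1 = set0.
  apply/setP => Q; rewrite in_setI in_set0; apply/negP => /andP[].
  move=> /cliquesP[h1 _ cQ] /cliquesP[h2 _ _].
  have /card_gt0P[A hA] : 0 < #|Q| by rewrite cQ.
  by have := disjointFr dEP (subsetP h1 _ hA); rewrite (subsetP h2).
rewrite cards0 addn0; apply/subset_leq_card/subsetP => Q.
by case/setUP=> /cliquesP[h1 h2 h3]; apply/cliquesP; split=> //; apply: subset_trans h1 _.
Qed.

End Small.

Lemma ncl_lex_le_graph l : 0 < l -> exists n0, forall n m (F : {set {set 'I_n}}) t,
  n0 <= n -> 'C(n, 2) - 'C(n - l, 2) <= m ->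
  m <= 'C(n, 2) - 'C(n - l, 2) + n - l - 2 + 1 ->
  F \subset ksets n 2 -> #|F| = m -> ncl F t.+2 <= ncl (lex_family n 2 m) t.+2.
Proof.
move=> l0.
pose q := 4 * l.+2 ^ 2; pose g := 36 * l.+1 * q; pose h := 4 * g * l.+1.
pose c0 := 2 * h ^ 2.
pose u1 := 36 * l.+1 * q * h; pose u2 := 3 * q * h ^ 2; pose u3 := 2 * g * h.
pose u4 := 2 * (2 * c0 * l.+1 + c0 ^ 2 + l.+2 * l.+1).
pose u5 := 2 * (3 * l.+1 ^ 2 * c0 + 3 * l.+1 * c0 ^ 2 + c0 ^ 3).
(* Large enough for all size assumptions of [saturated_graph]. *)
exists (2 * u1 + u2 + u3 + u4 + u5 + 4 * h + l + 20) => n m F t hn h1 h2 hF cF.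
have hln : l + 2 <= n by move: hn; clear; lia.
have [X [K [cX cK dXK [hL1 Lk cL hK]]]] := lex_family_structure (isT : 0 < 2) hln h1 h2.
set L := lex_family n 2 m in hL1 Lk cL hK *.
have [G [Gk cG tG sG]] := exists_saturated t.+2 (isT : 0 < 2) hF.
apply: leq_trans tG _.
have cGL : #|G| = #|L| by rewrite cG cF cL.
pose s := m - #|hit 2 X|.
have cs : s <= n.-1.
  by rewrite /s card_hit cX; move: h2 hln; move: ('C(n, 2)) ('C(n - l, 2)); clear; lia.
have cGs : #|G| <= l * n.-1 + s.
  rewrite cGL cL; have := card_hit_le X (isT : 0 < 2); rewrite cX bin1 /s.
  by clear; lia.
have : [\/ exists2 X1 : {set 'I_n}, #|X1| = l & hit 2 X1 \subset G,
            exists2 X1 : {set 'I_n}, #|X1| = l.+1 & G \subset hit 2 X1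
          | forall t0, ncl G t0.+2 <= l * 'C(n.-1, t0.+2) + 'C(s, t0.+2)].
  apply: (saturated_graph Gk sG cGs cs);
    rewrite -/q -/g -/h -/c0 -/u1 -/u2 -/u3 -/u4 -/u5;
    by move: hn; clear; lia.
case.
- case=> X1 cX1 hX1.
  have small : 2 < 2 -> 64 <= 'C(n - 2, 2 - 2) /\
     4 * ((2 * 2 + (128 * (l * 2)) ^ 2) * ((l + 7 * 2) ^ 3 * 'C(n - 3, 2 - 3)))
     + 4 * (2 ^ 2 * 'C(n - 3, 2 - 3)) <= 'C(n - 2, 2 - 2) by [].
  exact: (ncl_full_stars (isT : 1 < 2) hln small _ cX1 hX1 Gk cX cK dXK hL1 Lk hK cGL).
- case=> X1 cX1 hX1; have /cards1P[z eK] : #|K| == 1 by rewrite cK.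
  have zX : z \notin X by move: dXK; rewrite eK disjoint_sym disjoints1.
  apply: (@ncl_star_cover _ X1 G (z |: X) z L) => //.
  + by rewrite cardsU1 zX cX cX1.
  + exact: setU11.
  + by rewrite setU1K.
  + apply/subsetP => A hA; case: (boolP (A \in hit 2 X)) => hAX.
      exact: (subsetP (hitS _ (subsetUr _ _))) hAX.
    have := hK A; rewrite in_setD hAX hA => /(_ isT); rewrite eK sub1set => zA.
    apply/hitP; split; last by exists z; rewrite ?setU11.
    by have /ksetsP := subsetP Lk _ hA.
- move=> /(_ t) hG; apply: leq_trans hG _.
  have /cards1P[z eK] : #|K| == 1 by rewrite cK.
  have hst : {in L :\: hit 2 X, forall A : {set 'I_n}, z \in A}.
    by move=> A /hK; rewrite eK sub1set.
  have dis : [disjoint hit 2 X & L :\: hit 2 X].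
    by rewrite disjoint_sym disjoints_subset setDE subsetIr.
  apply: leq_trans (ncl_add_star t.+1 hL1 (subsetDl _ _) dis hst).
  have -> : #|L :\: hit 2 X| = s by rewrite cardsD (setIidPr hL1) cL.
  rewrite leq_add2r; have := ncl_hit_ge X t.+2 (isT : 0 < 2).
  by rewrite cX subnn bin0 bin1 (@bin_small 1 t.+2) // muln0 addn0.
Qed.

Lemma ncl_lex_le_hyper k l : 2 < k -> exists n0, forall n m (F : {set {set 'I_n}}) t,
  n0 <= n -> 'C(n, k) - 'C(n - l, k) <= m ->
  m <= 'C(n, k) - 'C(n - l, k) + n - l - k + 1 ->
  F \subset ksets n k -> #|F| = m -> ncl F t.+2 <= ncl (lex_family n k m) t.+2.
Proof.
move=> k3; have k0 : 0 < k by apply: ltn_trans k3.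
have k1 : 1 < k by apply: ltn_trans k3.
pose c := l.+1; pose q := 16 * l; pose g := 18 * c * q * k; pose h := g * k * c.
pose u1 := 18 * c * q * h * k; pose u2 := h * k + k * k; pose u3 := 3 * q * h ^ 2.
pose u4 := 8 * l * (2 + h ^ 2); pose u5 := 16 * l ^ 3.
pose u6 := 4 * l * (2 + (l ^ 2 + l * k)).
(* [S * N2 <= N] implies the assumptions of [saturated_full] and
   [few_almost_full], and [S3 * N3 <= N2] that of [ncl_full_stars]. *)
pose S := 2 * u1 + 2 * u2 + u3 + u4 + u5 + u6 + 4.
pose S3 := 4 * ((2 * k + (128 * (l * k)) ^ 2) * (l + 7 * k) ^ 3) + 4 * k ^ 2.
exists (S * k + S3 * k + l + k + 70) => n m F t hn h1 h2 hF cF.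
have [hln nS nS3 n70] : [/\ l + k <= n, S * k <= n.-1, S3 * k <= n - 2 & k + 70 <= n].
  by move: hn; move: (S * k) (S3 * k); clear => a b; split; lia.
pose N := 'C(n.-1, k.-1); pose N2 := 'C(n - 2, k - 2); pose N3 := 'C(n - 3, k - 3).
have r1 : S * N2 <= N.
  apply: codeg_small => //; apply: leq_trans (_ : S * k <= _).
    by rewrite leq_mul2l leq_pred orbT.
  exact: nS.
have r2 : S3 * N3 <= N2.
  have := @codeg_small n.-1 k.-1 S3.
  have -> : n.-1 - 2 = n - 3 by clear; lia.
  have -> : k.-1 - 2 = k - 3 by move: k3; clear; lia.
  have -> : n.-1.-1 = n - 2 by clear; lia.
  have -> : k.-1.-1 = k - 2 by move: k3; clear; lia.
  apply; first by move: k3; clear; lia.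
  apply: leq_trans (_ : S3 * k <= _); first by rewrite leq_mul2l leq_subr orbT.
  exact: nS3.
have nN2 : n - 2 <= N2.
  by apply: bin_geq; move: k3 n70; clear; lia.
have n2 : n <= 2 * N2 by move: nN2 n70; clear; lia.
have N64 : 64 <= N2 by move: nN2 n70; clear; lia.
have [X [K [cX cK dXK [hL1 Lk cL hK]]]] := lex_family_structure k0 hln h1 h2.
set L := lex_family n k m in hL1 Lk cL hK *.
have [G [Gk cG tG sG]] := exists_saturated t.+2 k0 hF.
apply: leq_trans tG _.
have cGL : #|G| = #|L| by rewrite cG cF cL.
have small : 2 < k -> 64 <= N2 /\
    4 * ((2 * k + (128 * (l * k)) ^ 2) * ((l + 7 * k) ^ 3 * N3)) + 4 * (k ^ 2 * N3) <= N2.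
  move=> _; split=> //; apply: leq_trans r2; rewrite /S3.
  move: (2 * k + _) => A; move: (_ ^ 3) (k ^ 2) N3; clear; lia.
have full (X1 : {set 'I_n}) : #|X1| = l -> hit k X1 \subset G -> ncl G t.+2 <= ncl L t.+2.
  by move=> cX1 hX1; apply: (ncl_full_stars k1 hln small _ cX1 hX1 Gk cX cK dXK hL1 Lk hK cGL).
have [l00|l0] := posnP l.
  apply: (full set0); first by rewrite cards0 l00.
  by rewrite hit_bigcup big_set0 sub0set.
have hitle : #|hit k X| <= #|G| by rewrite cGL; apply: subset_leq_card.
have cGn : #|G| <= l * N + n.
  rewrite cG cF; have := card_hit_le X k0; rewrite -/N cX card_hit cX.
  by move: h2 hln k0; move: ('C(n, k)) ('C(n - l, k)) (l * N); clear; lia.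
have sm Y : Y <= S -> Y * N2 <= N.
  by move=> hY; apply: leq_trans r1; rewrite leq_mul2r hY orbT.
have N20 : 0 < N2 by apply: leq_trans N64.
case: (leqP l #|almost_full k l G|) => [/subset_of_card[X1 hX1 cX1]|hbig].
  apply: (full X1 cX1); apply: (saturated_full l0 Gk sG hX1 cX1).
    by rewrite cGn andbT; move: hitle; rewrite !card_hit cX cX1.
  have : u6 * N2 <= N by apply: sm; rewrite /S; clear; lia.
  have : 4 * N2 <= N by apply: sm; rewrite /S; clear; lia.
  rewrite /u6 => f1 f2; apply: leq_ltn_trans (_ : N < _).
    apply: leq_trans f2; rewrite -[leqRHS]mulnA leq_mul2l [(2 + _) * N2]mulnDl leq_add2r.
    by rewrite n2 orbT.
  by rewrite -/N; move: f1 N20; clear; lia.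
have := @few_almost_full n k l k0 l0 G t Gk cGn.
rewrite -/c -/q -/g -/h -/N -/N2 -/u1 -/u2 -/u3 -/u5 => few.
have {few} : ncl G t.+2 + l ^ 2 * 'C(N2, t.+2) <= l * 'C(N, t.+2).
  have f4 : 4 * N2 <= N by apply: sm; rewrite /S; clear; lia.
  have f1 : (2 * u1 + 2) * N2 <= N by apply: sm; rewrite /S; clear; lia.
  have f2 : 2 * u2 * N2 <= N by apply: sm; rewrite /S; clear; lia.
  apply: few => //.
  - by apply: leq_trans n2 _; move: f4; clear; lia.
  - by move: f4 N20; clear; lia.
  - by move: f1 N20; rewrite mulnDl -mulnA; move: (u1 * N2); clear; lia.
  - by move: f2; rewrite -mulnA; move: (u2 * N2); clear; lia.
  - by apply: sm; rewrite /S; clear; lia.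
  - apply: leq_trans (_ : u4 * N2 <= _); last by apply: sm; rewrite /S; clear; lia.
    by rewrite /u4 -[leqRHS]mulnA leq_mul2l [(2 + _) * N2]mulnDl leq_add2r n2 orbT.
  - by apply: sm; rewrite /S; clear; lia.
have := ncl_hit_ge X t.+2 k0; rewrite cX -/N -/N2 => f1 f2.
apply: leq_trans (ncl_sub t.+2 hL1).
by rewrite -(leq_add2r (l ^ 2 * 'C(N2, t.+2))); apply: leq_trans f2 f1.
Qed.

(** Without full stars ([l = 0]) only the first comparison is needed; for [k = 1]
    two distinct sets never meet. *)
Lemma ncl_lex_le k l : 0 < k -> exists n0, forall n m (F : {set {set 'I_n}}) t,
  n0 <= n -> 'C(n, k) - 'C(n - l, k) <= m ->
  m <= 'C(n, k) - 'C(n - l, k) + n - l - k + 1 ->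
  F \subset ksets n k -> #|F| = m -> ncl F t.+2 <= ncl (lex_family n k m) t.+2.
Proof.
case: k => [//|[|[|k]]] _; last exact: ncl_lex_le_hyper.
  by exists 0 => n m F t _ _ _ hF _; rewrite (ncl_singletons _ hF).
case: l => [|l]; last exact: ncl_lex_le_graph.
exists 2 => n m F t hn h1 h2 hF cF; have {}hn : 0 + 2 <= n by [].
have [X [K [cX cK dXK [hL1 Lk cL hK]]]] := lex_family_structure (isT : 0 < 2) hn h1 h2.
have small : 2 < 2 -> 64 <= 'C(n - 2, 2 - 2) /\
     4 * ((2 * 2 + (128 * (0 * 2)) ^ 2) * ((0 + 7 * 2) ^ 3 * 'C(n - 3, 2 - 3)))
     + 4 * (2 ^ 2 * 'C(n - 3, 2 - 3)) <= 'C(n - 2, 2 - 2) by [].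
apply: (ncl_full_stars (isT : 1 < 2) hn small _ (cards0 _) _ hF cX cK dXK hL1 Lk hK).
  by rewrite hit_bigcup big_set0 sub0set.
by rewrite cF cL.
Qed.

Theorem corollary1p5 (k l : nat) (hk : (1 <= k)%N) :
  exists n0 : nat, forall (R : realType) (n m : nat),
    (n0 <= n)%N ->
    ('C(n, k) - 'C(n - l, k) <= m)%N ->
    (m <= 'C(n, k) - 'C(n - l, k) + n - l - k + 1)%N ->
    most_probably_intersecting R n k m (lex_family n k m).
Proof.
have [n0 hn0] := ncl_lex_le l hk.
exists (n0 + l + k) => R n m hn h1 h2.
have hln : l + k <= n by move: hn; clear; lia.
have [X [K [_ _ _ [_ Lk cL _]]]] := lex_family_structure hk hln h1 h2.
apply: most_probably_of_ncl => // F [|[|t]] hF cF.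
- by rewrite !ncl0.
- by rewrite !(ncl1 hk) // cF cL.
- by apply: hn0 => //; move: hn; clear; lia.
Qed.
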